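(* Let $\Gamma\subseteq\mathbb{R}^{n}$ be a closed convex cone with vertex at the origin, let $P$ be a homogeneous polynomial of degree $d$ such that $\operatorname{Re}P(iu)<0$ for all $u\in\Gamma\setminus\{0\}$, and let $f\in\mathcal{S}'(\mathbb{R}^{n})$ with $\operatorname{supp}\hat{f}\subseteq\Gamma$. Let $U$ be the solution, within the class of functions of slow growth over $\mathbb{H}^{n+1}$, of the Cauchy problem $$\frac{\partial}{\partial t}U(x,t)=P\left(\frac{\partial}{\partial x}\right)U(x,t),\quad (x,t)\in\mathbb{H}^{n+1},\qquad\lim_{t\to0^{+}}U(x,t)=f(x)\ \text{ in }\mathcal{S}'(\mathbb{R}^{n}_{x}).$$ Let $\alpha\in\mathbb{R}$ and let $L$ be slowly varying at infinity. If $U$ stabilizes along $d$-curves, with respect to $\lambda^{\alpha}L(\lambda)$, then $U$ stabilizes in time with respect to $T(t)=t^{\alpha/d}L(t^{1/d})$; that is, there is a constant $\ell\in\mathbb{C}$ such that $$\lim_{t\to\infty}\frac{U(x,t)}{T(t)}=\ell\quad\text{for each }x\in\mathbb{R}^{n}.$$ Moreover, this limit holds uniformly for $x$ in compacts of $\mathbb{R}^{n}$.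
   Context: $\mathbb{N}=\{0,1,2,\dots\}$, $\mathbb{H}^{n+1}=\mathbb{R}^{n}\times(0,\infty)$, $\mathbb{S}^{n}$ is the unit sphere of $\mathbb{R}^{n+1}$, and $\hat{\varphi}(u)=\int_{\mathbb{R}^{n}}\varphi(t)e^{-iu\cdot t}\,\mathrm{d}t$. A function $U$ on $\mathbb{H}^{n+1}$ is of slow growth if $\sup_{(x,t)\in\mathbb{H}^{n+1}}|U(x,t)|\left(t+\frac1t\right)^{-k_{1}}(1+|x|)^{-k_{2}}<\infty$ for some $k_{1},k_{2}\in\mathbb{N}$. The Cauchy problem above has a unique solution in this class, namely $U(x,t)=(2\pi)^{-n}\langle\hat{f}(u),e^{ix\cdot u}e^{tP(iu)}\rangle$ (the pairing makes sense because $\operatorname{supp}\hat f\subseteq\Gamma$ and, for each $t>0$, there is a function in $\mathcal{S}(\mathbb{R}^n)$ coinciding with $e^{tP(iu)}$ for $u\in\Gamma$). $L$ is slowly varying at infinity if it is a positive measurable function on some $(A,\infty)$ with $\lim_{\lambda\to\infty}L(a\lambda)/L(\lambda)=1$ for each $a>0$. $U$ stabilizes along $d$-curves (at infinity) with respect to $\lambda^{\alpha}L(\lambda)$ if: (1) the limits $\lim_{\lambda\to\infty}\frac{U(\lambda x,\lambda^{d}t)}{\lambda^{\alpha}L(\lambda)}=U_{0}(x,t)$ exist for every $(x,t)\in\mathbb{H}^{n+1}\cap\mathbb{S}^{n}$; and (2) there are constants $C>0$, $l\in\mathbb{N}$ and $\lambda_0>0$ such that $\left|\frac{U(\lambda x,\lambda^{d}t)}{\lambda^{\alpha}L(\lambda)}\right|\leq\frac{C}{t^{l}}$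 for all $(x,t)\in\mathbb{H}^{n+1}\cap\mathbb{S}^{n}$ and all $\lambda\ge\lambda_0$. *)

(* Defs.v *)
(* Points of R^n are row vectors over an abstract R : realType. *)
From HB Require Import structures.
From mathcomp Require Import all_boot all_order all_algebra.
From mathcomp Require Import all_classical all_reals all_analysis.
From mathcomp Require Import complex.
(* The notations of mpoly clash with those of mathcomp-analysis. *)
From mathcomp Require Import -(notations) mpoly.

Set Implicit Arguments.
Unset Strict Implicit.
Unset Printing Implicit Defensive.

Import Order.TTheory GRing.Theory Num.Theory.
Import numFieldNormedType.Exports.
Import ComplexField.Normc.

(* The usual topology of the complex plane: R[i] is a numClosedFieldType, and  *)
(* its norm topology is transferred to the concrete type R[i].                 *)
Set Warnings "-redundant-canonical-projection".
#[export] HB.instance Definition _ (R : realType) :=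
  NormedModule.copy R[i] (R[i] : numClosedFieldType)^o.
Set Warnings "redundant-canonical-projection".

Local Open Scope classical_set_scope.
Local Open Scope complex_scope.
Local Open Scope ring_scope.

Section Euclidean.
Context {R : realType} {n : nat}.
Implicit Types u x : 'rV[R]_n.

Definition dot u x : R := \sum_i u 0 i * x 0 i.

(* The library norm of 'rV[R]_n is the sup norm. *)
Definition enorm x : R := Num.sqrt (dot x x).

Definition closed_convex_cone (Gamma : set 'rV[R]_n) : Prop :=
  [/\ closed Gamma, convex_set Gamma, Gamma 0 &
      forall (a : R) x, 0 < a -> Gamma x -> Gamma (a *: x)].

Definition imag_vec u : 'I_n -> R[i] := fun j => 0 +i* u 0 j.

End Euclidean.

Definition expi {R : realType} (theta : R) : R[i] := cos theta +i* sin theta.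

Section Derivatives.
Context {R : realType}.

(* Complex-valued functions are differentiated through real and imaginary      *)
(* parts, since derive requires both spaces to have the same scalars.          *)
Definition cderivable {V : normedModType R} (g : V -> R[i]) (x v : V) : Prop :=
  derivable (fun y => complex.Re (g y)) x v /\
  derivable (fun y => complex.Im (g y)) x v.

Definition cderive {V : normedModType R} (v : V) (g : V -> R[i]) (x : V) :
    R[i] :=
  'D_v (fun y => complex.Re (g y)) x +i* 'D_v (fun y => complex.Im (g y)) x.

Context {n : nat}.
Implicit Types phi : 'rV[R]_n -> R[i].

Definition base (i : 'I_n) : 'rV[R]_n := delta_mx 0 i.

Definition partials (s : seq 'I_n) phi : 'rV[R]_n -> R[i] :=
  foldr (fun i g => cderive (base i) g) phi s.

(* The sequence of indices, with repetitions, encoded by a multi-index. *)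
Definition indices (m : multinom n) : seq 'I_n :=
  flatten [seq nseq (m i) i | i <- enum 'I_n].

(* P(d/dx) *)
Definition diff_op (P : mpoly n R[i]) phi (x : 'rV[R]_n) : R[i] :=
  \sum_(m <- msupp P) mcoeff m P * partials (indices m) phi x.

Definition smooth phi : Prop :=
  forall s : seq 'I_n, continuous (partials s phi) /\
    forall i x, cderivable (partials s phi) x (base i).

(* phi is in C_c^oo(O) *)
Definition test_function (O : set 'rV[R]_n) phi : Prop :=
  let K := closure [set x | phi x != 0] in
  [/\ smooth phi, compact K & K `<=` O].

End Derivatives.

Section Integral.
Context {R : realType}.

(* Iterated Lebesgue integral over R^n.  It is only used for products of a     *)
(* rapidly decreasing function and a continuous function of polynomial growth, *)
(* for which it is the integral for the n-dimensional Lebesgue measure.        *)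
Fixpoint iint (n : nat) : ('rV[R]_n -> R) -> R :=
  match n with
  | 0%N => fun g => g 0
  | m.+1 => fun g =>
      \int[@lebesgue_measure R]_a
        iint (fun y : 'rV[R]_m => g (row_mx a%:M y : 'rV[R]_(1 + m)))
  end.

Definition cint (n : nat) (g : 'rV[R]_n -> R[i]) : R[i] :=
  iint (fun x => complex.Re (g x)) +i* iint (fun x => complex.Im (g x)).

Definition fourier (n : nat) (phi : 'rV[R]_n -> R[i]) (u : 'rV[R]_n) : R[i] :=
  cint (fun t => phi t * expi (- dot u t)).

End Integral.

Section Distributions.
Context {R : realType} {n : nat}.
Implicit Types (phi psi : 'rV[R]_n -> R[i]) (f : ('rV[R]_n -> R[i]) -> R[i]).

(* The norms p_k(phi) = sup of (1 + |x|)^k |D^s phi(x)| over x and the orders  *)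
(* of differentiation at most k define the topology of the Schwartz space;     *)
(* this is p_k(phi) <= b.                                                      *)
Definition seminorm_le (k : nat) phi (b : R) : Prop :=
  forall (s : seq 'I_n) x, (size s <= k)%N ->
    (1 + enorm x) ^+ k * normc (partials s phi x) <= b.

Definition schwartz phi : Prop :=
  smooth phi /\ forall k, exists b : R, seminorm_le k phi b.

(* A tempered distribution is a functional on all functions of which only the  *)
(* restriction to the Schwartz space is meaningful.                            *)
Definition tempered_distribution f : Prop :=
  (forall (a : R[i]) phi psi, schwartz phi -> schwartz psi ->
     f (fun x => a * phi x + psi x) = a * f phi + f psi) /\
  (forall phi, schwartz phi -> forall e : R, 0 < e ->
     exists k (delta : R), 0 < delta /\
       forall psi, schwartz psi ->
         seminorm_le k (fun x => psi x - phi x) delta ->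
         normc (f psi - f phi) < e).

Definition dfourier f : ('rV[R]_n -> R[i]) -> R[i] :=
  fun phi => f (fourier phi).

Definition dsupp f : set 'rV[R]_n :=
  ~` [set x | exists O : set 'rV[R]_n,
        [/\ open O, O x & forall phi, test_function O phi -> f phi = 0]].

End Distributions.

(* A function on the half-space R^n x (0, oo) is a total function              *)
(* U : 'rV[R]_n -> R -> R[i] whose values U x t with t <= 0 are irrelevant.    *)
Section HalfSpace.
Context {R : realType} {n : nat}.
Implicit Type U : 'rV[R]_n -> R -> R[i].

Definition slow_growth U : Prop :=
  exists (k1 k2 : nat) (C : R), forall x t, 0 < t ->
    normc (U x t) * (t + t^-1) ^- k1 * (1 + enorm x) ^- k2 <= C.

(* U is continuous on the half-space, together with dU/dt and the derivatives  *)
(* in x of order at most d.                                                    *)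
Definition regular (d : nat) U : Prop :=
  [/\ forall x t, 0 < t -> cderivable (U x) t 1,
      forall z : 'rV[R]_n * R, 0 < z.2 ->
        {for z, continuous (fun w : 'rV[R]_n * R => cderive (1 : R) (U w.1) w.2)},
      forall (s : seq 'I_n) i x t, (size s < d)%N -> 0 < t ->
        cderivable (partials s (U ^~ t)) x (base i) &
      forall (s : seq 'I_n) (z : 'rV[R]_n * R), (size s <= d)%N -> 0 < z.2 ->
        {for z, continuous
           (fun w : 'rV[R]_n * R => partials s (U ^~ w.2) w.1)}].

(* U is a classical solution of dU/dt = P(d/dx) U, P having degree d, with     *)
(* U(., t) --> f in S' as t --> 0+.                                            *)
Definition cauchy_solution (d : nat) (P : mpoly n R[i])
    (f : ('rV[R]_n -> R[i]) -> R[i]) U : Prop :=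
  [/\ regular d U,
      forall x t, 0 < t -> cderive (1 : R) (U x) t = diff_op P (U ^~ t) x &
      forall phi, schwartz phi ->
        cint (fun x => U x t * phi x) @[t --> 0^'+] --> f phi].

Definition stabilizes_along_dcurves (d : nat) (rho : R -> R) U : Prop :=
  (exists U0 : 'rV[R]_n -> R -> R[i],
     forall x t, 0 < t -> dot x x + t ^+ 2 = 1 ->
       U (lambda *: x) (lambda ^+ d * t) / (rho lambda)%:C
         @[lambda --> +oo] --> U0 x t) /\
  (exists (C : R) (l : nat) (lambda0 : R), [/\ 0 < C, 0 < lambda0 &
     forall x t lambda, 0 < t -> dot x x + t ^+ 2 = 1 -> lambda0 <= lambda ->
       normc (U (lambda *: x) (lambda ^+ d * t) / (rho lambda)%:C)
         <= C / t ^+ l]).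

End HalfSpace.

Definition slowly_varying {R : realType} (L : R -> R) : Prop :=
  exists A : R, [/\ forall x, A < x -> 0 < L x,
    measurable_fun (`]A, +oo[%classic : set R) L &
    forall a : R, 0 < a -> L (a * x) / L x @[x --> +oo] --> (1 : R)].

(* Main.v *)
(* Write rho(k) = k^alpha L(k).  At the point (0, 1) the hypothesis gives        *)
(* U(0, k^d) / rho(k) --> l, so it suffices that                                *)
(* |U(x, k^d) - U(0, k^d)| <= C rho(k) |x| / k for |x| <= k.                    *)
(* For a test function phi, put uhat(t, phi) = int U(x, t) fourier(phi)(x) dx.  *)
(* The equation makes uhat(t, e^(-tP(iu)) phi) independent of t > 0 (integrate  *)
(* by parts against spatial cutoffs), and letting t --> 0                       *)
(* shows that uhat(t, .) vanishes on test functions supported off supp f^.      *)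
(* Hence b(e k u) (e^(i k y.u) - 1), with b a compactly supported approximation *)
(* of 1, may be multiplied by e^((k^d/2) P(iu)) chi(k u), where chi = 1 on      *)
(* Gamma and e^(P/2) chi is a Schwartz function, when k^d is replaced by        *)
(* k^d / 2.  This bounds U(k y, k^d) - U(0, k^d) by C |y| times                 *)
(* sup_w |U(k w, k^d/2)| (1 + |w|)^-N, uniformly in e and k.  Finally (w, 1/2)  *)
(* lies on the d-curve of a point of the unit sphere, with a dilation factor    *)
(* a in [1/2, 1 + |w|], so the second stabilization hypothesis and the bound    *)
(* rho(a k) <= C (1 + a)^M rho(k) for slowly varying L control the supremum by  *)
(* rho(k).                                                                      *)
Require Import Defs.
From HB Require Import structures.
From mathcomp Require Import all_boot all_order all_algebra.
From mathcomp Require Import all_classical all_reals all_analysis.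
From mathcomp Require Import complex.
From mathcomp Require Import -(notations) mpoly.
From mathcomp Require Import measurable_realfun.
From mathcomp Require Import ring lra.
Import Order.TTheory GRing.Theory Num.Theory.
Import numFieldNormedType.Exports.
Import ComplexField.Normc.
Local Open Scope classical_set_scope.
Local Open Scope complex_scope.
Local Open Scope ring_scope.
Set Implicit Arguments.
Unset Strict Implicit.
Unset Printing Implicit Defensive.

(** * Iterated integrals of weighted functions *)

(** On the time axis the limit is given: the first stabilization hypothesis at the point [(0, 1)] of
    the sphere says that U(0, k^d) / rho(k) converges. What remains is a gradient bound. [spreading]
    bounds U(k y, k^d) - U(0, k^d) by |y| times a polynomially weighted supremum of U(k w, k^d / 2);
    with y = x / k this makes the oscillation over a fixed compact set O(rho(k) / k), as carried out
    in [stabilization_estimate].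

    The gradient bound is parabolic smoothing seen on the Fourier side. Formally U(., t) has Fourier
    transform exp(t P(iu)) f^, carried by Gamma, and passing from time k^d / 2 to k^d multiplies it
    by exp((k^d / 2) P(iu)). By homogeneity this is the fixed function exp(P / 2) evaluated at k u,
    and it decreases rapidly on Gamma because Re P(iu) <= - c |u|^d there ([cone_constant]). Since U
    is given only as a solution of the Cauchy problem, these facts are derived from the equation:
    [uhat_evolution] is the multiplication law, [uhat_support] says that there is no spectrum
    outside the support of f^, and [uhat_cone_cut] combines them to replace exp(P / 2), which may
    grow off the cone, by the Schwartz function [kernel]. The law holds for compactly supported test
    functions, so point values of U are recovered through an approximate identity with compact
    spectrum ([approximate_identity], [bandlimit_mass_neq0]).

    The weighted supremum is controlled in [dcurve_growth]: (w, 1/2) lies on the d-curve of a point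
    of the sphere, with a dilation factor a at most 1 + |w|, and [regular_growth] compares rho(a k)
    with rho(k). That comparison comes from [slowly_varying_doubling], the passage from pointwise to
    locally uniform slow variation.

    All constants must be independent of the auxiliary parameters. For this reason smooth functions
    are handled as indexed families whose derivatives obey bounds uniform in the index ([reg],
    [csreg]). *)

Section Sequences.
Context {R : realType}.

Definition countable_base {T} (F : set_system T) : Prop :=
  exists B : nat -> set T, (forall n, F (B n)) /\
    forall A, F A -> exists N, forall n, (N <= n)%N -> B n `<=` A.

(** If convergence fails, every [B n] contains a point whose image stays at distance [e] from the
    limit, and choosing such points gives a sequence along [F] that contradicts the hypothesis. It
    carries dominated convergence of sequences over to [nbhs x] and to one-sided limits. *)
Lemma cvg_sequentially {T} (F : set_system T) {FF : Filter F}
    (V : normedModType R) (f : T -> V) (l : V) : countable_base F ->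
  (forall u : nat -> T, (forall A, F A -> \forall n \near \oo, A (u n)) ->
     f (u n) @[n --> \oo] --> l) ->
  f x @[x --> F] --> l.
Proof.
move=> [B [FB Bsub]] H; apply: contrapT => nfl.
have [e e0 nF] : exists2 e : R, 0 < e & ~ F [set x | `|l - f x| < e].
  apply: contrapT => H'; apply: nfl; apply/cvgrPdist_lt => e e0.
  by apply: contrapT => nF; apply: H'; exists e.
have /choice[u uP] : forall n, exists x, B n x /\ e <= `|l - f x|.
  move=> n; apply: contrapT => H'; apply: nF; apply: filterS (FB n) => x Bx /=.
  by rewrite ltNge; apply/negP => le; apply: H'; exists x.
have /H /cvgrPdist_lt /(_ _ e0)[N _ NP] :
    forall A, F A -> \forall n \near \oo, A (u n).
  by move=> A /Bsub[N NB]; exists N => // n /= /NB; apply; exact: (uP n).1.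
by have := NP N (leqnn N); rewrite ltNge (uP N).2.
Qed.

Lemma near_dist {V : normedModType R} (x : V) (e : R) :
  0 < e -> \forall z \near x, `|x - z| < e.
Proof. by move=> e0; apply: cvgr_dist_lt e0; exact: cvg_id. Qed.

Lemma lipschitz_continuous {V W : normedModType R} (k : R) (f : V -> W) :
  (forall x y, `|f x - f y| <= k * `|x - y|) -> continuous f.
Proof.
move=> fk x; apply/cvgrPdist_lt => e e0.
have k0 : 0 < `|k| + 1 by rewrite ltr_wpDl.
apply: filterS (near_dist x (divr_gt0 e0 k0)) => z.
rewrite ltr_pdivlMr// mulrC; apply: le_lt_trans; apply: le_trans (fk _ _) _.
by rewrite ler_wpM2r//; apply: le_trans (ler_norm k) _; rewrite lerDl.
Qed.

Lemma countable_base_nbhs {V : normedModType R} (x : V) :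
  countable_base (nbhs x).
Proof.
exists (fun n => ball x n.+1%:R^-1); split=> [n|A /nbhs_ballP[e /= e0 eA]].
  by apply: nbhsx_ballx; rewrite invr_gt0.
have [N _ NP] := near_infty_natSinv_lt (PosNum e0).
exists N => n Nn; apply: subset_trans eA; apply: le_ball.
exact/ltW/(NP n Nn).
Qed.

Lemma countable_base_within {T} (F : set_system T) {FF : Filter F} (D : set T) :
  countable_base F -> countable_base (within D F).
Proof.
move=> [B [FB Bsub]]; exists (fun n => B n `&` D); split=> [n|A /Bsub[N NP]].
  by apply: filterS (FB n) => x Bx Dx.
by exists N => n Nn x [Bx Dx]; exact: (NP n Nn).
Qed.

End Sequences.

(** * Row vectors: coordinates and slicing *)

Section RowVectors.
Context {R : realType}.

Lemma coord_le_norm n (x : 'rV[R]_n) i : `|x 0 i| <= `|x|.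
Proof.
have /mapP[j Hj ->] : `|x ord0 i| \in [seq `|x y.1 y.2| | y : 'I_1 * 'I_n].
  by apply/mapP; exists (ord0, i) => //=; rewrite mem_enum.
by rewrite [leRHS]/Num.Def.normr /= mx_normrE; apply/bigmax_geP; right => /=; exists j.
Qed.

Lemma norm_le_coord n (x : 'rV[R]_n) (e : R) :
  0 <= e -> (forall i, `|x 0 i| <= e) -> `|x| <= e.
Proof.
move=> e0 H; rewrite [leLHS]/Num.Def.normr /= mx_normrE.
by apply/bigmax_leP; split => // -[i j] _ /=; rewrite ord1.
Qed.

(** The decomposition over which [iint] iterates, with dimension [m.+1] instead of [1 + m]. *)
Definition vcons m (a : R) (y : 'rV[R]_m) : 'rV[R]_m.+1 :=
  row_mx (a%:M : 'M[R]_1) y.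

Lemma vcons0 m a (y : 'rV[R]_m) : vcons a y 0 ord0 = a.
Proof.
have -> : (ord0 : 'I_m.+1) = lshift m (ord0 : 'I_1) by apply/val_inj.
by apply: etrans (@row_mxEl _ 1 1 m a%:M y 0 ord0) _; rewrite mxE eqxx mulr1n.
Qed.

Lemma vconsS m a (y : 'rV[R]_m) i : vcons a y 0 (lift ord0 i) = y 0 i.
Proof.
have -> : (lift ord0 i : 'I_m.+1) = rshift 1 i by apply/val_inj.
exact: (@row_mxEr _ 1 1 m a%:M y 0 i).
Qed.

Lemma vconsP m (x : 'rV[R]_m.+1) : exists a y, x = vcons a y.
Proof.
exists (x 0 ord0), (\row_i x 0 (lift ord0 i)); apply/rowP => i.
by case: (unliftP ord0 i) => [j|] ->; rewrite ?vcons0 ?vconsS ?mxE.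
Qed.

Lemma vconsD m a b (y z : 'rV[R]_m) : vcons a y + vcons b z = vcons (a + b) (y + z).
Proof.
apply/rowP => i; rewrite mxE.
by case: (unliftP ord0 i) => [j|] ->; rewrite ?vcons0 ?vconsS ?mxE.
Qed.

Lemma vconsZ m k a (y : 'rV[R]_m) : k *: vcons a y = vcons (k * a) (k *: y).
Proof.
apply/rowP => i; rewrite mxE.
by case: (unliftP ord0 i) => [j|] ->; rewrite ?vcons0 ?vconsS ?mxE.
Qed.

Lemma vcons_dist m a b (y z : 'rV[R]_m) :
  `|vcons a y - vcons b z| <= `|a - b| + `|y - z|.
Proof.
apply: norm_le_coord => [|i]; first by rewrite addr_ge0.
rewrite mxE [X in _ + X]mxE; case: (unliftP ord0 i) => [j|] ->;
  rewrite ?vcons0 ?vconsS.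
  by have := coord_le_norm (y - z) j; rewrite mxE [X in _ + X]mxE => H; apply: le_trans H _; rewrite lerDr.
by rewrite lerDl.
Qed.

Lemma vcons_continuousr m a : continuous (@vcons m a).
Proof.
apply: (@lipschitz_continuous _ _ _ 1) => y z; rewrite mul1r.
by apply: le_trans (vcons_dist _ _ _ _) _; rewrite subrr normr0 add0r.
Qed.

Lemma vcons_continuousl m (y : 'rV[R]_m) : continuous (fun a => vcons a y).
Proof.
apply: (@lipschitz_continuous _ _ _ 1) => a b; rewrite mul1r.
by apply: le_trans (vcons_dist _ _ _ _) _; rewrite subrr normr0 addr0.
Qed.

End RowVectors.

(** * An integrable weight compatible with slicing *)

Section Weight.
Context {R : realType}.
Let mu := @lebesgue_measure R.

Definition weight1 (x : R) : R := (oneDsqr x)^-1.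

Lemma weight1_gt0 x : 0 < weight1 x.
Proof. by rewrite invr_gt0. Qed.

Lemma weight1_ge0 x : 0 <= weight1 x.
Proof. exact/ltW/weight1_gt0. Qed.

Lemma weight1_le1 x : weight1 x <= 1.
Proof. exact: oneDsqrV_le1. Qed.

Lemma weight1_continuous : continuous weight1.
Proof. exact: continuous_oneDsqrV. Qed.

(** Being a product, it leaves a weight of the same kind when a coordinate is fixed, so domination
    passes to slices. *)
Definition weight n (x : 'rV[R]_n) : R := \prod_i weight1 (x 0 i).

Lemma weight_ge0 n (x : 'rV[R]_n) : 0 <= weight x.
Proof. by apply: prodr_ge0 => i _; rewrite weight1_ge0. Qed.

Lemma weight_vcons m a (y : 'rV[R]_m) :
  weight (vcons a y) = weight1 a * weight y.
Proof.
rewrite /weight big_ord_recl vcons0; congr (_ * _).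
by apply: eq_bigr => i _; rewrite vconsS.
Qed.

Lemma integrable_oneDsqrV : mu.-integrable setT (EFin \o weight1).
Proof.
apply/integrableP; split.
  apply/measurable_EFinP; apply: continuous_measurable_fun.
  exact: weight1_continuous.
have -> : (\int[mu]_x `|(EFin \o weight1) x| =
    \int[mu]_x (weight1 x)%:E)%E.
  by apply: eq_integral => x _; rewrite gee0_abs//= lee_fin weight1_ge0.
rewrite ge0_symfun_integralT//.
- by rewrite -set_itvcy integral0y_oneDsqr ltey.
- by move=> x; rewrite weight1_ge0.
- exact: weight1_continuous.
- by move=> x /=; rewrite /weight1 /oneDsqr sqrrN.
Qed.

Definition wmass : R := \int[mu]_x weight1 x.

(** The class in which integrals are computed: continuity gives measurability, the weight gives
    integrability, and both are inherited by slices, so that one variable can be treated at a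
    time. *)
Definition wbounded C n (g : 'rV[R]_n -> R) : Prop :=
  continuous g /\ forall x, `|g x| <= C * weight x.

Definition wbounded1 C (g : R -> R) : Prop :=
  continuous g /\ forall x, `|g x| <= C * weight1 x.

Lemma wbounded1_integrable C g :
  wbounded1 C g -> mu.-integrable setT (EFin \o g).
Proof.
move=> [cg gC].
have i1 : mu.-integrable setT (EFin \o (fun x => C * weight1 x)).
  have := @integrableZl _ _ _ mu setT measurableT C _ integrable_oneDsqrV.
  by apply: eq_integrable.
apply: (le_integrable _ _ _ i1) => //.
  by apply/measurable_EFinP; exact: continuous_measurable_fun.
move=> x _ /=; rewrite lee_fin; apply: le_trans (gC x) _; exact: ler_norm.
Qed.

Lemma wbounded1_cvg C (g_ : nat -> R -> R) g :
  (forall k, wbounded1 C (g_ k)) -> wbounded1 C g ->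
  (forall x, g_ k x @[k --> \oo] --> g x) ->
  (\int[mu]_x g_ k x) @[k --> \oo] --> \int[mu]_x g x.
Proof.
move=> gk gg gcvg.
have i1 : mu.-integrable setT (EFin \o (fun x => C * weight1 x)).
  have := @integrableZl _ _ _ mu setT measurableT C _ integrable_oneDsqrV.
  by apply: eq_integrable.
have gE x : (g_ k x)%:E @[k --> \oo] --> (g x)%:E.
  by apply: cvg_EFin; [exact: nearW|exact: gcvg].
have H : (\int[mu]_x (g_ k x)%:E)%E @[k --> \oo] --> (\int[mu]_x (g x)%:E)%E.
  have [|||||_ _] := @dominated_convergence _ _ _ mu setT measurableT
    (fun k x => (g_ k x)%:E) (fun x => (g x)%:E) (fun x => (C * weight1 x)%:E).
  - by move=> k; exact: measurable_int (wbounded1_integrable (gk k)).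
  - exact: measurable_int (wbounded1_integrable gg).
  - by apply: aeW => x _; exact: gE.
  - exact: i1.
  - by apply: aeW => x k _; rewrite /= lee_fin; exact: (gk k).2.
  - by apply.
apply: fine_cvg; rewrite fineK //.
exact: integrable_fin_num (wbounded1_integrable gg).
Qed.

Lemma wbounded1_le C g : wbounded1 C g -> `|\int[mu]_x g x| <= C * wmass.
Proof.
move=> gC; apply: le_trans (le_normr_Rintegral _ (wbounded1_integrable gC)) _ => //.
rewrite -RintegralZl //; last exact: integrable_oneDsqrV.
apply: le_Rintegral => //.
- exact: (integrable_abse (wbounded1_integrable gC)).
- have := @integrableZl _ _ _ mu setT measurableT C _ integrable_oneDsqrV.
  by apply: eq_integrable.
- by move=> x _; exact: gC.2.
Qed.

End Weight.

(** * Iterated integrals: bounds, limits, linearity, affine substitutions *)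

Section IteratedIntegral.
Context {R : realType}.
Let mu := @lebesgue_measure R.

Lemma iintS m (g : 'rV[R]_m.+1 -> R) :
  iint g = \int[mu]_a iint (fun y => g (vcons a y)).
Proof. by []. Qed.

Lemma wbounded_slice C m (g : 'rV[R]_m.+1 -> R) a : wbounded C g ->
  wbounded (C * weight1 a) (fun y => g (vcons a y)).
Proof.
move=> [cg gC]; split=> [y|y].
  by apply: continuous_comp; [exact: vcons_continuousr|exact: cg].
by rewrite -mulrA -weight_vcons.
Qed.

Lemma wboundedW C C' n (g : 'rV[R]_n -> R) :
  C <= C' -> wbounded C g -> wbounded C' g.
Proof.
move=> CC' [cg gC]; split => // x; apply: le_trans (gC x) _.
by rewrite ler_wpM2r ?weight_ge0.
Qed.

Lemma weight_gt0 n (x : 'rV[R]_n) : 0 < weight x.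
Proof. by apply: prodr_gt0 => i _; exact: weight1_gt0. Qed.

Lemma wbounded_ge0 C n (g : 'rV[R]_n -> R) : wbounded C g -> 0 <= C.
Proof.
move=> [_ /(_ 0) H]; have := le_trans (normr_ge0 _) H.
by rewrite pmulr_lge0 ?weight_gt0.
Qed.

(** The two claims need each other in the induction on the dimension. To integrate in the first
    coordinate, the inner integral must be dominated, which is the bound in one dimension less, and
    continuous, which is the convergence claim in one dimension less. *)
Lemma iint_le_cvg n :
  (forall C (g : 'rV[R]_n -> R), wbounded C g -> `|iint g| <= C * wmass ^+ n) /\
  (forall C (g_ : nat -> 'rV[R]_n -> R) g, (forall k, wbounded C (g_ k)) ->
     wbounded C g -> (forall x, g_ k x @[k --> \oo] --> g x) ->
     iint (g_ k) @[k --> \oo] --> iint g).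
Proof.
elim: n => [|m [IHle IHcvg]].
  split=> [C g [_ /(_ 0) gC]|C g_ g _ _]; last exact.
  by rewrite expr0 mulr1; move: gC; rewrite /weight big_ord0 mulr1.
have slice1 C (g : 'rV[R]_m.+1 -> R) : wbounded C g ->
    wbounded1 (C * wmass ^+ m) (fun a => iint (fun y => g (vcons a y))).
  move=> gC; split=> [a|a]; last first.
    apply: le_trans (IHle _ _ (wbounded_slice a gC)) _.
    by rewrite -!mulrA [weight1 a * _]mulrC.
  apply: cvg_sequentially; first exact: countable_base_nbhs.
  move=> u ua; apply: (IHcvg C) => [k||y].
  - apply: wboundedW (wbounded_slice (u k) gC).
    by rewrite ler_piMr ?weight1_le1 ?(wbounded_ge0 gC).
  - apply: wboundedW (wbounded_slice a gC).
    by rewrite ler_piMr ?weight1_le1 ?(wbounded_ge0 gC).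
  - apply: (@cvg_comp _ _ _ (fun k => vcons (u k) y) g _ (nbhs (vcons a y))).
      apply: (@cvg_comp _ _ _ u (fun b => vcons b y) _ (nbhs a)) => //.
      exact: vcons_continuousl.
    exact: gC.1.
split=> [C g gC|C g_ g gk gC gcvg].
  rewrite iintS exprSr mulrA; exact: wbounded1_le (slice1 _ _ gC).
rewrite iintS; apply: wbounded1_cvg (fun k => slice1 _ _ (gk k)) (slice1 _ _ gC) _.
move=> a; apply: (IHcvg (C * weight1 a)) => [k||y].
- exact: wbounded_slice.
- exact: wbounded_slice.
- exact: gcvg.
Qed.

Lemma iint_le C n (g : 'rV[R]_n -> R) :
  wbounded C g -> `|iint g| <= C * wmass ^+ n.
Proof. exact: (iint_le_cvg n).1. Qed.

Lemma iint_cvg {T} (F : set_system T) {FF : ProperFilter F} C n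
    (g : T -> 'rV[R]_n -> R) (g0 : 'rV[R]_n -> R) : countable_base F ->
  (\forall t \near F, wbounded C (g t)) -> wbounded C g0 ->
  (forall x, g t x @[t --> F] --> g0 x) -> iint (g t) @[t --> F] --> iint g0.
Proof.
move=> cF gC g0C gcvg; apply: cvg_sequentially => // u uF.
have [N _ NP] := uF _ gC.
rewrite -(cvg_shiftn N); apply: (iint_le_cvg n).2 g0C _ => [k|x].
  by apply: NP => /=; rewrite leq_addl.
rewrite (cvg_shiftn N (fun k => g (u k) x)).
by apply: cvg_comp (gcvg x) => A /uF.
Qed.

Lemma slice_wbounded1 C m (g : 'rV[R]_m.+1 -> R) : wbounded C g ->
  wbounded1 (C * wmass ^+ m) (fun a => iint (fun y => g (vcons a y))).
Proof.
move=> gC; split=> [a|a]; last first.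
  apply: le_trans (iint_le (wbounded_slice a gC)) _.
  by rewrite -!mulrA [weight1 a * _]mulrC.
have C0 b : C * weight1 b <= C by rewrite ler_piMr ?weight1_le1 ?(wbounded_ge0 gC).
apply: (@iint_cvg _ (nbhs a) _ C m (fun b y => g (vcons b y))); first exact: countable_base_nbhs.
- by apply: nearW => b; apply: wboundedW (wbounded_slice b gC).
- exact: wboundedW (wbounded_slice a gC).
- move=> y; apply: (@continuous_comp _ _ _ (fun b => vcons b y) g a).
    exact: vcons_continuousl.
  exact: gC.1.
Qed.

Lemma wboundedD C C' n (g h : 'rV[R]_n -> R) :
  wbounded C g -> wbounded C' h -> wbounded (C + C') (fun x => g x + h x).
Proof.
move=> [cg gC] [ch hC]; split=> [x|x]; first exact: cvgD (cg x) (ch x).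
by rewrite mulrDl; apply: le_trans (ler_normD _ _) _; exact: lerD.
Qed.

Lemma wboundedZ C n k (g : 'rV[R]_n -> R) :
  wbounded C g -> wbounded (`|k| * C) (fun x => k * g x).
Proof.
move=> [cg gC]; split=> [x|x]; first exact: cvgM (cvg_cst k) (cg x).
by rewrite normrM -mulrA ler_wpM2l.
Qed.

Lemma wboundedB C C' n (g h : 'rV[R]_n -> R) :
  wbounded C g -> wbounded C' h -> wbounded (C + C') (fun x => g x - h x).
Proof.
move=> [cg gC] [ch hC]; split=> [x|x]; first exact: cvgB (cg x) (ch x).
by rewrite mulrDl; apply: le_trans (ler_normB _ _) _; exact: lerD.
Qed.

Lemma iintD C C' n (g h : 'rV[R]_n -> R) : wbounded C g -> wbounded C' h ->
  iint (fun x => g x + h x) = iint g + iint h.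
Proof.
elim: n C C' g h => [//|m IH] C C' g h gC hC.
rewrite !iintS -RintegralD //.
- by apply: eq_Rintegral => a _; rewrite (IH _ _ _ _ (wbounded_slice a gC) (wbounded_slice a hC)).
- exact: wbounded1_integrable (slice_wbounded1 gC).
- exact: wbounded1_integrable (slice_wbounded1 hC).
Qed.

Lemma iintZ C n k (g : 'rV[R]_n -> R) : wbounded C g ->
  iint (fun x => k * g x) = k * iint g.
Proof.
elim: n C g => [//|m IH] C g gC.
rewrite !iintS -RintegralZl //.
- by apply: eq_Rintegral => a _; rewrite (IH _ _ (wbounded_slice a gC)).
- exact: wbounded1_integrable (slice_wbounded1 gC).
Qed.

Lemma iintB C C' n (g h : 'rV[R]_n -> R) : wbounded C g -> wbounded C' h ->
  iint (fun x => g x - h x) = iint g - iint h.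
Proof.
move=> gC hC; rewrite -mulN1r -(iintZ _ hC) -(iintD gC (wboundedZ (-1) hC)).
by congr iint; apply/funext => x; rewrite mulN1r.
Qed.

Lemma weight1_affine (k b : R) : k != 0 ->
  {C | 0 <= C & forall x, weight1 (k * x + b) <= C * weight1 x}.
Proof.
(* The constant comes from x^2 <= 2 (z^2 + b^2) / k^2, where z = k x + b. *)
move=> k0; exists (1 + 2 * (1 + b ^+ 2) / k ^+ 2) => [|x].
  rewrite addr_ge0// divr_ge0 ?sqr_ge0// mulr_ge0// addr_ge0 ?sqr_ge0//.
rewrite /weight1 ler_pdivlMr ?oneDsqr_gt0// mulrC ler_pdivrMr ?oneDsqr_gt0//.
have k2 : 0 < k ^+ 2 by rewrite exprn_even_gt0.
rewrite /oneDsqr; set z := k * x + b.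
have -> : x = (z - b) / k by rewrite /z addrK mulrC mulKf.
have -> : ((z - b) / k) ^+ 2 = (z - b) ^+ 2 / k ^+ 2 by rewrite expr_div_n.
rewrite -(ler_pM2r k2) mulrDl mulfVK ?gt_eqF//.
rewrite [leRHS]mulrAC mulrDl mulfVK ?gt_eqF//.
have := sqr_ge0 (z + b); have := sqr_ge0 z; have := sqr_ge0 b; have := sqr_ge0 (z * b).
rewrite !exprMn; nra.
Qed.

Lemma wbounded1_affine C (g : R -> R) (k b : R) : k != 0 -> wbounded1 C g ->
  exists C', wbounded1 C' (fun x => g (k * x + b)).
Proof.
move=> k0 [cg gC]; have [D D0 DP] := weight1_affine b k0.
exists (`|C| * D); split=> [x|x].
  apply: continuous_comp; last exact: cg.
  by apply: cvgD; [apply: cvgM; [exact: cvg_cst|exact: cvg_id]|exact: cvg_cst].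
apply: le_trans (gC _) _; rewrite -mulrA.
apply: le_trans (ler_wpM2r (weight1_ge0 _) (ler_norm C)) _.
by rewrite ler_wpM2l.
Qed.

Lemma wbounded_affine C n (g : 'rV[R]_n -> R) (k : R) (b : 'rV[R]_n) :
  k != 0 -> wbounded C g -> exists C', wbounded C' (fun x => g (k *: x + b)).
Proof.
move=> k0 [cg gC].
have /choice[D DP] : forall i, exists D, 0 <= D /\ forall x, weight1 (k * x + b 0 i) <= D * weight1 x.
  by move=> i; have [D D0 DP] := weight1_affine (b 0 i) k0; exists D.
exists (`|C| * \prod_i D i); split=> [x|x].
  apply: continuous_comp; last exact: cg.
  apply: (@lipschitz_continuous _ _ _ `|k|) => y z.
  by rewrite opprD addrACA subrr addr0 -scalerBr normrZ.
apply: le_trans (gC _) _; rewrite -mulrA.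
apply: le_trans (ler_wpM2r (weight_ge0 _) (ler_norm C)) _.
rewrite ler_wpM2l// /weight -big_split /=; apply: ler_prod => i _.
by rewrite weight1_ge0 /= !mxE; exact: (DP i).2.
Qed.

(** The substitution is first made for nonnegative functions; adding [|C| * weight1] makes [g]
    nonnegative, and the contribution of the added term is subtracted again. *)
Lemma Rintegral_affine C (g : R -> R) (k b : R) : 0 < k -> wbounded1 C g ->
  \int[mu]_x g x = k * \int[mu]_x g (k * x + b).
Proof.
have pos D (h : R -> R) : 0 < k -> wbounded1 D h -> (forall x, 0 <= h x) ->
    \int[mu]_x h x = k * \int[mu]_x h (k * x + b).
  move=> k0 hD h0; rewrite {1}/Rintegral.
  have dF (x : R) : is_derive x (1 : R) (fun x : R => k * x + b) k.
    by apply: is_derive_eq; rewrite addr0; exact: mulr1.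
  have F' : (fun x : R => k * x + b)^`()%classic = fun=> k.
    by apply/funext => x; rewrite derive1E; apply: derive_val.
  rewrite (increasing_ge0_integration_by_substitutionT
    (F := fun x : R => k * x + b) (G := h)).
  - rewrite F'.
    rewrite -[LHS]/(\int[mu]_x (h (k * x + b) * k)).
    rewrite RintegralZr // 1?mulrC //.
    have [D' hD'] := wbounded1_affine b (lt0r_neq0 k0) hD.
    exact: wbounded1_integrable hD'.
  - by move=> x y xy; rewrite ltrD2r ltr_pM2l.
  - by rewrite F' => x; exact: cvg_cst.
  - by rewrite F'; exact: is_cvg_cst.
  - by rewrite F'; exact: is_cvg_cst.
  - by move=> x; have [] := dF x.
  - apply/cvgrNyPle => A.
    apply: filterS (nbhs_ninfty_le (num_real ((A - b) / k))) => x.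
    by rewrite ler_pdivlMr// mulrC lerBrDr.
  - apply/cvgryPge => A.
    apply: filterS (nbhs_pinfty_ge (num_real ((A - b) / k))) => x.
    by rewrite ler_pdivrMr// mulrC lerBlDr.
  - exact: hD.1.
  - exact: h0.
move=> k0 gC.
have w1 : wbounded1 `|C| (fun x => `|C| * weight1 x).
  split=> [x|x]; first by apply: cvgM; [exact: cvg_cst|exact: weight1_continuous].
  by rewrite normrM normr_id (ger0_norm (weight1_ge0 x)).
have gw : wbounded1 (C + `|C|) (fun x => g x + `|C| * weight1 x).
  split=> [x|x]; first exact: cvgD (gC.1 x) (w1.1 x).
  by rewrite mulrDl; apply: le_trans (ler_normD _ _) _; apply: lerD (gC.2 x) (w1.2 x).
have [D1 wD] := wbounded1_affine b (lt0r_neq0 k0) w1.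
have [D2 gwD] := wbounded1_affine b (lt0r_neq0 k0) gw.
have -> : g = fun x => (g x + `|C| * weight1 x) - `|C| * weight1 x.
  by apply/funext => x; rewrite addrK.
rewrite (RintegralB measurableT (wbounded1_integrable gw) (wbounded1_integrable w1)).
rewrite (RintegralB measurableT (wbounded1_integrable gwD) (wbounded1_integrable wD)).
rewrite mulrBr (pos _ _ k0 gw) ?(pos _ _ k0 w1)// => x.
  by rewrite mulr_ge0 ?weight1_ge0.
have := gC.2 x; rewrite ler_norml => /andP[+ _]; rewrite lerNl => H.
rewrite -[_ + _]opprK oppr_ge0 opprD subr_le0; apply: le_trans H _.
by rewrite ler_wpM2r ?weight1_ge0 ?ler_norm.
Qed.

Lemma iint_affine C n (g : 'rV[R]_n -> R) (k : R) (b : 'rV[R]_n) :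
  0 < k -> wbounded C g ->
  iint g = k ^+ n * iint (fun x => g (k *: x + b)).
Proof.
elim: n C g b => [|m IH] C g b k0 gC.
  by rewrite /= expr0 mul1r; congr g; apply/rowP; case.
have [b0 [b1 Eb]] := vconsP b.
rewrite !iintS (Rintegral_affine b0 k0 (slice_wbounded1 gC)) exprS -mulrA.
congr (_ * _); have [C' gC'] := wbounded_affine b (lt0r_neq0 k0) gC.
rewrite -RintegralZl//; last exact: wbounded1_integrable (slice_wbounded1 gC').
apply: eq_Rintegral => x _; rewrite (IH _ _ b1 k0 (wbounded_slice _ gC)).
by congr (_ * iint _); apply/funext => y; rewrite Eb vconsZ vconsD.
Qed.

End IteratedIntegral.

(** * Differentiation under the integral, integrals of derivatives, positivity *)

Section Differentiation.
Context {R : realType}.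
Let mu := @lebesgue_measure R.

Lemma is_derive_quotient {V : normedModType R} (f : V -> R) (x v : V) (l : R) :
  (h^-1 * (f (h *: v + x) - f x)) @[h --> 0^'] --> l <-> is_derive x v f l.
Proof.
split=> [H|[H <-]]; last by apply: cvg_trans H; exact: cvg_refl.
have H' : h^-1 *: ((f \o shift x) (h *: v) - f x) @[h --> 0^'] --> l by [].
by split; [exact: cvgP H'|exact: cvg_lim H'].
Qed.

Lemma is_derive_line {V : normedModType R} (f : V -> R) (x v : V) (t l : R) :
  is_derive (x + t *: v) v f l <-> is_derive t (1 : R) (fun s : R => f (x + s *: v)) l.
Proof.
rewrite -!is_derive_quotient.
suff -> : (fun h : R => h^-1 * (f (h *: v + (x + t *: v)) - f (x + t *: v))) =
   (fun h : R => h^-1 * (f (x + (h *: (1 : R) + t) *: v) - f (x + t *: v))) by [].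
apply/funext => h; congr (_ * (f _ - _)).
by rewrite addrCA -scalerDl [h *: 1]mulr1.
Qed.

Lemma mean_value_le (f f' : R -> R) (a b M : R) :
  (forall t, Num.min a b <= t <= Num.max a b -> is_derive t (1 : R) f (f' t)) ->
  (forall t, Num.min a b <= t <= Num.max a b -> `|f' t| <= M) ->
  `|f b - f a| <= M * `|b - a|.
Proof.
wlog ab : a b / a <= b => [H|] f'P f'M.
  have [ab|ba] := leP a b; first by apply: H => //.
  rewrite distrC [`|b - a|]distrC; apply: H (ltW ba) _ _ => t.
    by rewrite minC maxC; exact: f'P.
  by rewrite minC maxC; exact: f'M.
rewrite min_l// max_r// in f'P f'M.
have cf : {within `[a, b], continuous f}.
  apply: derivable_within_continuous => t; rewrite in_itv /= => /f'P [].
  by [].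
have [|c cab ->] := @MVT_segment R f f' a b ab _ cf.
  by move=> t; rewrite in_itv /= => /andP[/ltW at_ /ltW tb]; apply: f'P; rewrite at_ tb.
by rewrite normrM ler_wpM2r// f'M// -in_itv.
Qed.

(** Dominated convergence of the difference quotients: the mean value inequality gives them the
    majorant of [g']. *)
Lemma iint_is_derive n (g g' : R -> 'rV[R]_n -> R) (t0 e C C' : R) : 0 < e ->
  (forall t x, `|t - t0| < e -> is_derive t (1 : R) (g^~ x) (g' t x)) ->
  (forall t, `|t - t0| < e -> wbounded C (g t)) ->
  (forall t x, `|t - t0| < e -> `|g' t x| <= C' * weight x) ->
  continuous (g' t0) ->
  is_derive t0 (1 : R) (fun t => iint (g t)) (iint (g' t0)).
Proof.
move=> e0 dg gC g'C cg'.
apply/is_derive_quotient.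
have near0 : \forall h \near (0 : R)^', h != 0 /\ `|h| < e.
  near=> h; split; first by near: h; exact: nbhs_dnbhs_neq.
  by near: h; apply: dnbhs0_lt.
have : iint (fun x => h^-1 * (g (h *: (1 : R) + t0) x - g t0 x)) @[h --> 0^'] -->
    iint (g' t0).
  apply: (@iint_cvg _ _ _ _ C').
  - exact/countable_base_within/countable_base_nbhs.
  - apply: filterS near0 => h [h0 he]; split=> [x|x].
      have [c0 _] : wbounded C (g t0) by apply: gC; rewrite subrr normr0.
      have [ch _] : wbounded C (g (h *: (1 : R) + t0)).
        by apply: gC; rewrite addrK [h *: 1]mulr1.
      exact: cvgM (cvg_cst h^-1) (cvgB (ch x) (c0 x)).
    rewrite normrM normfV mulrC ler_pdivrMr ?normr_gt0//.
    have -> : `|h| = `|h *: (1 : R) + t0 - t0| by rewrite addrK [h *: 1]mulr1.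
    have betw t : Num.min t0 (h *: (1 : R) + t0) <= t <= Num.max t0 (h *: (1 : R) + t0) ->
        `|t - t0| < e.
      rewrite [h *: 1]mulr1 => /andP[t1 t2]; apply: le_lt_trans he.
      move: t1 t2; have [|] := leP t0 (h + t0); rewrite ler_norml.
        by move=> ? ? ?; have := ler_norm h; lra.
      by move=> ? ? ?; have := ler_norm (- h); rewrite normrN; lra.
    apply: (mean_value_le (f := g^~ x) (f' := g'^~ x)) => t /betw te.
      exact: dg.
    exact: g'C.
  - by split => // x; apply: g'C; rewrite subrr normr0.
  - by move=> x; apply/(is_derive_quotient (g^~ x)); apply: dg; rewrite subrr normr0.
apply: cvg_trans; apply: near_eq_cvg.
apply: filterS near0 => h [h0 he].
have gh : wbounded C (g (h *: (1 : R) + t0)) by apply: gC; rewrite addrK [h *: 1]mulr1.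
have gt : wbounded C (g t0) by apply: gC; rewrite subrr normr0.
by rewrite -(iintB gh gt) -(iintZ _ (wboundedB gh gt)).
Unshelve. all: by end_near. Qed.

Lemma weight_shift n (x y : 'rV[R]_n) : (forall i, `|y 0 i| <= 1) ->
  weight (x + y) <= 3 ^+ n * weight x.
Proof.
move=> y1; have -> : 3 ^+ n = \prod_(i < n) (3 : R) by rewrite prodr_const card_ord.
rewrite /weight -big_split /=; apply: ler_prod => i _.
rewrite weight1_ge0 mxE /= /weight1 ler_pdivlMr ?oneDsqr_gt0//.
rewrite mulrC ler_pdivrMr ?oneDsqr_gt0// /oneDsqr.
have := y1 i; rewrite ler_norml => /andP[].
move: (x 0 i) (y 0 i) => u v.
move=> v1 v2; have v3 : v ^+ 2 <= 1 by rewrite expr2; nra.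
have := sqr_ge0 (u + 2 * v); have := sqr_ge0 (u + v).
rewrite !expr2 in v3 *; lra.
Qed.

(** By translation invariance the integral of g(x + t e_i) does not depend on t, while its
    derivative at t = 0 is the integral of [g']. Every integration by parts below rests on this. *)
Lemma iint_partial n (i : 'I_n) (g g' : 'rV[R]_n -> R) C C' :
  wbounded C g -> wbounded C' g' ->
  (forall x, is_derive x (base i) g (g' x)) -> iint g' = 0.
Proof.
move=> gC g'C dg.
have shiftE (t : R) : `|t| < 1 -> forall x, weight (x + t *: base i) <= 3 ^+ n * weight x.
  move=> t1 x; apply: weight_shift => j; rewrite !mxE normrM.
  rewrite (le_trans (ler_piMr (normr_ge0 _) _) (ltW t1))//.
  by case: eqP; case: eqP => _ _; rewrite ?normr1 ?normr0.
have ct (h : 'rV[R]_n -> R) (t : R) : continuous h -> continuous (fun x : 'rV[R]_n => h (x + t *: base i)).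
  move=> ch x; apply: (@continuous_comp _ _ _ (fun x : 'rV[R]_n => x + t *: base i) h x); last exact: ch.
  apply: (@lipschitz_continuous _ _ _ 1) => y z.
  by rewrite opprD addrACA subrr addr0 mul1r.
have := @iint_is_derive n (fun t x => g (x + t *: base i))
  (fun t x => g' (x + t *: base i)) 0 1 (C * 3 ^+ n) (C' * 3 ^+ n) ltr01.
case.
- by move=> t x _; apply: (is_derive_line g x (base i) t (g' (x + t *: base i))).1; exact: dg.
- move=> t; rewrite subr0 => t1; split; first by apply: ct; exact: gC.1.
  move=> x; apply: le_trans (gC.2 _) _.
  by rewrite -mulrA ler_wpM2l ?(wbounded_ge0 gC)// shiftE.
- move=> t x; rewrite subr0 => t1; apply: le_trans (g'C.2 _) _.
  by rewrite -mulrA ler_wpM2l ?(wbounded_ge0 g'C)// shiftE.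
- by apply: ct; exact: g'C.1.
have G' : (fun x : 'rV[R]_n => g' (x + 0 *: base i)) = g'.
  by apply/funext => x; rewrite scale0r addr0.
rewrite G' => _ <-.
have -> : (fun t : R => iint (fun x => g (x + t *: base i))) = fun=> iint g.
  apply/funext => t; rewrite (iint_affine (t *: base i) ltr01 gC) expr1n mul1r.
  by congr iint; apply/funext => x; rewrite scale1r.
exact: derive_cst.
Qed.

(** On [0, 1] the function is at least its minimum, which is positive. *)
Lemma Rintegral_gt0 C (g : R -> R) : wbounded1 C g -> (forall x, 0 < g x) ->
  0 < \int[mu]_x g x.
Proof.
move=> gC g0.
have [c c01 cP] := EVT_min ler01 (continuous_subspaceT gC.1).
have I : mu.-integrable setT (EFin \o g) := wbounded1_integrable gC.
apply: (lt_le_trans (g0 c)).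
have -> : g c = \int[mu]_(x in `[0, 1]) g c.
  rewrite Rintegral_cst//= /mu lebesgue_measure_itv /= lte_fin ltr01 -EFinB subr0 /=.
  by rewrite mulr1.
apply: (@le_trans _ _ (\int[mu]_(x in `[0, 1]) g x)).
  apply: le_Rintegral => //.
  - apply: continuous_compact_integrable; first exact: segment_compact.
    by apply: continuous_subspaceT => x; exact: cvg_cst.
  - exact: integrableS I.
have I01 : mu.-integrable `[0, 1] (EFin \o g) by exact: integrableS I.
have le01 : (\int[mu]_(x in `[0%R, 1%R]) (g x)%:E <= \int[mu]_x (g x)%:E)%E.
  apply: ge0_subset_integral => //; first exact: measurable_int I.
  by move=> x _; rewrite lee_fin ltW.
exact: (fine_le (integrable_fin_num _ I01) (integrable_fin_num _ I) le01).
Qed.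

Lemma iint_gt0 C n (g : 'rV[R]_n -> R) : wbounded C g -> (forall x, 0 < g x) ->
  0 < iint g.
Proof.
elim: n C g => [|m IH] C g gC g0; first exact: g0.
rewrite iintS; apply: Rintegral_gt0 (slice_wbounded1 gC) _ => a.
by apply: IH (wbounded_slice a gC) _.
Qed.

End Differentiation.

(** * Families with controlled derivatives *)

Section Regularity.
Context {R : realType} {V : normedModType R} {I : Type} (dir : I -> V).

(* B is a class of families F : J -> V -> R, typically given by bounds which   *)
(* are uniform in the index; reg B k F says that the derivatives of F of order *)
(* at most k exist, are continuous, and belong to B.                           *)
Fixpoint reg {J : Type} (B : (J -> V -> R) -> Prop) (k : nat)
    (F : J -> V -> R) : Prop :=
  [/\ B F, forall j, continuous (F j) &
    match k with
    | 0 => True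
    | k'.+1 => forall i, (forall j x, derivable (F j) x (dir i)) /\
        reg B k' (fun j x => 'D_(dir i) (F j) x)
    end].

Definition sreg {J : Type} (B : (J -> V -> R) -> Prop) F :=
  forall k, reg B k F.

Section Families.
Context {J : Type}.
Implicit Types (B : (J -> V -> R) -> Prop) (F G : J -> V -> R).

Lemma reg_bound B k F : reg B k F -> B F.
Proof. by case: k => [|k] []. Qed.

Lemma reg_continuous B k F : reg B k F -> forall j, continuous (F j).
Proof. by case: k => [|k] []. Qed.
Arguments reg_continuous [B k F] _ j.

Lemma regS_intro B k F : B F -> (forall j, continuous (F j)) ->
  (forall i, exists F', (forall j x, is_derive x (dir i) (F j) (F' j x)) /\
     reg B k F') -> reg B k.+1 F.
Proof.
move=> BF cF H; split=> // i; have [F' [dF' regF']] := H i; split.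
  by move=> j x; have [] := dF' j x.
suff -> : (fun j x => 'D_(dir i) (F j) x) = F' by [].
by apply/funext => j; apply/funext => x; have [_] := dF' j x.
Qed.

Lemma regSE B k F i : reg B k.+1 F ->
  (forall j x, is_derive x (dir i) (F j) ('D_(dir i) (F j) x)) /\
  reg B k (fun j x => 'D_(dir i) (F j) x).
Proof.
by move=> [_ _ /(_ i)[dF rF]]; split => // j x; exact/derivableP.
Qed.

Lemma regW B k F : reg B k.+1 F -> reg B k F.
Proof.
elim: k F => [|k IH] F; first by case.
move=> [BF cF H]; split => // i; have [dF rF] := H i.
by split => //; exact: IH.
Qed.

Lemma reg_sub B B' k F : (forall G, B G -> B' G) -> reg B k F -> reg B' k F.
Proof.
move=> BB'; elim: k F => [|k IH] F [BF cF H]; split=> //; try exact: BB'.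
by move=> i; have [dF rF] := H i; split => //; exact: IH.
Qed.

Lemma reg_add B k F G : (forall F G, B F -> B G -> B (fun j x => F j x + G j x)) ->
  reg B k F -> reg B k G -> reg B k (fun j x => F j x + G j x).
Proof.
move=> BD; elim: k F G => [|k IH] F G.
  move=> [BF cF _] [BG cG _]; split=> // [|j x]; first exact: BD.
  exact: cvgD (cF j x) (cG j x).
move=> rF rG; apply: regS_intro.
- exact: BD (reg_bound rF) (reg_bound rG).
- move=> j; have cF := reg_continuous rF j; have cG := reg_continuous rG j.
  by move=> x; exact: cvgD (cF x) (cG x).
- move=> i; have [dF rF'] := regSE i rF; have [dG rG'] := regSE i rG.
  exists (fun j x => 'D_(dir i) (F j) x + 'D_(dir i) (G j) x).
  by split; [move=> j x; exact: is_deriveD|exact: IH].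
Qed.

Lemma sreg_der B F i : sreg B F -> sreg B (fun j x => 'D_(dir i) (F j) x).
Proof. by move=> H k; have [] := regSE i (H k.+1). Qed.

Lemma sreg_is_derive B F i j x : sreg B F ->
  is_derive x (dir i) (F j) ('D_(dir i) (F j) x).
Proof. by move=> H; have [] := regSE i (H 1%N). Qed.

(** Derivatives of a function vanishing on an open set vanish there too, so the vanishing may be
    made part of the class. This is how bounds are localized to a support. *)
Lemma reg_vanish B k F (W : J -> set V) : (forall j, open (W j)) ->
  (forall j x, W j x -> F j x = 0) -> reg B k F ->
  reg (fun G => B G /\ forall j x, W j x -> G j x = 0) k F.
Proof.
move=> oW; elim: k F => [|k IH] F F0; first by move=> [BF cF _].
move=> [BF cF H]; split => // i; have [dF rF] := H i; split => //.
apply: IH rF => j x Wx.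
have E : \near x, F j x = cst 0 x.
  by have := oW j; rewrite openE => /(_ x Wx); apply: filterS => y /F0.
have -> : 'D_(dir i) (F j) x = 'D_(dir i) (cst 0) x by exact: near_eq_derive.
exact: derive_cst.
Qed.

End Families.
Arguments reg_continuous [J B k F] _ j.

(** Leibniz rule. Three classes are kept apart to cover products such as rapid times moderate. *)
Lemma reg_mul {J : Type} (B1 B2 B3 : (J -> V -> R) -> Prop) k F G :
  (forall F G, B1 F -> B2 G -> B3 (fun j x => F j x * G j x)) ->
  (forall F G, B3 F -> B3 G -> B3 (fun j x => F j x + G j x)) ->
  reg B1 k F -> reg B2 k G -> reg B3 k (fun j x => F j x * G j x).
Proof.
move=> BM BD; elim: k F G => [|k IH] F G.
  move=> [BF cF _] [BG cG _]; split=> // [|j x]; first exact: BM.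
  exact: cvgM (cF j x) (cG j x).
move=> rF rG; apply: regS_intro.
- exact: BM (reg_bound rF) (reg_bound rG).
- move=> j; have cF := reg_continuous rF j; have cG := reg_continuous rG j.
  by move=> x; exact: cvgM (cF x) (cG x).
- move=> i; have [dF rF'] := regSE i rF; have [dG rG'] := regSE i rG.
  exists (fun j x => 'D_(dir i) (F j) x * G j x + F j x * 'D_(dir i) (G j) x).
  split; last first.
    by apply: reg_add => //; apply: IH => //; exact: regW.
  move=> j x; have := is_deriveM (dF j x) (dG j x).
  rewrite addrC /GRing.scale /= [G j x * _]mulrC; exact.
Qed.

Lemma reg_reindex {J J' : Type} (s : J' -> J) (B : (J -> V -> R) -> Prop)
    (B' : (J' -> V -> R) -> Prop) k F :
  (forall G, B G -> B' (fun j => G (s j))) ->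
  reg B k F -> reg B' k (fun j => F (s j)).
Proof.
move=> BB'; elim: k F => [|k IH] F [BF cF H]; split=> //; try exact: BB'.
by move=> i; have [dF rF] := H i; split => //; exact: IH rF.
Qed.

End Regularity.
Arguments reg_continuous [R V I dir J B k F] _ j.

(** * Chain rule and reciprocals in classes of families *)

Section Composition.
Context {R : realType} {V : normedModType R} {I : Type} (dir : I -> V).

Definition dir1 (_ : unit) : R := 1.

Lemma is_derive_comp_line (q : V -> R) (h : R -> R) (x v : V) (dq dh : R) :
  is_derive x v q dq -> is_derive (q x) (1 : R) h dh ->
  is_derive x v (fun y => h (q y)) (dh * dq).
Proof.
move=> dqx dhx.
have E (f : V -> R) l : is_derive x v f l <->
    is_derive (0 : R) (1 : R) (fun s : R => f (x + s *: v)) l.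
  by rewrite -is_derive_line scale0r addr0.
apply/E; move/E : dqx => dqx.
have := @is_derive1_comp _ h (fun s : R => q (x + s *: v)) 0 dh dq.
by rewrite mulrC scale0r addr0; apply.
Qed.

(** Each derivative of h(q(x)) is a derivative of h at q(x) times a derivative of q, so the growth
    of [h] enters only through its values along [q]. *)
Lemma reg_comp {J : Type} (Bh : (J -> R -> R) -> Prop)
    (B1 B2 : (J -> V -> R) -> Prop) k (h : J -> R -> R) (q : J -> V -> R)
    (dq : I -> J -> V -> R) :
  (forall h, Bh h -> B1 (fun j x => h j (q j x))) ->
  (forall F G, B1 F -> B2 G -> B1 (fun j x => F j x * G j x)) ->
  (forall F G, B1 F -> B1 G -> B1 (fun j x => F j x + G j x)) ->
  reg dir1 Bh k h -> (forall j, continuous (q j)) ->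
  (forall i j x, is_derive x (dir i) (q j) (dq i j x)) ->
  (forall i, reg dir B2 k (dq i)) -> reg dir B1 k (fun j x => h j (q j x)).
Proof.
move=> Bhq BM BD rh cq dqP; elim: k h rh => [|k IH] h rh rq.
  split=> //; first exact: Bhq (reg_bound rh).
  move=> j x; apply: (@continuous_comp _ _ _ (q j) (h j)); first exact: cq.
  exact: reg_continuous rh j _.
apply: regS_intro.
- exact: Bhq (reg_bound rh).
- move=> j x; apply: (@continuous_comp _ _ _ (q j) (h j)); first exact: cq.
  exact: reg_continuous rh j _.
- move=> i; have [dh rh'] := regSE tt rh.
  exists (fun j x => 'D_(dir1 tt) (h j) (q j x) * dq i j x); split.
    by move=> j x; exact: is_derive_comp_line.
  exact: reg_mul BM BD (IH _ rh' (fun i => regW (rq i))) (regW (rq i)).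
Qed.

Lemma reg_cst {J : Type} (B : (J -> V -> R) -> Prop) k (c : J -> R) :
  B (fun _ _ => 0) -> B (fun j _ => c j) -> reg dir B k (fun j _ => c j).
Proof.
move=> B0 Bc; elim: k c Bc => [|k IH] c Bc.
  by split=> // j x; exact: cvg_cst.
apply: regS_intro => // [j x|i]; first exact: cvg_cst.
exists (fun _ _ => 0); split; first by move=> j x; exact: is_derive_cst.
exact: (IH (fun=> 0)).
Qed.

Lemma reg_opp {J : Type} (B : (J -> V -> R) -> Prop) k F :
  (forall F, B F -> B (fun j x => - F j x)) ->
  reg dir B k F -> reg dir B k (fun j x => - F j x).
Proof.
move=> BN; elim: k F => [|k IH] F.
  move=> [BF cF _]; split=> // [|j x]; first exact: BN.
  exact: cvgN (cF j x).
move=> rF; apply: regS_intro.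
- exact: BN (reg_bound rF).
- move=> j; have cF := reg_continuous rF j.
  by move=> x; exact: cvgN (cF x).
- move=> i; have [dF rF'] := regSE i rF.
  exists (fun j x => - 'D_(dir i) (F j) x).
  by split; [move=> j x; exact: is_deriveN|exact: IH].
Qed.

Lemma reg_inv {J : Type} (B : (J -> V -> R) -> Prop) (F : J -> V -> R) k :
  (forall F G, B F -> B G -> B (fun j x => F j x * G j x)) ->
  (forall F G, B F -> B G -> B (fun j x => F j x + G j x)) ->
  (forall F, B F -> B (fun j x => - F j x)) ->
  B (fun j x => (F j x)^-1) ->
  (forall j x, F j x != 0) -> reg dir B k F -> reg dir B k (fun j x => (F j x)^-1).
Proof.
move=> BM BD BN BV F0.
have cV j : continuous (F j) -> continuous (fun x => (F j x)^-1).
  by move=> cF x; apply: cvgV => //; exact: cF.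
elim: k => [|k IH] rF.
  by split=> // j; apply: cV; exact: (reg_continuous rF j).
apply: regS_intro => // [j|i]; first by apply: cV; exact: (reg_continuous rF j).
have [dF rF'] := regSE i rF.
have rV := IH (regW rF).
exists (fun j x => - ((F j x)^-1 * (F j x)^-1 * 'D_(dir i) (F j) x)); split.
  move=> j x; have [dFx _] := dF j x; split; first exact: derivableV.
  by rewrite deriveV// -exprVn expr2 scaleNr.
have rVV := reg_mul BM BD rV rV.
exact: reg_opp BN (reg_mul BM BD rVV rF').
Qed.

End Composition.

Section BoundedClass.
Context {R : realType} {V : Type} {J : Type}.
Implicit Types F G : J -> V -> R.

Definition bounded_family F : Prop := exists C, forall j x, `|F j x| <= C.

Lemma bounded_familyD F G : bounded_family F -> bounded_family G ->
  bounded_family (fun j x => F j x + G j x).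
Proof.
move=> [C FC] [D GD]; exists (C + D) => j x.
by apply: le_trans (ler_normD _ _) _; exact: lerD.
Qed.

Lemma bounded_familyM F G : bounded_family F -> bounded_family G ->
  bounded_family (fun j x => F j x * G j x).
Proof.
move=> [C FC] [D GD]; exists (C * D) => j x.
by rewrite normrM; exact: ler_pM.
Qed.

Lemma bounded_familyN F : bounded_family F -> bounded_family (fun j x => - F j x).
Proof. by move=> [C FC]; exists C => j x; rewrite normrN. Qed.

Lemma bounded_family_cst (c : R) : bounded_family (fun _ _ => c).
Proof. by exists `|c|. Qed.

End BoundedClass.

(** * A smooth step function *)

Section SmoothStep.
Context {R : realType}.

Lemma exprn_le_expR m : {C : R | 0 < C & forall y, 0 <= y -> y ^+ m <= C * expR y}.
Proof.
exists (m.+1%:R ^+ m) => [|y y0]; first by rewrite exprn_gt0.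
have y1 : y <= m.+1%:R * expR (y / m.+1%:R).
  rewrite -ler_pdivrMl// mulrC; apply: le_trans (expR_ge1Dx _).
  by rewrite lerDr.
apply: le_trans (lerXn2r m _ _ y1) _; rewrite ?nnegrE ?mulr_ge0 ?expR_ge0//.
rewrite exprMn ler_wpM2l ?exprn_ge0// -expRM_natl ler_expR mulrA ler_pdivrMr//.
by rewrite mulrC ler_wpM2l// ler_nat.
Qed.

(* All derivatives of exp(-1/x) are of this form. *)
Definition flat (p : {poly R}) (x : R) : R :=
  if 0 < x then p.[x^-1] * expR (- x^-1) else 0.

Lemma flat_le0 p x : x <= 0 -> flat p x = 0.
Proof. by rewrite /flat ltNge => ->. Qed.

Lemma flat_bounded p : exists C, forall x, `|flat p x| <= C.
Proof.
have /choice[C CP] : forall i : 'I_(size p), exists C : R, 0 < C /\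
    forall y, 0 <= y -> y ^+ i <= C * expR y.
  by move=> i; have [C C0 CP] := exprn_le_expR i; exists C.
exists (\sum_(i < size p) `|p`_i| * C i) => x; rewrite /flat; case: ifPn => [x0|_]; last first.
  by rewrite normr0 sumr_ge0// => i _; rewrite mulr_ge0// ltW// (CP i).1.
rewrite horner_coef normrM (ger0_norm (expR_ge0 _)) expRN ler_pdivrMr ?expR_gt0//.
apply: le_trans (ler_norm_sum _ _ _) _; rewrite mulr_suml; apply: ler_sum => i _.
rewrite normrM -mulrA ler_wpM2l// ger0_norm ?exprn_ge0 ?invr_ge0 ?(ltW x0)//.
by apply: (CP i).2; rewrite invr_ge0 ltW.
Qed.

(** Exhibits [flat p] as x^2 times a bounded function, whence derivative 0 at the origin. *)
Lemma flat_sqr p x : flat p x = x ^+ 2 * flat ('X^2 * p) x.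
Proof.
rewrite /flat; case: ifPn => [x0|]; last by rewrite mulr0.
rewrite hornerM hornerXn exprVn; move: p.[_] (expR _) => a b.
by field; rewrite gt_eqF.
Qed.

(** For x > 0 the derivative of p(1/x) exp(-1/x) is x^-2 (p - p')(1/x) exp(-1/x), so the family is
    closed under differentiation. *)
Lemma flat_is_derive p (x : R) :
  is_derive x (1 : R) (flat p) (flat ('X^2 * (p - p^`())) x).
Proof.
have [x0|x0|->] := ltrgt0P x.
- have nx : \near x, p.[x^-1] * expR (- x^-1) = flat p x.
    by near=> y; rewrite /flat ifT//; near: y; exact: lt_nbhsr.
  apply: near_eq_is_derive nx _.
  have dV : is_derive x (1 : R) (fun y : R => y^-1) (- x ^- 2).
    split; first by apply: (derivableV (f := id)) => //; rewrite gt_eqF.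
    rewrite (deriveV (f := id)) ?gt_eqF//.
    by rewrite derive_id; exact: mulr1.
  have dp := is_derive_comp_line dV (is_derive_poly p x^-1).
  have de := is_derive_comp_line (is_deriveN dV) (is_derive_expR (- x^-1)).
  have D := is_deriveM dp de; refine (is_derive_eq D _).
  rewrite /flat x0 hornerM hornerXn hornerD hornerN /GRing.scale /= -exprVn.
  ring.
- have nx : \near x, cst 0 x = flat p x.
    near=> y; rewrite flat_le0//; apply: ltW; near: y; exact: lt_nbhsl.
  by apply: near_eq_is_derive nx _; rewrite flat_le0 ?(ltW x0)//; exact: is_derive_cst.
- rewrite (flat_le0 _ (lexx 0)); apply/is_derive_quotient.
  have [C CP] := flat_bounded ('X^2 * p).
  rewrite (flat_le0 p (lexx 0)).
  have C0 : 0 <= C by apply: le_trans (CP 0).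
  apply/cvgr0Pnorm_lt => e e0; near=> h.
  have h0 : h != 0 by near: h; exact: nbhs_dnbhs_neq.
  rewrite [h *: 1]mulr1 addr0 subr0 flat_sqr expr2 !mulrA mulVf// mul1r normrM.
  apply: le_lt_trans (ler_wpM2l (normr_ge0 _) (CP h)) _.
  apply: (@le_lt_trans _ _ (`|h| * (C + 1))); first by rewrite ler_wpM2l// lerDl.
  rewrite -ltr_pdivlMr ?ltr_wpDl//; near: h; apply: dnbhs0_lt.
  by rewrite divr_gt0// ltr_wpDl.
Unshelve. all: by end_near. Qed.

Lemma flat_reg k p : reg dir1 bounded_family k (fun _ : unit => flat p).
Proof.
have cf q : continuous (flat q).
  move=> x; have [d _] := flat_is_derive q x.
  exact/differentiable_continuous/derivable1_diffP.
have bf q : bounded_family (fun _ : unit => flat q).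
  by have [C CP] := flat_bounded q; exists C.
elim: k p => [|k IH] p; first by split.
apply: regS_intro => // -[].
by exists (fun _ => flat ('X^2 * (p - p^`()))); split => // _ x; exact: flat_is_derive.
Qed.

(** Equal to 0 for x <= 0 and to 1 for x >= 1. All cutoffs and partitions of unity below are built
    from it. *)
Definition step (x : R) : R := flat 1 x / (flat 1 x + flat 1 (1 - x)).

Lemma flat1_ge0 x : 0 <= flat 1 x.
Proof. by rewrite /flat; case: ifP => // _; rewrite hornerC mul1r expR_ge0. Qed.

Lemma flat1_ge (x a : R) : 0 < a -> a <= x -> expR (- a^-1) <= flat 1 x.
Proof.
move=> a0 ax; rewrite /flat (lt_le_trans a0 ax) hornerC mul1r ler_expR lerN2.
by rewrite lef_pV2 ?posrE// (lt_le_trans a0 ax).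
Qed.

(** One of x and 1 - x is at least 1/2, where [flat 1] is at least exp(-2). The positive lower bound
    keeps all derivatives of the quotient bounded. *)
Lemma step_den_ge x : expR (- 2) <= flat 1 x + flat 1 (1 - x).
Proof.
have := flat1_ge0 x; have := flat1_ge0 (1 - x).
have e2 (y : R) : 2^-1 <= y -> expR (- 2) <= flat 1 y.
  by rewrite -[X in expR (- X)]invrK; apply: flat1_ge; rewrite invr_gt0.
have [x2|x2] := leP 2^-1 x; first by have := e2 _ x2; lra.
have /e2 : 2^-1 <= 1 - x by lra.
by lra.
Qed.

Lemma step_den_gt0 x : 0 < flat 1 x + flat 1 (1 - x).
Proof. exact: lt_le_trans (expR_gt0 _) (step_den_ge x). Qed.

Lemma step_le0 x : x <= 0 -> step x = 0.
Proof. by move=> x0; rewrite /step flat_le0// mul0r. Qed.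

Lemma step_ge1 x : 1 <= x -> step x = 1.
Proof.
move=> x1; have := step_den_gt0 x; rewrite /step (@flat_le0 1 (1 - x)) ?subr_le0//.
by rewrite addr0 => /lt0r_neq0 ?; rewrite divff.
Qed.

Lemma step_ge0 x : 0 <= step x.
Proof. by rewrite divr_ge0 ?flat1_ge0 ?(ltW (step_den_gt0 _)). Qed.

Lemma step_le1 x : step x <= 1.
Proof. by rewrite ler_pdivrMr ?step_den_gt0// mul1r lerDl flat1_ge0. Qed.

Lemma step_reg k : reg dir1 bounded_family k (fun _ : unit => step).
Proof.
have BM := @bounded_familyM R R unit; have BD := @bounded_familyD R R unit.
have rf := flat_reg k 1.
have rf1 : reg dir1 bounded_family k (fun (_ : unit) x => flat 1 (1 - x)).
  apply: (@reg_comp R R unit dir1 unit bounded_family bounded_family bounded_family k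
    (fun _ => flat 1) (fun _ x => 1 - x) (fun _ _ _ => -1)) => //.
  - by move=> h [C hC]; exists C => j x; exact: hC.
  - by move=> _ x; apply: cvgB; [exact: cvg_cst|exact: cvg_id].
  - move=> i _ x; rewrite /dir1; apply: is_derive_eq; ring.
  - by move=> _; apply: reg_cst; exact: bounded_family_cst.
have rd : reg dir1 bounded_family k (fun (_ : unit) x => flat 1 x + flat 1 (1 - x)).
  exact: reg_add BD rf rf1.
apply: (reg_mul BM BD rf); apply: (reg_inv BM BD (@bounded_familyN R R unit)) => //.
- exists (expR 2) => _ x; rewrite normfV ger0_norm ?(ltW (step_den_gt0 _))//.
  by rewrite -[leRHS]invrK -expRN lef_pV2 ?posrE ?expR_gt0 ?step_den_gt0// step_den_ge.
- by move=> _ x; rewrite gt_eqF ?step_den_gt0.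
Qed.

End SmoothStep.

(** * Growth classes of families *)

Section GrowthClasses.
Context {R : realType} {n : nat} {J : Type}.
Implicit Types F G : J -> 'rV[R]_n -> R.

(** Here and in the next three classes the constants do not depend on the index. Parameters such as
    a cutoff scale, a time or a translation are put in [J] to obtain uniform estimates. *)
Definition moderate F : Prop :=
  exists (N : nat) (C : R), forall j x, `|F j x| <= C * (1 + `|x|) ^+ N.

Definition rapid F : Prop :=
  forall N : nat, exists C : R, forall j x, `|F j x| * (1 + `|x|) ^+ N <= C.

Definition locally_bounded F : Prop :=
  forall r : R, exists C : R, forall j x, `|x| <= r -> `|F j x| <= C.

Definition compactly_bounded F : Prop :=
  bounded_family F /\ exists r : R, forall j x, r < `|x| -> F j x = 0.

Lemma norm1_ge1 (x : 'rV[R]_n) N : 1 <= (1 + `|x|) ^+ N.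
Proof. by rewrite exprn_ege1// lerDl. Qed.

Lemma norm1_gt0 (x : 'rV[R]_n) N : 0 < (1 + `|x|) ^+ N.
Proof. exact: lt_le_trans ltr01 (norm1_ge1 x N). Qed.

Lemma moderateP F : moderate F -> exists (N : nat) (C : R), 0 <= C /\
  forall j x, `|F j x| <= C * (1 + `|x|) ^+ N.
Proof.
move=> [N [C FC]]; exists N, `|C|; split=> // j x; apply: le_trans (FC j x) _.
by rewrite ler_wpM2r ?(ltW (norm1_gt0 _ _))// ler_norm.
Qed.

Lemma moderateD F G : moderate F -> moderate G ->
  moderate (fun j x => F j x + G j x).
Proof.
move=> /moderateP[N [C [C0 FC]]] /moderateP[M [D [D0 GD]]].
exists (N + M)%N, (C + D) => j x; apply: le_trans (ler_normD _ _) _.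
rewrite mulrDl; apply: lerD.
  apply: le_trans (FC j x) _; rewrite ler_wpM2l// exprD.
  by rewrite ler_peMr ?norm1_ge1// ltW ?norm1_gt0.
apply: le_trans (GD j x) _; rewrite ler_wpM2l// exprD.
by rewrite ler_peMl ?norm1_ge1// ltW ?norm1_gt0.
Qed.

Lemma moderateM F G : moderate F -> moderate G ->
  moderate (fun j x => F j x * G j x).
Proof.
move=> /moderateP[N [C [C0 FC]]] /moderateP[M [D [D0 GD]]].
exists (N + M)%N, (C * D) => j x; rewrite normrM exprD mulrACA.
exact: ler_pM.
Qed.

Lemma bounded_moderate F : bounded_family F -> moderate F.
Proof.
by move=> [C FC]; exists 0%N, C => j x; rewrite expr0 mulr1.
Qed.

Lemma rapidD F G : rapid F -> rapid G -> rapid (fun j x => F j x + G j x).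
Proof.
move=> rF rG N; have [C FC] := rF N; have [D GD] := rG N.
exists (C + D) => j x; apply: le_trans (lerD (FC j x) (GD j x)).
by rewrite -mulrDl ler_wpM2r ?(ltW (norm1_gt0 _ _))// ler_normD.
Qed.

Lemma rapid_moderate F G : rapid F -> moderate G ->
  rapid (fun j x => F j x * G j x).
Proof.
move=> rF /moderateP[M [D [D0 GD]]] N; have [C FC] := rF (M + N)%N.
exists (C * D) => j x; rewrite normrM -mulrA.
apply: le_trans (ler_wpM2r D0 (FC j x)).
by rewrite -mulrA ler_wpM2l// [leRHS]mulrC exprD mulrA ler_wpM2r// ltW ?norm1_gt0.
Qed.

Lemma bounded_rapid F : compactly_bounded F -> rapid F.
Proof.
move=> [[C FC] [r Fr]] N; exists (`|C| * (1 + `|r|) ^+ N) => j x.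
have [/Fr ->|xr] := ltP r `|x|.
  by rewrite normr0 mul0r mulr_ge0// exprn_ge0// addr_ge0.
apply: ler_pM; rewrite ?(ltW (norm1_gt0 _ _))//.
  exact: le_trans (FC j x) (ler_norm C).
by rewrite lerXn2r ?nnegrE ?addr_ge0// lerD2l (le_trans xr)// ler_norm.
Qed.

Lemma locally_boundedD F G : locally_bounded F -> locally_bounded G ->
  locally_bounded (fun j x => F j x + G j x).
Proof.
move=> bF bG r; have [C FC] := bF r; have [D GD] := bG r; exists (C + D) => j x xr.
by apply: le_trans (ler_normD _ _) (lerD (FC j x xr) (GD j x xr)).
Qed.

Lemma locally_boundedM F G : locally_bounded F -> locally_bounded G ->
  locally_bounded (fun j x => F j x * G j x).
Proof.
move=> bF bG r; have [C FC] := bF r; have [D GD] := bG r; exists (C * D) => j x xr.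
by rewrite normrM ler_pM ?FC ?GD.
Qed.

Lemma moderate_locally_bounded F : moderate F -> locally_bounded F.
Proof.
move=> /moderateP[N [C [C0 FC]]] r; exists (C * (1 + `|r|) ^+ N) => j x xr.
apply: le_trans (FC j x) _; rewrite ler_wpM2l// lerXn2r ?nnegrE ?addr_ge0//.
by rewrite lerD2l (le_trans xr)// ler_norm.
Qed.

Lemma compactly_boundedD F G : compactly_bounded F -> compactly_bounded G ->
  compactly_bounded (fun j x => F j x + G j x).
Proof.
move=> [bF [r Fr]] [bG [s Gs]]; split; first exact: bounded_familyD.
exists (Num.max r s) => j x; rewrite gt_max => /andP[rx sx].
by rewrite Fr// Gs// addr0.
Qed.

Lemma compactly_locally_bounded F G : compactly_bounded F -> locally_bounded G ->
  compactly_bounded (fun j x => F j x * G j x).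
Proof.
move=> [[C FC] [r Fr]] bG; have [D GD] := bG r; split; last first.
  by exists r => j x /Fr ->; rewrite mul0r.
exists (`|C| * `|D|) => j x; have [/Fr ->|xr] := ltP r `|x|.
  by rewrite mul0r normr0 mulr_ge0.
rewrite normrM ler_pM//; first exact: le_trans (FC j x) (ler_norm C).
exact: le_trans (GD j x xr) (ler_norm D).
Qed.

End GrowthClasses.

(** * Smooth families in the growth classes *)

Section GrowthRegularity.
Context {R : realType} {n : nat} {J : Type}.
Implicit Types F G : J -> 'rV[R]_n -> R.
Local Notation sreg := (sreg (@base R n)).

Lemma sreg_moderateD F G : sreg moderate F -> sreg moderate G ->
  sreg moderate (fun j x => F j x + G j x).
Proof. by move=> rF rG k; exact: reg_add (@moderateD _ _ _) (rF k) (rG k). Qed.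

Lemma sreg_moderateM F G : sreg moderate F -> sreg moderate G ->
  sreg moderate (fun j x => F j x * G j x).
Proof.
by move=> rF rG k; exact: reg_mul (@moderateM _ _ _) (@moderateD _ _ _) (rF k) (rG k).
Qed.

Lemma sreg_moderate_cst (c : J -> R) C : (forall j, `|c j| <= C) ->
  sreg moderate (fun j _ => c j).
Proof.
move=> cC k; apply: reg_cst; apply: bounded_moderate; last by exists C.
exact: bounded_family_cst.
Qed.

Lemma is_derive_coord (i j : 'I_n) (x : 'rV[R]_n) :
  is_derive x (base j) (fun y : 'rV[R]_n => y 0 i) (i == j)%:R.
Proof.
apply/is_derive_quotient.
suff H : \forall h \near (0 : R)^', cst (i == j)%:R h =
    h^-1 * ((h *: base j + x) 0 i - x 0 i).
  by apply: cvg_trans (near_eq_cvg H) _; exact: cvg_cst.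
near=> h; have h0 : h != 0 by near: h; exact: nbhs_dnbhs_neq.
by rewrite !mxE eqxx /= addrK mulKf.
Unshelve. all: by end_near. Qed.

Lemma sreg_moderate_coord i : sreg moderate (fun (_ : J) x => x 0 i).
Proof.
have b : moderate (fun (_ : J) (x : 'rV[R]_n) => x 0 i).
  exists 1%N, 1 => _ x; rewrite mul1r expr1 (le_trans (coord_le_norm x i))//.
  by rewrite lerDr.
have c : forall j : J, continuous (fun x : 'rV[R]_n => x 0 i).
  by move=> _; exact: coord_continuous.
case=> [|k]; first by split.
apply: regS_intro => // j; exists (fun _ _ => (i == j)%:R); split.
  by move=> _ x; exact: is_derive_coord.
by apply: (@sreg_moderate_cst (fun=> (i == j)%:R) 1) => _; case: eqP; rewrite ?normr1 ?normr0.
Qed.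

Lemma sreg_moderate_sum (I : Type) (r : seq I) (F : I -> J -> 'rV[R]_n -> R) :
  (forall i, sreg moderate (F i)) ->
  sreg moderate (fun j x => \sum_(i <- r) F i j x).
Proof.
move=> rF; elim: r => [|i r IH].
  under eq_fun do under eq_fun do rewrite big_nil.
  by apply: (@sreg_moderate_cst _ 0) => _; rewrite normr0.
under eq_fun do under eq_fun do rewrite big_cons.
exact: sreg_moderateD.
Qed.

Lemma sreg_moderate_prod (I : Type) (r : seq I) (F : I -> J -> 'rV[R]_n -> R) :
  (forall i, sreg moderate (F i)) ->
  sreg moderate (fun j x => \prod_(i <- r) F i j x).
Proof.
move=> rF; elim: r => [|i r IH].
  under eq_fun do under eq_fun do rewrite big_nil.
  by apply: (@sreg_moderate_cst _ 1) => _; rewrite normr1.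
under eq_fun do under eq_fun do rewrite big_cons.
exact: sreg_moderateM.
Qed.

Lemma sreg_moderate_exp F N : sreg moderate F ->
  sreg moderate (fun j x => F j x ^+ N).
Proof.
move=> rF; elim: N => [|N IH].
  by apply: (@sreg_moderate_cst _ 1) => _; rewrite normr1.
under eq_fun do under eq_fun do rewrite exprS.
exact: sreg_moderateM.
Qed.

Lemma sreg_moderateN F : sreg moderate F -> sreg moderate (fun j x => - F j x).
Proof.
move=> rF; under eq_fun do under eq_fun do rewrite -mulN1r.
apply: sreg_moderateM rF.
by apply: (@sreg_moderate_cst _ 1) => _; rewrite normrN1.
Qed.

Lemma sreg_moderate_dot (z : J -> 'rV[R]_n) C : (forall j, `|z j| <= C) ->
  sreg moderate (fun j x => dot (z j) x).
Proof.
move=> zC; apply: sreg_moderate_sum => i; apply: sreg_moderateM.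
  by apply: (@sreg_moderate_cst _ C) => j; apply: le_trans (coord_le_norm _ _) _.
exact: sreg_moderate_coord.
Qed.

Lemma sreg_continuous (B : (J -> 'rV[R]_n -> R) -> Prop) F :
  sreg B F -> forall j, continuous (F j).
Proof. by move=> rF j; exact: (reg_continuous (rF 0%N) j). Qed.
Arguments sreg_continuous [B F] _ j.

Lemma sreg_bound (B : (J -> 'rV[R]_n -> R) -> Prop) F : sreg B F -> B F.
Proof. by move=> rF; exact: reg_bound (rF 0%N). Qed.

Lemma sreg_comp (Bh : (J -> R -> R) -> Prop) (B : (J -> 'rV[R]_n -> R) -> Prop)
    (h : J -> R -> R) (q : J -> 'rV[R]_n -> R) :
  (forall h, Bh h -> B (fun j x => h j (q j x))) ->
  (forall F G, B F -> moderate G -> B (fun j x => F j x * G j x)) ->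
  (forall F G, B F -> B G -> B (fun j x => F j x + G j x)) ->
  (forall k, reg dir1 Bh k h) -> sreg moderate q ->
  sreg B (fun j x => h j (q j x)).
Proof.
move=> Bhq BM BD rh rq k.
apply: (reg_comp Bhq BM BD (rh k) (dq := fun i j x => 'D_(base i) (q j) x)).
- by move=> j; exact: sreg_continuous.
- by move=> i j x; exact: sreg_is_derive.
- by move=> i; exact: sreg_der.
Qed.

Lemma sreg_bounded_comp (h : R -> R) (q : J -> 'rV[R]_n -> R) :
  (forall k, reg dir1 bounded_family k (fun _ : unit => h)) -> sreg moderate q ->
  sreg moderate (fun j x => h (q j x)).
Proof.
move=> rh rq; apply: (@sreg_comp bounded_family moderate (fun=> h)) rq => //.
- by move=> {rh}h [C hC]; apply: bounded_moderate; exists C.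
- exact: moderateM.
- exact: moderateD.
- move=> k; apply: (@reg_reindex R R unit dir1 unit J (fun=> tt) bounded_family
    bounded_family k (fun=> h) _ (rh k)) => g [C gC].
  by exists C.
Qed.

Lemma sreg_rapidD F G : sreg rapid F -> sreg rapid G ->
  sreg rapid (fun j x => F j x + G j x).
Proof. by move=> rF rG k; exact: reg_add (@rapidD _ _ _) (rF k) (rG k). Qed.

Lemma sreg_rapidM F G : sreg rapid F -> sreg moderate G ->
  sreg rapid (fun j x => F j x * G j x).
Proof.
by move=> rF rG k; exact: reg_mul (@rapid_moderate _ _ _) (@rapidD _ _ _) (rF k) (rG k).
Qed.

(** Each of the n factors of the weight is at least (1 + |x|)^-2; thus decay of order 2n implies
    [wbounded]. *)
Lemma weight_norm1 (x : 'rV[R]_n) : 1 <= (1 + `|x|) ^+ (2 * n) * weight x.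
Proof.
have -> : (1 + `|x|) ^+ (2 * n) = \prod_(i < n) ((1 + `|x|) ^+ 2).
  by rewrite prodr_const card_ord exprM.
rewrite /weight -big_split /=.
apply: (@le_trans _ _ (\prod_(i < n) (1 : R))); first by rewrite big1.
apply: ler_prod => i _; rewrite ler01 /= /weight1 ler_pdivlMr ?oneDsqr_gt0// mul1r.
rewrite /oneDsqr; have := coord_le_norm x i; rewrite -(real_normK (num_real (x 0 i))).
have := normr_ge0 (x 0 i); have := normr_ge0 x; nra.
Qed.

Lemma rapid_wbounded F : (forall j, continuous (F j)) -> rapid F ->
  exists C, forall j, wbounded C (F j).
Proof.
move=> cF /(_ (2 * n)%N)[C FC]; exists C => j; split => // x.
apply: le_trans (ler_wpM2r (weight_ge0 x) (FC j x)).
by rewrite -mulrA ler_peMr// weight_norm1.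
Qed.

Lemma sreg_rapid_wbounded F : sreg rapid F -> exists C, forall j, wbounded C (F j).
Proof.
move=> rF; apply: rapid_wbounded; last exact: sreg_bound.
by move=> j; exact: sreg_continuous.
Qed.

End GrowthRegularity.
Arguments sreg_continuous {R n J} [B F] _ j.

Lemma is_derive_line0 {R : realType} {V : normedModType R} (f : V -> R) (x v : V)
    (l : R) :
  is_derive x v f l <-> is_derive (0 : R) (1 : R) (fun s : R => f (x + s *: v)) l.
Proof. by rewrite -is_derive_line scale0r addr0. Qed.

(** * Fourier transforms of rapidly decreasing families *)

Section TrigonometricTransform.
Context {R : realType} {n : nat} {J : Type}.
Implicit Types F G : J -> 'rV[R]_n -> R.
Local Notation sreg := (sreg (@base R n)).

(** A cosine transform with a phase: the phases 0 and - pi / 2 give the cosine and the sine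
    transform. Besides acting on [F], differentiation and multiplication by a coordinate merely
    shift the phase by pi / 2, so one induction handles both transforms. *)
Definition trig (theta : R) F (j : J) (z : 'rV[R]_n) : R :=
  iint (fun x => F j x * cos (dot z x + theta)).

Lemma dotC (x y : 'rV[R]_n) : dot x y = dot y x.
Proof. by apply: eq_bigr => i _; rewrite mulrC. Qed.

Lemma dotDl (x y z : 'rV[R]_n) : dot (x + y) z = dot x z + dot y z.
Proof. by rewrite /dot -big_split; apply: eq_bigr => i _; rewrite mxE mulrDl. Qed.

Lemma dotZl a (x y : 'rV[R]_n) : dot (a *: x) y = a * dot x y.
Proof. by rewrite /dot mulr_sumr; apply: eq_bigr => i _; rewrite mxE mulrA. Qed.

Lemma dot_base i (x : 'rV[R]_n) : dot (base i) x = x 0 i.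
Proof.
rewrite /dot (bigD1 i)//= big1 => [|k ki]; first by rewrite mxE !eqxx mul1r addr0.
by rewrite mxE (negbTE ki) andbF mul0r.
Qed.

Lemma dot_continuous (z : 'rV[R]_n) : continuous (dot z).
Proof.
have H := @sreg_moderate_dot R n unit (fun=> z) `|z| (fun=> lexx _).
exact: (sreg_continuous H tt).
Qed.

Lemma cos_phase_continuous (z : 'rV[R]_n) theta :
  continuous (fun x => cos (dot z x + theta)).
Proof.
move=> x; apply: (@continuous_comp _ _ _ (fun x => dot z x + theta) (@cos R)).
  exact: (cvgD (@dot_continuous z x) (cvg_cst theta)).
exact: continuous_cos.
Qed.

Lemma trig_wbounded C (g : 'rV[R]_n -> R) z theta : wbounded C g ->
  wbounded C (fun x => g x * cos (dot z x + theta)).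
Proof.
move=> [cg gC]; split=> x; first exact: cvgM (cg x) (@cos_phase_continuous z theta x).
rewrite normrM; apply: le_trans (gC x); rewrite ler_piMr//.
by rewrite ler_norml cos_geN1 cos_le1.
Qed.

Lemma sreg_rapid_coord F i : sreg rapid F -> sreg rapid (fun j x => F j x * x 0 i).
Proof. by move=> rF; apply: sreg_rapidM rF _; exact: sreg_moderate_coord. Qed.

Lemma is_derive_affine (a b t : R) :
  is_derive t (1 : R) (fun s : R => a + s * b) b.
Proof.
by apply: is_derive_eq; rewrite add0r scaler0 add0r mul1r; exact: mulr1.
Qed.

Lemma is_derive_cos_phase (a b t : R) :
  is_derive t (1 : R) (fun s : R => cos (a + s * b)) (cos (a + t * b + pi / 2) * b).
Proof.
have dl : is_derive t (1 : R) (fun s : R => a + s * b) b.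
  exact: is_derive_affine.
have := is_derive_comp_line dl (is_derive_cos _).
by rewrite cosDpihalf.
Qed.

Lemma trig_is_derive theta F (i : 'I_n) j (z : 'rV[R]_n) : sreg rapid F ->
  is_derive z (base i) (trig theta F j)
    (trig (theta + pi / 2) (fun j x => F j x * x 0 i) j z).
Proof.
move=> rF; have [C FC] := sreg_rapid_wbounded rF.
have [D FD] := sreg_rapid_wbounded (sreg_rapid_coord i rF).
apply: (is_derive_line0 (trig theta F j) z (base i) _).2.
have := @iint_is_derive R n
  (fun t x => F j x * cos (dot (z + t *: base i) x + theta))
  (fun t x => F j x * x 0 i * cos (dot (z + t *: base i) x + (theta + pi / 2)))
  0 1 C D ltr01.
case => //.
- move=> t x _; have := is_derive_cos_phase (dot z x + theta) (x 0 i) t.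
  move=> /(is_deriveZ (F j x)) => H.
  have -> : (fun t0 : R => F j x * cos (dot (z + t0 *: base i) x + theta)) =
      F j x \*: (fun s : R => cos (dot z x + theta + s * x 0 i)).
    apply/funext => s; rewrite dotDl dotZl dot_base /GRing.scale /=.
    by rewrite addrAC.
  refine (is_derive_eq H _); rewrite /GRing.scale /= dotDl dotZl dot_base.
  by rewrite -mulrA [cos _ * _]mulrC !addrA [dot z x + _ + theta]addrAC.
- by move=> t _; exact: trig_wbounded.
- by move=> t x _; apply: (trig_wbounded _ _ (FD j)).2.
- exact: (trig_wbounded _ _ (FD j)).1.
by move=> d1 d2; split => //; rewrite d2 scale0r addr0.
Qed.

Lemma trig_continuous theta F j : sreg rapid F -> continuous (trig theta F j).
Proof.
move=> rF z; have [C FC] := sreg_rapid_wbounded rF.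
apply: (@iint_cvg _ _ (nbhs z) _ C n (fun z x => F j x * cos (dot z x + theta))).
- exact: countable_base_nbhs.
- by apply: nearW => y; exact: trig_wbounded.
- exact: trig_wbounded.
- move=> x; apply: cvgM; first exact: cvg_cst.
  have -> : (fun y => cos (dot y x + theta)) = (fun y => cos (dot x y + theta)).
    by apply/funext => y; rewrite dotC.
  by rewrite dotC; exact: cos_phase_continuous.
Qed.

(** Comes from [iint_partial] applied to F(x) cos(z.x + theta). *)
Lemma trig_by_parts theta F (i : 'I_n) j (z : 'rV[R]_n) : sreg rapid F ->
  z 0 i * trig (theta + pi / 2) F j z =
  - trig theta (fun j x => 'D_(base i) (F j) x) j z.
Proof.
move=> rF; have [C FC] := sreg_rapid_wbounded rF.
have [D FD] := sreg_rapid_wbounded (sreg_der i rF).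
have w1 := trig_wbounded z theta (FD j).
have w2 := wboundedZ (z 0 i) (trig_wbounded z (theta + pi / 2) (FC j)).
apply/eqP; rewrite -addr_eq0 addrC -(iintZ _ (trig_wbounded z (theta + pi / 2) (FC j))).
rewrite -(iintD w1 w2); apply/eqP.
apply: (iint_partial (i := i) (trig_wbounded z theta (FC j)) (wboundedD w1 w2)).
move=> x; have dF := sreg_is_derive i j x rF.
have dq : is_derive x (base i) (fun x => dot z x + theta) (z 0 i).
  apply: (is_derive_line0 (fun x => dot z x + theta) x (base i) _).2.
  have -> : (fun s : R => dot z (x + s *: base i) + theta) =
      (fun s : R => dot z x + theta + s * z 0 i).
    by apply/funext => s; rewrite dotC dotDl dotZl dot_base dotC addrAC.
  exact: is_derive_affine.
have := is_deriveM dF (is_derive_comp_line dq (is_derive_cos _)).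
move=> H; refine (is_derive_eq H _); rewrite /GRing.scale /= addrA cosDpihalf; ring.
Qed.

Lemma trig_bound theta F : sreg rapid F ->
  exists C, forall j z, `|trig theta F j z| <= C.
Proof.
move=> rF; have [C FC] := sreg_rapid_wbounded rF.
by exists (C * wmass ^+ n) => j z; apply: iint_le; exact: trig_wbounded.
Qed.

Lemma trig_bound_coord N (i : 'I_n) theta F : sreg rapid F ->
  exists C, forall j (z : 'rV[R]_n), `|z 0 i| ^+ N * `|trig theta F j z| <= C.
Proof.
elim: N theta F => [|N IH] theta F rF.
  by have [C FC] := trig_bound theta rF; exists C => j z; rewrite expr0 mul1r.
have [C CP] := IH (theta - pi / 2) _ (sreg_der i rF).
exists C => j z; apply: le_trans (CP j z).
rewrite exprSr -mulrA -normrM -[theta in leLHS](subrK (pi / 2)).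
by rewrite trig_by_parts// normrN.
Qed.

(** The largest coordinate of z has modulus equal to the sup norm, and N integrations by parts in
    that coordinate give decay of order N. For |z| <= 1 boundedness suffices. *)
Lemma trig_rapid theta F : sreg rapid F -> rapid (trig theta F).
Proof.
move=> rF N.
have [C CP] := trig_bound theta rF.
have /choice[D DP] : forall i : 'I_n, exists D, forall j (z : 'rV[R]_n), `|z 0 i| ^+ N * `|trig theta F j z| <= D.
  by move=> i; exact: trig_bound_coord.
exists (2 ^+ N * (`|C| + \sum_i `|D i|)) => j z.
have S0 : 0 <= \sum_i `|D i| by rewrite sumr_ge0.
have [z1|z1] := leP `|z| 1.
  apply: (@le_trans _ _ (`|trig theta F j z| * 2 ^+ N)).
    by rewrite ler_wpM2l// lerXn2r ?nnegrE ?addr_ge0//; lra.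
  rewrite mulrC ler_wpM2l ?exprn_ge0//; apply: le_trans (CP j z) _.
  by apply: le_trans (ler_norm C) _; rewrite lerDl.
have [i zi] : exists i, `|z| = `|z 0 i|.
  have z0 : mx_norm z != 0 by apply: contraTneq z1; rewrite -leNgt /Num.Def.normr /= => ->.
  by have [[a i] E] := mx_norm_neq0 z0; exists i; rewrite /Num.Def.normr /= E ord1.
apply: (@le_trans _ _ (`|trig theta F j z| * (2 ^+ N * `|z 0 i| ^+ N))).
  rewrite ler_wpM2l// -exprMn lerXn2r ?nnegrE ?addr_ge0 ?mulr_ge0// -zi.
  by rewrite mulr_natl mulr2n lerD2r ltW.
rewrite mulrCA ler_wpM2l ?exprn_ge0// mulrC; apply: le_trans (DP i j z) _.
apply: le_trans (ler_norm _) _; rewrite (bigD1 i)//= addrCA lerDl addr_ge0//.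
by rewrite sumr_ge0.
Qed.

Lemma trig_sreg theta F : sreg rapid F -> sreg rapid (trig theta F).
Proof.
move=> + k; elim: k theta F => [|k IH] theta F rF.
  by split=> // [|j]; [exact: trig_rapid|exact: trig_continuous].
apply: regS_intro.
- exact: trig_rapid.
- by move=> j; exact: trig_continuous.
- move=> i; exists (trig (theta + pi / 2) (fun j x => F j x * x 0 i)); split.
    by move=> j x; exact: trig_is_derive.
  by apply: IH; exact: sreg_rapid_coord.
Qed.

End TrigonometricTransform.

(** * Complex values through real and imaginary parts *)

Section ComplexValues.
Context {R : realType}.
Implicit Types z w : R[i].
Local Notation Re := complex.Re.
Local Notation Im := complex.Im.

Lemma eq_complexP z w : Re z = Re w -> Im z = Im w -> z = w.
Proof. by case: z; case: w => a b c e /= -> ->. Qed.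

Lemma ReD z w : Re (z + w) = Re z + Re w. Proof. by case: z; case: w. Qed.
Lemma ImD z w : Im (z + w) = Im z + Im w. Proof. by case: z; case: w. Qed.
Lemma ReN z : Re (- z) = - Re z. Proof. by case: z. Qed.
Lemma ImN z : Im (- z) = - Im z. Proof. by case: z. Qed.
Lemma ReM z w : Re (z * w) = Re z * Re w - Im z * Im w.
Proof. by case: z; case: w. Qed.
Lemma ImM z w : Im (z * w) = Re z * Im w + Im z * Re w.
Proof. by case: z; case: w => a b c e. Qed.

Lemma normcE z : normc z = Num.sqrt (Re z ^+ 2 + Im z ^+ 2).
Proof. by case: z. Qed.

Lemma normc_ge0 z : 0 <= normc z.
Proof. by rewrite normcE sqrtr_ge0. Qed.

Lemma Re_le_normc z : `|Re z| <= normc z.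
Proof. by rewrite normcE -sqrtr_sqr ler_wsqrtr// lerDl sqr_ge0. Qed.

Lemma Im_le_normc z : `|Im z| <= normc z.
Proof. by rewrite normcE -sqrtr_sqr ler_wsqrtr// lerDr sqr_ge0. Qed.

Lemma normc_le z : normc z <= `|Re z| + `|Im z|.
Proof.
rewrite normcE -[leRHS]ger0_norm ?addr_ge0// -sqrtr_sqr ler_wsqrtr//.
rewrite sqrrD !real_normK ?num_real// -addrA lerD2l lerDr.
by rewrite mulrn_wge0// mulr_ge0.
Qed.

Lemma normcR (a : R) : normc a%:C = `|a|.
Proof. by rewrite normcE /= expr0n addr0 sqrtr_sqr. Qed.

Lemma cvg_normcP {T} (F : set_system T) {FF : Filter F} (f : T -> R[i]) (l : R[i]) :
  f x @[x --> F] --> l <->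
  forall e : R, 0 < e -> \forall x \near F, normc (f x - l) < e.
Proof.
have nE (z : R[i]) : `|z| = (normc z)%:C by [].
split=> [/cvgrPdist_lt H e e0|H].
  have := H e%:C; rewrite ltcR => /(_ e0); apply: filterS => x.
  by rewrite nE ltcR -opprB normcN.
apply/cvgrPdist_lt => -[e e'] H0.
have [e0 e'0] : 0 < e /\ e' = 0 by move: H0; rewrite ltcE /= => /andP[/eqP -> ->].
apply: filterS (H e e0) => x; rewrite nE e'0 -[_ +i* _]/(e%:C) ltcR.
by rewrite -opprB normcN.
Qed.

Lemma cvg_complexP {T} (F : set_system T) {FF : Filter F} (f : T -> R[i]) (l : R[i]) :
  f x @[x --> F] --> l <->
  (Re (f x) @[x --> F] --> Re l /\ Im (f x) @[x --> F] --> Im l).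
Proof.
split=> [/cvg_normcP H|[/cvgrPdist_lt HR /cvgrPdist_lt HI]].
  split; apply/cvgrPdist_lt => e e0; apply: filterS (H e e0) => x.
    apply: le_lt_trans; rewrite distrC -ReN -ReD; exact: Re_le_normc.
  apply: le_lt_trans; rewrite distrC -ImN -ImD; exact: Im_le_normc.
apply/cvg_normcP => e e0; have e2 : 0 < e / 2 by rewrite divr_gt0.
near=> x; apply: le_lt_trans (normc_le _) _; rewrite ReD ImD ReN ImN [e]splitr.
apply: ltrD; rewrite distrC; near: x; [exact: HR|exact: HI].
Unshelve. all: by end_near. Qed.

Lemma continuous_complexP (T : topologicalType) (f : T -> R[i]) :
  continuous f <->
  continuous (fun x => Re (f x)) /\ continuous (fun x => Im (f x)).
Proof.
split=> [H|[HR HI] x]; last by apply/cvg_complexP; split; [exact: HR|exact: HI].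
by split=> x; have /cvg_complexP[] := H x.
Qed.

End ComplexValues.

(** * Complex families and Schwartz functions *)

Section ComplexFamilies.
Context {R : realType} {n : nat}.
Local Notation Re := complex.Re.
Local Notation Im := complex.Im.

Definition csreg {J : Type} (B : (J -> 'rV[R]_n -> R) -> Prop)
    (F : J -> 'rV[R]_n -> R[i]) : Prop :=
  sreg (@base R n) B (fun j x => Re (F j x)) /\
  sreg (@base R n) B (fun j x => Im (F j x)).

Definition rpartials (s : seq 'I_n) (g : 'rV[R]_n -> R) : 'rV[R]_n -> R :=
  foldr (fun i g x => 'D_(base i) g x) g s.

Lemma partialsE s (g : 'rV[R]_n -> R[i]) : partials s g =
  fun x => rpartials s (fun y => Re (g y)) x +i* rpartials s (fun y => Im (g y)) x.
Proof.
elim: s => [|i s IH]; first by apply/funext => x /=; case: (g x).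
by rewrite /= -/(partials s g) IH; apply/funext => x.
Qed.

Lemma sreg_rpartials {J : Type} B s (F : J -> 'rV[R]_n -> R) :
  sreg (@base R n) B F -> sreg (@base R n) B (fun j => rpartials s (F j)).
Proof.
by elim: s => [//|i s IH] /IH /(sreg_der i).
Qed.

Lemma csreg_partials {J : Type} B s (F : J -> 'rV[R]_n -> R[i]) :
  csreg B F -> csreg B (fun j => partials s (F j)).
Proof.
move=> [rR rI]; split; under eq_fun do rewrite partialsE.
  exact: (sreg_rpartials s rR).
exact: (sreg_rpartials s rI).
Qed.

Lemma csreg_cderivable {J : Type} B (F : J -> 'rV[R]_n -> R[i]) i j x :
  csreg B F -> cderivable (F j) x (base i).
Proof.
by move=> [rR rI]; split; [have [] := sreg_is_derive i j x rR|
  have [] := sreg_is_derive i j x rI].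
Qed.

Lemma csreg_continuous {J : Type} B (F : J -> 'rV[R]_n -> R[i]) :
  csreg B F -> forall j, continuous (F j).
Proof.
move=> [rR rI] j; apply/continuous_complexP; split.
  exact: (sreg_continuous rR j).
exact: (sreg_continuous rI j).
Qed.

Arguments csreg_continuous {J B F} _ j.

Lemma csreg_smooth {J : Type} B (F : J -> 'rV[R]_n -> R[i]) j :
  csreg B F -> smooth (F j).
Proof.
move=> rF s; have rF' := csreg_partials s rF; split.
  exact: (csreg_continuous rF' j).
by move=> i x; exact: (csreg_cderivable i j x rF').
Qed.

Lemma enorm_ge0 (x : 'rV[R]_n) : 0 <= enorm x.
Proof. exact: sqrtr_ge0. Qed.

Lemma norm_le_enorm (x : 'rV[R]_n) : `|x| <= enorm x.
Proof.
apply: norm_le_coord => [|i]; first exact: enorm_ge0.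
rewrite /enorm -sqrtr_sqr ler_wsqrtr// /dot (bigD1 i)//= -expr2 lerDl.
by apply: sumr_ge0 => k _; rewrite -expr2 sqr_ge0.
Qed.

Lemma enorm_le_norm (x : 'rV[R]_n) : enorm x <= n%:R * `|x|.
Proof.
have nx : 0 <= n%:R * `|x| by rewrite mulr_ge0.
rewrite /enorm -[leRHS]ger0_norm// -sqrtr_sqr ler_wsqrtr//.
apply: (@le_trans _ _ (\sum_(i < n) `|x| ^+ 2)).
  apply: ler_sum => i _; rewrite -expr2 -(real_normK (num_real (x 0 i))).
  by rewrite lerXn2r ?nnegrE// coord_le_norm.
rewrite sumr_const card_ord -[leLHS]mulr_natl exprMn; apply: ler_wpM2r => //.
by rewrite expr2 -natrM ler_nat; case: (n) => // m; rewrite leq_pmulr.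
Qed.

Lemma norm1_enorm (x : 'rV[R]_n) k : 
  (1 + enorm x) ^+ k <= (n%:R + 1) ^+ k * (1 + `|x|) ^+ k.
Proof.
rewrite -exprMn lerXn2r ?nnegrE ?addr_ge0 ?mulr_ge0 ?enorm_ge0 ?addr_ge0//.
have := enorm_le_norm x; have := normr_ge0 x; have : 0 <= n%:R :> R by [].
by nra.
Qed.

Lemma csreg_rapid_bound {J : Type} (F : J -> 'rV[R]_n -> R[i]) k :
  csreg rapid F -> exists C, forall j x, normc (F j x) * (1 + `|x|) ^+ k <= C.
Proof.
move=> [rR rI]; have [C CP] := sreg_bound rR k; have [D DP] := sreg_bound rI k.
exists (C + D) => j x; apply: le_trans (lerD (CP j x) (DP j x)).
by rewrite -mulrDl ler_wpM2r ?normc_le// ltW ?norm1_gt0.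
Qed.

(** Each single derivative decreases rapidly, and a seminorm involves only the finitely many index
    sequences of bounded length, over which the bounds are combined. *)
Lemma csreg_rapid_schwartz {J : Type} (F : J -> 'rV[R]_n -> R[i]) j :
  csreg rapid F -> schwartz (F j).
Proof.
move=> rF; split; first exact: csreg_smooth rF.
move=> k.
suff H l : exists b : R, forall (s : seq 'I_n) x, (size s <= l)%N ->
    (1 + enorm x) ^+ k * normc (partials s (F j) x) <= b.
  by have [b bP] := H k; exists b.
have one s : exists b : R, 0 <= b /\
    forall x, (1 + enorm x) ^+ k * normc (partials s (F j) x) <= b.
  have [C CP] := csreg_rapid_bound k (csreg_partials s rF).
  exists ((n%:R + 1) ^+ k * `|C|); split.
    by rewrite mulr_ge0// exprn_ge0// addr_ge0.
  move=> x; apply: le_trans (ler_wpM2r (normc_ge0 _) (norm1_enorm _ _)) _.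
  rewrite -mulrA ler_wpM2l ?exprn_ge0 ?addr_ge0//.
  by rewrite mulrC (le_trans (CP j x))// ler_norm.
have [b bP] := choice one.
have fin (A : finType) (s_ : A -> seq 'I_n) : exists M, forall a, b (s_ a) <= M.
  exists (\sum_a b (s_ a)) => a; rewrite (bigD1 a)//= lerDl sumr_ge0// => a' _.
  exact: (bP _).1.
elim: l => [|l [M MP]].
  by exists (b [::]) => -[|//] x _; exact: (bP [::]).2.
have [M' M'P] := fin {: l.+1.-tuple 'I_n} (fun t => t : seq 'I_n).
exists (Num.max M M') => s x; rewrite leq_eqVlt => /orP[|sl]; last first.
  by rewrite le_max MP.
move=> sl; rewrite le_max; apply/orP; right.
exact: le_trans ((bP s).2 x) (M'P (Tuple sl)).
Qed.

Lemma csregM {J : Type} (B1 B2 B3 : (J -> 'rV[R]_n -> R) -> Prop) F G :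
  (forall F G, sreg (@base R n) B1 F -> sreg (@base R n) B2 G ->
     sreg (@base R n) B3 (fun j x => F j x * G j x)) ->
  (forall F G, B3 F -> B3 G -> B3 (fun j x => F j x + G j x)) ->
  (forall F, B3 F -> B3 (fun j x => - F j x)) ->
  csreg B1 F -> csreg B2 G -> csreg B3 (fun j x => F j x * G j x).
Proof.
move=> BM BD BN [FR FI] [GR GI]; split.
  under eq_fun do under eq_fun do rewrite ReM.
  move=> k; apply: reg_add => //; first exact: BM.
  by apply: reg_opp => //; exact: BM.
under eq_fun do under eq_fun do rewrite ImM.
by move=> k; apply: reg_add => //; exact: BM.
Qed.

Lemma csregD {J : Type} (B : (J -> 'rV[R]_n -> R) -> Prop) F G :
  (forall F G, B F -> B G -> B (fun j x => F j x + G j x)) ->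
  csreg B F -> csreg B G -> csreg B (fun j x => F j x + G j x).
Proof.
move=> BD [FR FI] [GR GI]; split.
  by under eq_fun do under eq_fun do rewrite ReD; move=> k; exact: reg_add.
by under eq_fun do under eq_fun do rewrite ImD; move=> k; exact: reg_add.
Qed.

Lemma csreg_sub {J : Type} (B B' : (J -> 'rV[R]_n -> R) -> Prop) F :
  (forall G, B G -> B' G) -> csreg B F -> csreg B' F.
Proof.
by move=> BB' [FR FI]; split=> k; [exact: reg_sub BB' (FR k)|exact: reg_sub BB' (FI k)].
Qed.

Lemma csreg_reindex {J J' : Type} (s : J' -> J) (B : (J -> 'rV[R]_n -> R) -> Prop)
    (B' : (J' -> 'rV[R]_n -> R) -> Prop) F :
  (forall G, B G -> B' (fun j => G (s j))) ->
  csreg B F -> csreg B' (fun j => F (s j)).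
Proof.
move=> BB' [FR FI]; split => k.
  exact: reg_reindex BB' (FR k).
exact: reg_reindex BB' (FI k).
Qed.

Lemma rapidN {J : Type} (F : J -> 'rV[R]_n -> R) : rapid F -> rapid (fun j x => - F j x).
Proof. by move=> rF N; have [C CP] := rF N; exists C => j x; rewrite normrN. Qed.

Lemma moderateN {J : Type} (F : J -> 'rV[R]_n -> R) :
  moderate F -> moderate (fun j x => - F j x).
Proof. by move=> [N [C CP]]; exists N, C => j x; rewrite normrN. Qed.

Lemma compactly_boundedN {J : Type} (F : J -> 'rV[R]_n -> R) :
  compactly_bounded F -> compactly_bounded (fun j x => - F j x).
Proof.
move=> [bF [r Fr]]; split; first exact: bounded_familyN.
by exists r => j x /Fr ->; rewrite oppr0.
Qed.

Lemma locally_boundedN {J : Type} (F : J -> 'rV[R]_n -> R) :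
  locally_bounded F -> locally_bounded (fun j x => - F j x).
Proof. by move=> bF r; have [C CP] := bF r; exists C => j x /CP; rewrite normrN. Qed.

Lemma csreg_rapidM {J : Type} (F G : J -> 'rV[R]_n -> R[i]) :
  csreg rapid F -> csreg moderate G -> csreg rapid (fun j x => F j x * G j x).
Proof.
by apply: csregM; [exact: sreg_rapidM|exact: rapidD|exact: rapidN].
Qed.

Lemma csreg_moderateM {J : Type} (F G : J -> 'rV[R]_n -> R[i]) :
  csreg moderate F -> csreg moderate G -> csreg moderate (fun j x => F j x * G j x).
Proof.
by apply: csregM; [exact: sreg_moderateM|exact: moderateD|exact: moderateN].
Qed.

Lemma csreg_compactM {J : Type} (F G : J -> 'rV[R]_n -> R[i]) :
  csreg compactly_bounded F -> csreg locally_bounded G ->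
  csreg compactly_bounded (fun j x => F j x * G j x).
Proof.
apply: csregM; [|exact: compactly_boundedD|exact: compactly_boundedN].
move=> f g rf rg k; apply: reg_mul (rf k) (rg k).
  exact: compactly_locally_bounded.
exact: compactly_boundedD.
Qed.

Lemma csreg_compact_rapid {J : Type} (F : J -> 'rV[R]_n -> R[i]) :
  csreg compactly_bounded F -> csreg rapid F.
Proof. by apply: csreg_sub => G; exact: bounded_rapid. Qed.

Lemma csreg_moderate_locally {J : Type} (F : J -> 'rV[R]_n -> R[i]) :
  csreg moderate F -> csreg locally_bounded F.
Proof. by apply: csreg_sub => G; exact: moderate_locally_bounded. Qed.

Lemma csreg_moderate_cst {J : Type} (c : J -> R[i]) C :
  (forall j, normc (c j) <= C) -> csreg moderate (fun j (_ : 'rV[R]_n) => c j).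
Proof.
move=> cC; split; apply: (@sreg_moderate_cst _ _ _ _ C) => j; apply: le_trans (cC j).
  exact: Re_le_normc.
exact: Im_le_normc.
Qed.

Lemma csreg_moderate_real {J : Type} (F : J -> 'rV[R]_n -> R) :
  sreg (@base R n) moderate F -> csreg moderate (fun j x => (F j x)%:C).
Proof.
move=> rF; split => //=.
by apply: (@sreg_moderate_cst _ _ _ _ 0) => _; rewrite normr0.
Qed.

End ComplexFamilies.
Arguments csreg_continuous {R n J B F} _ j.

(** * Complex integrals *)

Section ComplexIntegral.
Context {R : realType} {n : nat}.
Local Notation Re := complex.Re.
Local Notation Im := complex.Im.
Implicit Types g h : 'rV[R]_n -> R[i].

Definition cwbounded C g : Prop :=
  wbounded C (fun x => Re (g x)) /\ wbounded C (fun x => Im (g x)).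

Lemma Re_cint g : Re (cint g) = iint (fun x => Re (g x)). Proof. by []. Qed.
Lemma Im_cint g : Im (cint g) = iint (fun x => Im (g x)). Proof. by []. Qed.

Lemma cintD C C' g h : cwbounded C g -> cwbounded C' h ->
  cint (fun x => g x + h x) = cint g + cint h.
Proof.
move=> [gR gI] [hR hI]; apply: eq_complexP; rewrite ?ReD ?ImD !(Re_cint, Im_cint).
  by rewrite -(iintD gR hR); congr iint; apply/funext => x; rewrite ReD.
by rewrite -(iintD gI hI); congr iint; apply/funext => x; rewrite ImD.
Qed.

Lemma cintZ C (c : R[i]) g : cwbounded C g ->
  cint (fun x => c * g x) = c * cint g.
Proof.
move=> [gR gI].
apply: eq_complexP; rewrite ?ReM ?ImM !(Re_cint, Im_cint).
  rewrite -(iintZ _ gR) -(iintZ _ gI) -(iintB (wboundedZ _ gR) (wboundedZ _ gI)).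
  by congr iint; apply/funext => x; rewrite ReM.
rewrite -(iintZ _ gR) -(iintZ _ gI) -(iintD (wboundedZ _ gI) (wboundedZ _ gR)).
by congr iint; apply/funext => x; rewrite ImM.
Qed.

Lemma cwboundedZ C (c : R[i]) g : cwbounded C g ->
  exists C', cwbounded C' (fun x => c * g x).
Proof.
move=> [gR gI]; exists (`|Re c| * C + `|Im c| * C + (`|Re c| * C + `|Im c| * C)).
have C0 := wbounded_ge0 gR.
have p : 0 <= `|Re c| * C + `|Im c| * C by rewrite addr_ge0// mulr_ge0.
split; under eq_fun do rewrite ?ReM ?ImM.
  by apply: wboundedW (wboundedB (wboundedZ _ gR) (wboundedZ _ gI)); rewrite lerDl.
by apply: wboundedW (wboundedD (wboundedZ _ gI) (wboundedZ _ gR)); rewrite lerDr.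
Qed.

Lemma cwboundedD C C' g h : cwbounded C g -> cwbounded C' h ->
  cwbounded (C + C') (fun x => g x + h x).
Proof.
move=> [gR gI] [hR hI]; split; under eq_fun do rewrite ?ReD ?ImD.
  exact: wboundedD.
exact: wboundedD.
Qed.

Lemma cint_cvg {T} (F : set_system T) {FF : ProperFilter F} C
    (g : T -> 'rV[R]_n -> R[i]) g0 : countable_base F ->
  (\forall t \near F, cwbounded C (g t)) -> cwbounded C g0 ->
  (forall x, g t x @[t --> F] --> g0 x) -> cint (g t) @[t --> F] --> cint g0.
Proof.
move=> cF gC [g0R g0I] gcvg; apply/cvg_complexP; split.
  apply: (@iint_cvg _ _ F _ C n (fun t x => Re (g t x))) => //.
    by apply: filterS gC => t [].
  by move=> x; have /cvg_complexP[] := gcvg x.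
apply: (@iint_cvg _ _ F _ C n (fun t x => Im (g t x))) => //.
  by apply: filterS gC => t [].
by move=> x; have /cvg_complexP[] := gcvg x.
Qed.

Lemma cint_le C g : cwbounded C g -> normc (cint g) <= (C * wmass ^+ n) *+ 2.
Proof.
move=> [gR gI]; apply: le_trans (normc_le _) _; rewrite mulr2n.
by apply: lerD; exact: iint_le.
Qed.

Lemma cint_affine C g (k : R) (b : 'rV[R]_n) : 0 < k -> cwbounded C g ->
  cint g = (k ^+ n)%:C * cint (fun x => g (k *: x + b)).
Proof.
move=> k0 [gR gI].
apply: eq_complexP; rewrite ?ReM ?ImM /= ?mul0r ?subr0 ?addr0.
  exact: (iint_affine b k0 gR).
exact: (iint_affine b k0 gI).
Qed.

Lemma cint_partial (i : 'I_n) g C C' : cwbounded C g ->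
  cwbounded C' (cderive (base i) g) ->
  (forall x, cderivable g x (base i)) -> cint (cderive (base i) g) = 0.
Proof.
move=> [gR gI] [g'R g'I] dg; apply: eq_complexP.
  apply: (iint_partial (i := i) gR g'R) => x /=.
  by have [d _] := dg x; exact/derivableP.
apply: (iint_partial (i := i) gI g'I) => x /=.
by have [_ d] := dg x; exact/derivableP.
Qed.

Lemma cwbounded_normc C g : continuous g ->
  (forall x, normc (g x) <= C * weight x) -> cwbounded C g.
Proof.
move=> /continuous_complexP[cR cI] gC; split; split=> // x; apply: le_trans (gC x).
  exact: Re_le_normc.
exact: Im_le_normc.
Qed.

End ComplexIntegral.

(** * Fourier transforms of rapid families *)

Section Fourier.
Context {R : realType} {n : nat} {J : Type}.
Local Notation Re := complex.Re.
Local Notation Im := complex.Im.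
Implicit Types F : J -> 'rV[R]_n -> R[i].

Lemma csreg_rapid_cwbounded F : csreg rapid F -> exists C, forall j, cwbounded C (F j).
Proof.
move=> [FR FI]; have [C CP] := sreg_rapid_wbounded FR.
have [D DP] := sreg_rapid_wbounded FI; exists (Num.max C D) => j.
by split; [apply: wboundedW (CP j)|apply: wboundedW (DP j)]; rewrite le_max lexx ?orbT.
Qed.

Lemma cos_sub_pihalf (a : R) : cos (a - pi / 2) = sin a.
Proof. by rewrite -[a in RHS](subrK (pi / 2)) sinDpihalf. Qed.

Lemma fourier_integrandE (w : R[i]) (a : R) : w * expi (- a) =
  (Re w * cos a + Im w * sin a) +i* (Im w * cos a - Re w * sin a).
Proof.
by apply: eq_complexP; rewrite ?ReM ?ImM /= cosN sinN ?mulrN ?opprK// addrC.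
Qed.

Lemma fourier_cwbounded C (g : 'rV[R]_n -> R[i]) z : cwbounded C g ->
  cwbounded (C + C) (fun t => g t * expi (- dot z t)).
Proof.
move=> [gR gI].
have cw h : wbounded C h -> wbounded C (fun t => h t * cos (dot z t)).
  by move=> hC; have := trig_wbounded z 0 hC; under eq_fun do rewrite addr0.
have sw h : wbounded C h -> wbounded C (fun t => h t * sin (dot z t)).
  by move=> hC; have := trig_wbounded z (- (pi / 2)) hC; under eq_fun do rewrite cos_sub_pihalf.
split; under eq_fun do rewrite fourier_integrandE /=.
  exact: wboundedD (cw _ gR) (sw _ gI).
exact: wboundedB (cw _ gI) (sw _ gR).
Qed.

Lemma fourierE C F j z : cwbounded C (F j) -> fourier (F j) z =
  (trig 0 (fun j x => Re (F j x)) j z + trig (- (pi / 2)) (fun j x => Im (F j x)) j z) +i*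
  (trig 0 (fun j x => Im (F j x)) j z - trig (- (pi / 2)) (fun j x => Re (F j x)) j z).
Proof.
move=> [gR gI]; have w h theta : wbounded C h -> wbounded C (fun t => h t * cos (dot z t + theta)).
  exact: trig_wbounded.
apply: eq_complexP => /=.
  rewrite -(iintD (w _ 0 gR) (w _ (- (pi / 2)) gI)); congr iint; apply/funext => x.
  by rewrite fourier_integrandE /= addr0 cos_sub_pihalf.
rewrite -(iintB (w _ 0 gI) (w _ (- (pi / 2)) gR)); congr iint; apply/funext => x.
by rewrite fourier_integrandE /= addr0 cos_sub_pihalf.
Qed.

Lemma csreg_fourier F : csreg rapid F -> csreg rapid (fun j => fourier (F j)).
Proof.
move=> rF; have [C FC] := csreg_rapid_cwbounded rF; have [rR rI] := rF.
have N G : sreg (@base R n) rapid G -> sreg (@base R n) rapid (fun j x => - G j x : R).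
  by move=> rG k; apply: reg_opp (rG k); exact: rapidN.
have E j : fourier (F j) = fun z => (trig 0 (fun j x => Re (F j x)) j z +
      trig (- (pi / 2)) (fun j x => Im (F j x)) j z) +i*
    (trig 0 (fun j x => Im (F j x)) j z - trig (- (pi / 2)) (fun j x => Re (F j x)) j z).
  by apply/funext => z; exact: fourierE (FC j).
split; under eq_fun do rewrite E /=; apply: sreg_rapidD; try exact: trig_sreg.
by apply: N; exact: trig_sreg.
Qed.

(** The product of the factors - i u_j brought under the integral when a Fourier transform is
    differentiated along [s]. *)
Definition monomial_symbol (s : seq 'I_n) (u : 'rV[R]_n) : R[i] :=
  \prod_(i <- s) (0 -i* u 0 i).

Lemma csreg_monomial_symbol s :
  csreg moderate (fun (_ : J) => monomial_symbol s).
Proof.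
rewrite /monomial_symbol; elim: s => [|i s IH].
  under eq_fun do under eq_fun do rewrite big_nil.
  by apply: (@csreg_moderate_cst _ _ _ _ 1) => _; rewrite normc1.
under eq_fun do under eq_fun do rewrite big_cons.
apply: csreg_moderateM IH; split => /=.
  by apply: (@sreg_moderate_cst _ _ _ _ 0) => _; rewrite normr0.
exact: sreg_moderateN (sreg_moderate_coord i).
Qed.

Lemma fourier_cderive F (i : 'I_n) j : csreg rapid F ->
  cderive (base i) (fourier (F j)) = fourier (fun u => F j u * (0 -i* u 0 i)).
Proof.
move=> rF; have [C FC] := csreg_rapid_cwbounded rF; have [rR rI] := rF.
have rF' : csreg rapid (fun j u => F j u * (0 -i* u 0 i)).
  apply: csreg_rapidM rF _; have := csreg_monomial_symbol [:: i].
  by rewrite /monomial_symbol; under eq_fun do under eq_fun do rewrite big_seq1.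
have [D FD] := csreg_rapid_cwbounded rF'.
have E : fourier (F j) = fun z => (trig 0 (fun j x => Re (F j x)) j z +
      trig (- (pi / 2)) (fun j x => Im (F j x)) j z) +i*
    (trig 0 (fun j x => Im (F j x)) j z - trig (- (pi / 2)) (fun j x => Re (F j x)) j z).
  by apply/funext => y; exact: fourierE (FC j).
apply/funext => z; refine (etrans _ (esym (@fourierE D (fun j u => F j u * (0 -i* u 0 i)) j z (FD j)))).
have reE : (fun j x => Re (F j x * (0 -i* x 0 i))) = fun j x => Im (F j x) * x 0 i.
  by apply/funext => k; apply/funext => x; rewrite ReM /= mulr0 sub0r mulrN opprK.
have imE : (fun j x => Im (F j x * (0 -i* x 0 i))) = fun j x => - (Re (F j x) * x 0 i).
  by apply/funext => k; apply/funext => x; rewrite ImM /= mulr0 addr0 mulrN.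
have phase (G : J -> 'rV[R]_n -> R) :
    trig (pi / 2) G j z = trig (- (pi / 2)) (fun j x => - G j x) j z.
  congr iint; apply/funext => x.
  by rewrite cosDpihalf cos_sub_pihalf mulrN mulNr.
have tN th (G : J -> 'rV[R]_n -> R) K : wbounded K (G j) ->
    trig th (fun j x => - G j x) j z = - trig th G j z.
  move=> wG; rewrite -mulN1r -(iintZ _ (trig_wbounded z th wG)).
  by congr iint; apply/funext => x; rewrite mulN1r mulNr.
have dR th := trig_is_derive th i j z rR.
have dI th := trig_is_derive th i j z rI.
rewrite reE imE E; apply: eq_complexP => /=.
  have [_ ->] := is_deriveD (dR 0) (dI (- (pi / 2))).
  by rewrite add0r addNr phase addrC.
have [_ ->] := is_deriveB (dI 0) (dR (- (pi / 2))).
have [K KP] := sreg_rapid_wbounded (sreg_rapid_coord i rR).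
have [K' KP'] := sreg_rapid_wbounded (sreg_rapid_coord i rI).
rewrite add0r addNr phase.
rewrite (tN 0 (fun j x => Re (F j x) * x 0 i) K (KP j)).
by rewrite (tN (- (pi / 2)) (fun j x => Im (F j x) * x 0 i) K' (KP' j)) addrC.
Qed.

Lemma fourier_partials F s j : csreg rapid F ->
  partials s (fourier (F j)) = fourier (fun u => F j u * monomial_symbol s u).
Proof.
move=> rF; elim: s => [|i s IH].
  congr fourier; apply/funext => u; rewrite /monomial_symbol big_nil.
  by rewrite mulr1.
rewrite /= -/(partials s _) IH.
have rF' := csreg_rapidM rF (csreg_monomial_symbol s).
rewrite (fourier_cderive i j rF'); congr fourier; apply/funext => u.
by rewrite /monomial_symbol big_cons -mulrA; congr (_ * _); rewrite mulrC.
Qed.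

End Fourier.

(** * Complex differentiation and integration by parts *)

Section ComplexDerivatives.
Context {R : realType}.
Local Notation Re := complex.Re.
Local Notation Im := complex.Im.

Definition is_cderive {V : normedModType R} (x v : V) (f : V -> R[i]) (l : R[i]) : Prop :=
  is_derive x v (fun y => Re (f y)) (Re l) /\ is_derive x v (fun y => Im (f y)) (Im l).

Lemma is_cderiveP {V : normedModType R} (x v : V) (f : V -> R[i]) :
  cderivable f x v -> is_cderive x v f (cderive v f x).
Proof. by move=> [dR dI]; split; exact/derivableP. Qed.

Lemma is_cderiveE {V : normedModType R} (x v : V) (f : V -> R[i]) l :
  is_cderive x v f l -> cderivable f x v /\ cderive v f x = l.
Proof.
move=> [[dR eR] [dI eI]]; split=> //.
by rewrite /cderive eR eI; case: l {eR eI}.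
Qed.

Lemma is_cderiveM {V : normedModType R} (x v : V) (f g : V -> R[i]) df dg :
  is_cderive x v f df -> is_cderive x v g dg ->
  is_cderive x v (fun y => f y * g y) (df * g x + f x * dg).
Proof.
move=> [fR fI] [gR gI]; split.
  have H := is_deriveB (is_deriveM fR gR) (is_deriveM fI gI).
  have -> : (fun y => Re (f y * g y)) = (fun y => Re (f y) * Re (g y) - Im (f y) * Im (g y)).
    by apply/funext => y; rewrite ReM.
  refine (is_derive_eq H _); rewrite /GRing.scale /= ReD !ReM; ring.
have H := is_deriveD (is_deriveM fR gI) (is_deriveM fI gR).
have -> : (fun y => Im (f y * g y)) = (fun y => Re (f y) * Im (g y) + Im (f y) * Re (g y)).
  by apply/funext => y; rewrite ImM.
refine (is_derive_eq H _); rewrite /GRing.scale /= ImD !ImM; ring.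
Qed.

Lemma is_cderiveD {V : normedModType R} (x v : V) (f g : V -> R[i]) df dg :
  is_cderive x v f df -> is_cderive x v g dg ->
  is_cderive x v (fun y => f y + g y) (df + dg).
Proof.
move=> [fR fI] [gR gI]; split.
  have -> : (fun y => Re (f y + g y)) = (fun y => Re (f y) + Re (g y)).
    by apply/funext => y; rewrite ReD.
  by rewrite ReD; exact: is_deriveD.
have -> : (fun y => Im (f y + g y)) = (fun y => Im (f y) + Im (g y)).
  by apply/funext => y; rewrite ImD.
by rewrite ImD; exact: is_deriveD.
Qed.

Lemma is_cderive_cst {V : normedModType R} (x v : V) (c : R[i]) :
  is_cderive x v (fun=> c) 0.
Proof. by split; exact: is_derive_cst. Qed.

Lemma is_cderiveZ {V : normedModType R} (x v : V) (f : V -> R[i]) (c : R[i]) df :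
  is_cderive x v f df -> is_cderive x v (fun y => c * f y) (c * df).
Proof.
by move=> H; have := is_cderiveM (is_cderive_cst x v c) H; rewrite mul0r add0r.
Qed.

Lemma csreg_is_cderive n {J : Type} B (F : J -> 'rV[R]_n -> R[i]) i j x :
  csreg B F -> is_cderive x (base i) (F j) (cderive (base i) (F j) x).
Proof. by move=> rF; apply: is_cderiveP; exact: csreg_cderivable rF. Qed.

Lemma cint_is_derive n (g g' : R -> 'rV[R]_n -> R[i]) (t0 e C C' : R) : 0 < e ->
  (forall t x, `|t - t0| < e -> is_cderive t (1 : R) (g^~ x) (g' t x)) ->
  (forall t, `|t - t0| < e -> cwbounded C (g t)) ->
  (forall t x, `|t - t0| < e -> normc (g' t x) <= C' * weight x) ->
  continuous (g' t0) ->
  is_cderive t0 (1 : R) (fun t => cint (g t)) (cint (g' t0)).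
Proof.
move=> e0 dg gC g'C /continuous_complexP[cR cI]; split.
  apply: (@iint_is_derive R n (fun t x => Re (g t x)) (fun t x => Re (g' t x)) t0 e C C') => //.
  - by move=> t x te; have [] := dg t x te.
  - by move=> t te; have [] := gC t te.
  - by move=> t x te; apply: le_trans (g'C t x te); exact: Re_le_normc.
apply: (@iint_is_derive R n (fun t x => Im (g t x)) (fun t x => Im (g' t x)) t0 e C C') => //.
- by move=> t x te; have [] := dg t x te.
- by move=> t te; have [] := gC t te.
- by move=> t x te; apply: le_trans (g'C t x te); exact: Im_le_normc.
Qed.

Lemma continuous_complexM (T : topologicalType) (f g : T -> R[i]) :
  continuous f -> continuous g -> continuous (fun x => f x * g x).
Proof.
move=> /continuous_complexP[fR fI] /continuous_complexP[gR gI].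
apply/continuous_complexP; split=> x.
  under eq_fun do rewrite ReM.
  exact: cvgB (cvgM (fR x) (gR x)) (cvgM (fI x) (gI x)).
under eq_fun do rewrite ImM.
exact: cvgD (cvgM (fR x) (gI x)) (cvgM (fI x) (gR x)).
Qed.

Lemma continuous_complexD (T : topologicalType) (f g : T -> R[i]) :
  continuous f -> continuous g -> continuous (fun x => f x + g x).
Proof.
move=> /continuous_complexP[fR fI] /continuous_complexP[gR gI].
apply/continuous_complexP; split=> x.
  by under eq_fun do rewrite ReD; exact: cvgD (fR x) (gR x).
by under eq_fun do rewrite ImD; exact: cvgD (fI x) (gI x).
Qed.

(** The constant depends on [K], [N] and the family, but not on [V]. In [spreading] the role of [V]
    is played by the rescaled and normalized solution, and the independence yields uniformity in the
    scale. *)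
Lemma growth_cwbounded n {J : Type} (G : J -> 'rV[R]_n -> R[i]) (K : R) (N : nat) :
  csreg rapid G -> exists C, forall j (V : 'rV[R]_n -> R[i]), continuous V ->
    (forall x, normc (V x) <= K * (1 + `|x|) ^+ N) ->
    cwbounded C (fun x => V x * G j x).
Proof.
move=> rG; have [C CP] := csreg_rapid_bound (N + 2 * n) rG.
exists (`|K| * C) => j V cV VK; apply: cwbounded_normc.
  exact: continuous_complexM cV (csreg_continuous rG j).
move=> x; rewrite normcM -mulrA.
apply: (@le_trans _ _ (`|K| * (1 + `|x|) ^+ N * normc (G j x))).
  rewrite ler_wpM2r ?normc_ge0//; apply: le_trans (VK x) _.
  by rewrite ler_wpM2r ?ler_norm// ltW ?norm1_gt0.
rewrite -mulrA ler_wpM2l//.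
have := ler_wpM2r (weight_ge0 x) (CP j x); apply: le_trans.
rewrite exprD -!mulrA mulrC ler_wpM2l ?normc_ge0//.
by rewrite ler_peMr ?weight_norm1// ltW ?norm1_gt0.
Qed.

Lemma compact_norm_bounded (T : topologicalType) (A : set T) (f : T -> R) :
  compact A -> (forall x, A x -> {for x, continuous f}) ->
  exists C, forall x, A x -> `|f x| <= C.
Proof.
move=> cA cf; have [A0|A0] := pselect (A !=set0); last first.
  by exists 0 => x Ax; exfalso; apply: A0; exists x.
have [|c _ cP] := @compact_EVT_max T R (fun x => `|f x|) A A0 cA.
  apply: continuous_in_subspaceT => x /set_mem Ax.
  by apply: cvg_norm; exact: cf.
by exists `|f c| => x Ax; apply: cP; rewrite inE.
Qed.

Lemma closed_ball_compact n (r : R) : compact [set x : 'rV[R]_n | `|x| <= r].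
Proof.
apply: bounded_closed_compact.
  by exists r; split; [exact: num_real|move=> M rM x /= xr; apply: le_trans (ltW rM)].
have cn : continuous (fun x : 'rV[R]_n => `|x|).
  apply: (@lipschitz_continuous _ _ _ 1) => x y; rewrite mul1r.
  exact: ler_dist_dist.
apply: (@preimage_closed _ _ _ [set t | t <= r]) => [x _|]; first exact: cn.
exact: closed_le.
Qed.

Lemma compact_support_cwbounded n (g : 'rV[R]_n -> R[i]) (r : R) : continuous g ->
  (forall x, r < `|x| -> g x = 0) -> exists C, cwbounded C g.
Proof.
move=> cg g0; have /continuous_complexP[gR gI] := cg.
have [C CP] := compact_norm_bounded (@closed_ball_compact n r) (fun x _ => gR x).
have [D DP] := compact_norm_bounded (@closed_ball_compact n r) (fun x _ => gI x).
exists ((`|C| + `|D|) * (1 + `|r|) ^+ (2 * n)).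
apply: cwbounded_normc => // x; have [/g0 ->|xr] := ltP r `|x|.
  by rewrite normc0 mulr_ge0 ?weight_ge0// mulr_ge0 ?addr_ge0// exprn_ge0// addr_ge0.
rewrite -mulrA -[leLHS]mulr1; apply: ler_pM; rewrite ?normc_ge0//.
  apply: le_trans (normc_le _) _; apply: lerD.
    exact: le_trans (CP _ xr) (ler_norm _).
  exact: le_trans (DP _ xr) (ler_norm _).
apply: le_trans (weight_norm1 x) _; rewrite ler_wpM2r ?weight_ge0//.
rewrite lerXn2r ?nnegrE ?addr_ge0// lerD2l (le_trans xr)// ler_norm.
by [].
Qed.

(** No growth of [h] is assumed: the compact support of [g] makes all products integrable, and the
    derivative of the product h g has integral 0. *)
Lemma cint_by_parts n (i : 'I_n) (h g : 'rV[R]_n -> R[i]) :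
  continuous h -> continuous (cderive (base i) h) ->
  (forall x, cderivable h x (base i)) ->
  csreg compactly_bounded (fun _ : unit => g) ->
  cint (fun x => cderive (base i) h x * g x) =
  - cint (fun x => h x * cderive (base i) g x).
Proof.
move=> ch ch' dh rg; have rg' := csreg_partials [:: i] rg.
have [r1 [r1R r1I]] : exists r1, (forall x : 'rV[R]_n, r1 < `|x| -> g x = 0) /\ forall x, r1 < `|x| -> cderive (base i) g x = 0.
  have [[_ [a aP]] [_ [b bP]]] := (sreg_bound rg.1, sreg_bound rg.2).
  have [[_ [c cP]] [_ [e eP]]] := (sreg_bound rg'.1, sreg_bound rg'.2).
  exists (Num.max (Num.max a b) (Num.max c e)).
  split=> x; rewrite !gt_max => /andP[/andP[xa xb] /andP[xc xe]].
    by apply: eq_complexP; [exact: (aP tt)|exact: (bP tt)].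
  by apply: eq_complexP; [exact: (cP tt)|exact: (eP tt)].
have cg := csreg_continuous rg tt; have cg' := csreg_continuous rg' tt.
have D x := is_cderiveM (is_cderiveP (dh x)) (csreg_is_cderive i tt x rg).
have E x : cderive (base i) (fun y => h y * g y) x =
    cderive (base i) h x * g x + h x * cderive (base i) g x.
  by have [_] := is_cderiveE (D x).
have [|C1 w1] := @compact_support_cwbounded n
    (fun x => cderive (base i) h x * g x) r1 (continuous_complexM ch' cg).
  by move=> x /r1R ->; rewrite mulr0.
have [|C2 w2] := @compact_support_cwbounded n
    (fun x => h x * cderive (base i) g x) r1 (continuous_complexM ch cg').
  by move=> x /r1I ->; rewrite mulr0.
have [|C3 w3] := @compact_support_cwbounded n
    (fun x => h x * g x) r1 (continuous_complexM ch cg).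
  by move=> x /r1R ->; rewrite mulr0.
apply/eqP; rewrite -addr_eq0 -(cintD w1 w2); apply/eqP.
have -> : (fun x => cderive (base i) h x * g x + h x * cderive (base i) g x) =
    cderive (base i) (fun y => h y * g y).
  by apply/funext => x; rewrite E.
apply: (cint_partial (i := i) (C' := C1 + C2) w3).
  by rewrite (funext E : cderive _ _ = _); exact: cwboundedD.
by move=> x; have [] := is_cderiveE (D x).
Qed.

End ComplexDerivatives.

(** * The multiplier exp(t P(iu)) and evolution on the Fourier side *)

Section Symbol.
Context {R : realType} {n : nat} (P : mpoly n R[i]).
Local Notation Re := complex.Re.
Local Notation Im := complex.Im.

Definition psymbol (u : 'rV[R]_n) : R[i] := meval (imag_vec u) P.

(* The formal transpose P(-d/dx) of P(d/dx). *)
Definition adjoint_op (phi : 'rV[R]_n -> R[i]) (x : 'rV[R]_n) : R[i] :=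
  \sum_(m <- msupp P)
    mcoeff m P * ((-1) ^+ mdeg m * partials (rev (indices m)) phi x).

Lemma size_indices (m : multinom n) : size (indices m) = mdeg m.
Proof.
rewrite /indices size_flatten /shape -map_comp sumnE big_map mdegE big_enum /=.
by apply: eq_bigr => i _; rewrite size_nseq.
Qed.

Lemma monomial_symbol_rev (s : seq 'I_n) (u : 'rV[R]_n) :
  monomial_symbol (rev s) u = monomial_symbol s u.
Proof. by rewrite /monomial_symbol (perm_big s)// perm_rev. Qed.

(** (-1)^|m| (-iu)^m = (iu)^m: the sign of the transpose and that of the Fourier exponent cancel, so
    under [fourier] the operator [adjoint_op] becomes multiplication by P(iu). *)
Lemma monomial_symbol_indices (m : multinom n) (u : 'rV[R]_n) :
  (-1) ^+ mdeg m * monomial_symbol (indices m) u =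
  \prod_(i < n) imag_vec u i ^+ m i.
Proof.
rewrite /monomial_symbol /indices big_flatten big_map big_enum /= mdegE.
rewrite -prodrXr -big_split; apply: eq_bigr => i _ /=.
rewrite big_nseq iter_mulr_1 -exprMn; congr (_ ^+ _).
by apply: eq_complexP; rewrite ?ReM ?ImM ?ReN ?ImN /= !(mulr0, mul0r, oppr0, subr0, addr0, mulN1r, opprK).
Qed.

Lemma psymbolE u : psymbol u =
  \sum_(m <- msupp P) mcoeff m P *
    ((-1) ^+ mdeg m * monomial_symbol (rev (indices m)) u).
Proof.
rewrite /psymbol mevalE; apply: eq_bigr => m _.
by rewrite monomial_symbol_rev monomial_symbol_indices.
Qed.

Lemma csreg_moderate_sum {J I : Type} (r : seq I) (F : I -> J -> 'rV[R]_n -> R[i]) :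
  (forall i, csreg moderate (F i)) ->
  csreg moderate (fun j x => \sum_(i <- r) F i j x).
Proof.
move=> rF; elim: r => [|i r IH].
  under eq_fun do under eq_fun do rewrite big_nil.
  by apply: (@csreg_moderate_cst _ _ _ _ 0) => _; rewrite normc0.
under eq_fun do under eq_fun do rewrite big_cons.
exact: csregD (@moderateD _ _ _) _ _.
Qed.

Lemma csreg_psymbol {J : Type} : csreg moderate (fun _ : J => psymbol).
Proof.
have -> : psymbol = fun u => \sum_(m <- msupp P) mcoeff m P *
    ((-1) ^+ mdeg m * monomial_symbol (rev (indices m)) u).
  by apply/funext => u; exact: psymbolE.
apply: csreg_moderate_sum => m; apply: csreg_moderateM.
  by apply: csreg_moderate_cst => _; exact: lexx.
apply: csreg_moderateM; last exact: csreg_monomial_symbol.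
by apply: csreg_moderate_cst => _; exact: lexx.
Qed.

Lemma fourierD C C' (g h : 'rV[R]_n -> R[i]) z : cwbounded C g -> cwbounded C' h ->
  fourier (fun x => g x + h x) z = fourier g z + fourier h z.
Proof.
move=> gC hC; rewrite -(cintD (fourier_cwbounded z gC) (fourier_cwbounded z hC)).
by congr cint; apply/funext => x; rewrite mulrDl.
Qed.

Lemma fourierZ C (c : R[i]) (g : 'rV[R]_n -> R[i]) z : cwbounded C g ->
  fourier (fun x => c * g x) z = c * fourier g z.
Proof.
move=> gC; rewrite -(cintZ c (fourier_cwbounded z gC)).
by congr cint; apply/funext => x; rewrite mulrA.
Qed.

Lemma adjoint_fourier {J : Type} (F : J -> 'rV[R]_n -> R[i]) j : csreg rapid F ->
  adjoint_op (fourier (F j)) = fourier (fun u => psymbol u * F j u).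
Proof.
move=> rF; apply/funext => z; rewrite /adjoint_op.
have -> : (fun u => psymbol u * F j u) = (fun u => \sum_(m <- msupp P)
    mcoeff m P * ((-1) ^+ mdeg m * monomial_symbol (rev (indices m)) u) * F j u).
  by apply/funext => u; rewrite psymbolE mulr_suml.
have rm (m : multinom n) : csreg rapid (fun j u => F j u * monomial_symbol (rev (indices m)) u).
  by apply: csreg_rapidM rF _; exact: csreg_monomial_symbol.
elim: (msupp P) => [|m r IH].
  rewrite big_nil; have -> : (fun u : 'rV[R]_n => \sum_(m <- [::]) mcoeff m P *
      ((-1) ^+ mdeg m * monomial_symbol (rev (indices m)) u) * F j u) = fun=> 0.
    by apply/funext => u; rewrite big_nil.
  have w0 : cwbounded 0 (fun _ : 'rV[R]_n => 0 : R[i]).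
    by split; split=> [|x]; rewrite /= ?mul0r ?normr0//; exact: cst_continuous.
  rewrite -[LHS](mul0r (fourier (fun=> 0) z)) -(fourierZ 0 z w0).
  by congr fourier; apply/funext => x; rewrite mul0r.
rewrite big_cons IH.
have -> : (fun u : 'rV[R]_n => \sum_(m <- m :: r) mcoeff m P *
      ((-1) ^+ mdeg m * monomial_symbol (rev (indices m)) u) * F j u) =
    fun u => mcoeff m P * ((-1) ^+ mdeg m * monomial_symbol (rev (indices m)) u) * F j u +
    \sum_(m <- r) mcoeff m P *
      ((-1) ^+ mdeg m * monomial_symbol (rev (indices m)) u) * F j u.
  by apply/funext => u; rewrite big_cons.
rewrite fourier_partials//.
have [C FC] := csreg_rapid_cwbounded (rm m).
pose c := mcoeff m P * (-1) ^+ mdeg m.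
rewrite mulrA -(fourierZ c z (FC j)).
have [C1 w1] := cwboundedZ c (FC j).
have rs : csreg rapid (fun j u => \sum_(i <- r) mcoeff i P *
   ((-1) ^+ mdeg i * monomial_symbol (rev (indices i)) u) * F j u).
  under eq_fun do under eq_fun do rewrite -mulr_suml mulrC.
  apply: csreg_rapidM rF _; apply: csreg_moderate_sum => m'; apply: csreg_moderateM.
    by apply: csreg_moderate_cst => _; exact: lexx.
  apply: csreg_moderateM; last exact: csreg_monomial_symbol.
  by apply: csreg_moderate_cst => _; exact: lexx.
have [C2 w2] := csreg_rapid_cwbounded rs.
rewrite -(fourierD z w1 (w2 j)); congr fourier; apply/funext => u.
by rewrite /c; congr (_ + _); rewrite -!mulrA; congr (_ * (_ * _)); rewrite mulrC.
Qed.

(* exp(t P(iu)) *)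
Definition pexp (t : R) (u : 'rV[R]_n) : R[i] :=
  (expR (t * Re (psymbol u)))%:C * expi (t * Im (psymbol u)).

Lemma Re_pexp t u : Re (pexp t u) = expR (t * Re (psymbol u)) * cos (t * Im (psymbol u)).
Proof. by rewrite /pexp ReM /= mul0r subr0. Qed.

Lemma Im_pexp t u : Im (pexp t u) = expR (t * Re (psymbol u)) * sin (t * Im (psymbol u)).
Proof. by rewrite /pexp ImM /= mul0r addr0. Qed.

Lemma pexpD s t u : pexp (s + t) u = pexp s u * pexp t u.
Proof.
apply: eq_complexP.
  rewrite [RHS]ReM !Re_pexp !Im_pexp !mulrDl expRD cosD; ring.
rewrite [RHS]ImM !Re_pexp !Im_pexp !mulrDl expRD sinD; ring.
Qed.

Lemma pexp0 u : pexp 0 u = 1.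
Proof. by apply: eq_complexP; rewrite ?Re_pexp ?Im_pexp !mul0r expR0 ?cos0 ?sin0 ?mulr1 ?mulr0. Qed.

Lemma pexp_is_cderive t u :
  is_cderive t (1 : R) (pexp^~ u) (psymbol u * pexp t u).
Proof.
have dl (b : R) : is_derive t (1 : R) (fun s : R => s * b) b.
  by have := is_derive_affine 0 b t; under eq_fun do rewrite add0r.
have de := is_derive_comp_line (dl (Re (psymbol u))) (is_derive_expR _).
have dc := is_derive_comp_line (dl (Im (psymbol u))) (is_derive_cos _).
have ds := is_derive_comp_line (dl (Im (psymbol u))) (is_derive_sin _).
split.
  under eq_fun do rewrite Re_pexp.
  refine (is_derive_eq (is_deriveM de dc) _).
  rewrite /GRing.scale /= [RHS]ReM Re_pexp Im_pexp; ring.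
under eq_fun do rewrite Im_pexp.
refine (is_derive_eq (is_deriveM de ds) _).
rewrite /GRing.scale /= [RHS]ImM Re_pexp Im_pexp; ring.
Qed.

Lemma cos_sin_reg k :
  reg dir1 bounded_family k (fun _ : unit => @cos R) /\
  reg dir1 bounded_family k (fun _ : unit => @sin R).
Proof.
have bc : bounded_family (fun _ : unit => @cos R).
  by exists 1 => _ x; rewrite ler_norml cos_geN1 cos_le1.
have bs : bounded_family (fun _ : unit => @sin R).
  by exists 1 => _ x; rewrite ler_norml sin_geN1 sin_le1.
elim: k => [|k [IHc IHs]].
  by split; split=> // _; [exact: continuous_cos|exact: continuous_sin].
split; apply: regS_intro => //.
- by move=> _; exact: continuous_cos.
- move=> i; exists (fun _ x => - sin x); split; first by move=> _ x; exact: is_derive_cos.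
  by apply: reg_opp IHs; exact: bounded_familyN.
- by move=> _; exact: continuous_sin.
- by move=> i; exists (fun _ => cos); split=> // _ x; exact: is_derive_sin.
Qed.

Lemma sreg_expR {J : Type} (q : J -> 'rV[R]_n -> R) : sreg (@base R n) moderate q ->
  sreg (@base R n) locally_bounded (fun j x => expR (q j x)).
Proof.
move=> rq; apply: (@sreg_comp _ _ J (fun h : J -> R -> R => forall r, exists C, forall j x,
    `|x| <= r -> `|h j x| <= C) locally_bounded (fun=> expR)); last exact: rq.
- move=> h hP r; have [C CP] := moderate_locally_bounded (sreg_bound rq) r.
  by have [D DP] := hP C; exists D => j x /(CP j) /DP.
- move=> F G bF /moderate_locally_bounded; exact: locally_boundedM.
- exact: locally_boundedD.
- have b : forall r : R, exists C, forall (_ : J) (x : R), `|x| <= r -> `|expR x| <= C.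
    move=> r; exists (expR r) => _ x xr; rewrite ger0_norm ?expR_ge0// ler_expR.
    exact: le_trans (ler_norm x) xr.
  elim=> [|k IH]; first by split=> // _; exact: continuous_expR.
  apply: regS_intro => // [_|i]; first exact: continuous_expR.
  by exists (fun=> expR); split => // _ x; exact: is_derive_expR.
Qed.

Lemma sreg_locallyM {J : Type} (F G : J -> 'rV[R]_n -> R) :
  sreg (@base R n) locally_bounded F -> sreg (@base R n) locally_bounded G ->
  sreg (@base R n) locally_bounded (fun j x => F j x * G j x).
Proof.
by move=> rF rG k; exact: reg_mul (@locally_boundedM _ _ _) (@locally_boundedD _ _ _) (rF k) (rG k).
Qed.

(** Only local bounds can be expected, since Re P(iu) may be positive off the cone and [tau] may be
    negative. The exponential is therefore multiplied by compactly supported functions, or by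
    [cone_cut]. *)
Lemma csreg_pexp {J : Type} (tau : J -> R) T : (forall j, `|tau j| <= T) ->
  csreg locally_bounded (fun j => pexp (tau j)).
Proof.
move=> tauT; have [pR pI] := @csreg_psymbol J.
have rt : sreg (@base R n) moderate (fun j (_ : 'rV[R]_n) => tau j).
  exact: sreg_moderate_cst tauT.
have re := sreg_expR (sreg_moderateM rt pR).
have rc := sreg_bounded_comp (fun k => (cos_sin_reg k).1) (sreg_moderateM rt pI).
have rs := sreg_bounded_comp (fun k => (cos_sin_reg k).2) (sreg_moderateM rt pI).
have ml F : sreg (@base R n) (@moderate R n J) F -> sreg (@base R n) locally_bounded F.
  by move=> rF k; apply: reg_sub (rF k); exact: moderate_locally_bounded.
split; under eq_fun do under eq_fun do rewrite ?Re_pexp ?Im_pexp.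
  exact: sreg_locallyM re (ml _ rc).
exact: sreg_locallyM re (ml _ rs).
Qed.

End Symbol.

(** * Spatial cutoffs and their commutators *)

Section Cutoff.
Context {R : realType} {n : nat}.

(** For e > 0 it is 1 on the Euclidean ball of radius 1 / e and 0 outside that of radius sqrt(2) /
    e; the squared norm keeps it smooth. *)
Definition cutoff (e : R) (x : 'rV[R]_n) : R[i] := (step (2 - e ^+ 2 * dot x x))%:C.

Lemma sreg_step_comp {J : Type} (q : J -> 'rV[R]_n -> R) : sreg (@base R n) moderate q ->
  sreg (@base R n) moderate (fun j x => step (q j x)).
Proof. by move=> rq; exact: (sreg_bounded_comp (@step_reg R) rq). Qed.

Lemma sreg_dotxx {J : Type} : sreg (@base R n) moderate (fun (_ : J) x => dot x x).
Proof.
apply: sreg_moderate_sum => i.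
by apply: sreg_moderateM; exact: sreg_moderate_coord.
Qed.

Lemma sreg_cutoff_arg {J : Type} (e : J -> R) : (forall j, `|e j| <= 1) ->
  sreg (@base R n) moderate (fun j x => 2 - e j ^+ 2 * dot x x).
Proof.
move=> e1; apply: sreg_moderateD.
  by apply: (@sreg_moderate_cst _ _ _ _ `|2|) => _.
apply: sreg_moderateN; apply: sreg_moderateM sreg_dotxx.
apply: (@sreg_moderate_cst _ _ _ _ 1) => j.
by rewrite normrX exprn_ile1.
Qed.

Lemma csreg_cutoff {J : Type} (e : J -> R) : (forall j, `|e j| <= 1) ->
  csreg moderate (fun j => cutoff (e j)).
Proof.
by move=> e1; apply: csreg_moderate_real; apply: sreg_step_comp; exact: sreg_cutoff_arg.
Qed.

(** The cutoff is a function of e x, so a derivative carries a factor e; the remaining factor is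
    moderate uniformly in the scale. *)
Lemma cutoff_cderive {J : Type} (e : J -> R) (i : 'I_n) : (forall j, `|e j| <= 1) ->
  exists K, csreg moderate K /\
    forall j x, cderive (base i) (cutoff (e j)) x = (e j)%:C * K j x.
Proof.
move=> e1; have rq := sreg_cutoff_arg e1.
have rd := @sreg_dotxx J.
have rs : sreg (@base R n) moderate
    (fun j x => 'D_(dir1 tt) step (2 - e j ^+ 2 * dot x x)).
  have rk k : reg dir1 bounded_family k (fun _ : unit => 'D_(dir1 tt) (@step R)).
    by have [_] := regSE tt (@step_reg R k.+1).
  exact: (sreg_bounded_comp rk rq).
exists (fun j x => ('D_(dir1 tt) step (2 - e j ^+ 2 * dot x x) *
    (- e j * 'D_(base i) (fun x => dot x x) x))%:C); split.
  apply: csreg_moderate_real; apply: (sreg_moderateM rs).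
  apply: sreg_moderateM; last exact: sreg_der rd.
  by apply: (@sreg_moderate_cst _ _ _ _ 1) => j; rewrite normrN.
move=> j x; have dd := sreg_is_derive i j x rd.
have dq := is_deriveB (is_derive_cst (2 : R) x (base i)) (is_deriveZ (e j ^+ 2) dd).
have [ds _] := regSE tt (@step_reg R 1).
have dk := is_derive_comp_line dq (ds tt _).
have H : is_cderive x (base i) (cutoff (e j)) ((e j)%:C *
   ('D_(dir1 tt) step (2 - e j ^+ 2 * dot x x) *
    (- e j * 'D_(base i) (fun x => dot x x) x))%:C).
  split; last first.
    by rewrite ImM /= mulr0 mul0r addr0; exact: is_derive_cst.
  refine (is_derive_eq dk _); rewrite /GRing.scale ReM /= mul0r subr0 sub0r.
  rewrite /GRing.scale /= expr2; ring.
by have [] := is_cderiveE H.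
Qed.

Lemma cutoff_eq0 (e : R) x : 2 <= e ^+ 2 * dot x x -> cutoff e x = 0.
Proof. by move=> H; rewrite /cutoff step_le0// subr_le0. Qed.

Lemma cutoff_eq1 (e : R) x : e ^+ 2 * dot x x <= 1 -> cutoff e x = 1.
Proof. by move=> H; rewrite /cutoff step_ge1//; lra. Qed.

Lemma norm_sqr_le_dot (x : 'rV[R]_n) : `|x| ^+ 2 <= dot x x.
Proof.
have d0 : 0 <= dot x x by apply: sumr_ge0 => i _; rewrite -expr2 sqr_ge0.
by rewrite -(sqr_sqrtr d0) lerXn2r ?nnegrE ?enorm_ge0// norm_le_enorm.
Qed.

Lemma cutoff_cvg (x : 'rV[R]_n) : cutoff e x @[e --> (0 : R)^'+] --> (1 : R[i]).
Proof.
have H : \forall e \near (0 : R)^'+, cst 1 e = cutoff e x.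
  have d1 : 0 < 1 + dot x x.
    by rewrite ltr_wpDr// sumr_ge0// => i _; rewrite -expr2 sqr_ge0.
  near=> e; rewrite cutoff_eq1//.
  have e0 : 0 < e by near: e; exact: nbhs_right_gt.
  have e1 : e < 1 by near: e; apply: nbhs_right_lt.
  have e2 : e < (1 + dot x x)^-1 by near: e; apply: nbhs_right_lt; rewrite invr_gt0.
  apply: (@le_trans _ _ (e * (1 + dot x x))).
    rewrite expr2 -mulrA; apply: ler_wpM2l; first exact: ltW.
    have : 0 <= dot x x by apply: le_trans (norm_sqr_le_dot x); rewrite sqr_ge0.
    nra.
  by rewrite -ler_pdivlMr// mul1r ltW.
by apply: cvg_trans (near_eq_cvg H) _; exact: cvg_cst.
Unshelve. all: by end_near. Qed.

Lemma csreg_compact_vanish {J : Type} (F : J -> 'rV[R]_n -> R[i]) (r : R) :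
  csreg locally_bounded F -> (forall j x, r < `|x| -> F j x = 0) ->
  csreg compactly_bounded F.
Proof.
move=> [FR FI] F0.
have oW : forall j : J, open [set x : 'rV[R]_n | r < `|x|].
  move=> _; have cn : continuous (fun x : 'rV[R]_n => `|x|).
    apply: (@lipschitz_continuous _ _ _ 1) => x y; rewrite mul1r.
    exact: ler_dist_dist.
  by apply: (@open_comp _ _ (fun x : 'rV[R]_n => `|x|) [set t | r < t]) => [x _|];
    [exact: cn|exact: open_gt].
have sub (G : J -> 'rV[R]_n -> R) :
    (locally_bounded G /\ forall j x, [set x : 'rV[R]_n | r < `|x|] x -> G j x = 0) ->
    compactly_bounded G.
  move=> [bG G0]; split; last by exists r.
  have [K KP] := bG r; exists `|K| => j x.
  have [xr|rx] := leP `|x| r; first exact: le_trans (KP j x xr) (ler_norm _).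
  by rewrite (G0 j x rx) normr0.
split=> k; apply: (reg_sub sub).
  by apply: reg_vanish (FR k) => // j x /(F0 j) ->.
by apply: reg_vanish (FI k) => // j x /(F0 j) ->.
Qed.

(** In the Leibniz expansion every term except the one with all derivatives on [F] contains a
    derivative of [K], hence a factor e. *)
Lemma cutoff_commutator {J : Type} (e : J -> R) (F K : J -> 'rV[R]_n -> R[i]) s :
  csreg rapid F -> csreg moderate K ->
  (forall i, exists K', csreg moderate K' /\
     forall j x, cderive (base i) (K j) x = (e j)%:C * K' j x) ->
  exists G, csreg rapid G /\ forall j x,
    partials s (fun x => F j x * K j x) x =
    partials s (F j) x * K j x + (e j)%:C * G j x.
Proof.
move=> rF rK dK; elim: s => [|i s [G [rG GP]]].
  exists (fun _ _ => 0); split; last by move=> j x; rewrite mulr0 addr0.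
  split=> k; apply: reg_cst; move=> N; exists 0 => _ x /=; rewrite normr0 mul0r//.
have [K' [rK' K'P]] := dK i.
have rF' := csreg_partials s rF.
exists (fun j x => partials s (F j) x * K' j x + cderive (base i) (G j) x); split.
  apply: (csregD (@rapidD _ _ _)); first exact: csreg_rapidM.
  exact: (csreg_partials [:: i] rG).
move=> j x; rewrite /= -/(partials s _) -/(partials s (F j)).
have -> : partials s (fun x => F j x * K j x) =
    fun x => partials s (F j) x * K j x + (e j)%:C * G j x.
  by apply/funext => y; exact: GP.
have H := is_cderiveD (is_cderiveM (csreg_is_cderive i j x rF')
  (csreg_is_cderive i j x rK)) (is_cderiveZ (e j)%:C (csreg_is_cderive i j x rG)).
have [_ ->] := is_cderiveE H.
by rewrite K'P; ring.
Qed.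

End Cutoff.

Section Pairs.
Context {S T : topologicalType} (t : T).

Lemma pairl_continuous : continuous (fun y : S => (y, t)).
Proof. move=> x; exact: (cvg_pair (@cvg_id _ (nbhs x)) (@cvg_cst _ t _ (nbhs x) _)). Qed.

End Pairs.

(** * Pairing the solution with Fourier transforms *)

Section Evolution.
Context {R : realType} {n d : nat} (P : mpoly n R[i]) (U : 'rV[R]_n -> R -> R[i]).
Hypothesis P_deg : forall m, m \in msupp P -> mdeg m = d.
Hypothesis U_regular : regular d U.
Hypothesis U_pde : forall x t, 0 < t -> cderive (1 : R) (U x) t = diff_op P (U ^~ t) x.
Hypothesis U_growth : slow_growth U.

(** The distributional Fourier transform of U(., t), evaluated at [phi]. *)
Definition uhat (t : R) (phi : 'rV[R]_n -> R[i]) : R[i] :=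
  cint (fun x => U x t * fourier phi x).

Lemma growth_on_interval a b : 0 < a -> exists K N, forall t x, a <= t <= b ->
  normc (U x t) <= K * (1 + `|x|) ^+ N.
Proof.
move=> a0; have [k1 [k2 [C CP]]] := U_growth.
exists (`|C| * (b + a^-1) ^+ k1 * (n%:R + 1) ^+ k2), k2 => t x /andP[at_ tb].
have t0 : 0 < t by exact: lt_le_trans at_.
have tt0 : 0 < t + t^-1 by rewrite addr_gt0 ?invr_gt0.
have x0 : 0 < 1 + enorm x by rewrite ltr_pwDl ?enorm_ge0.
have := CP x t t0; rewrite ler_pdivrMr ?exprn_gt0// ler_pdivrMr ?exprn_gt0// => H.
apply: le_trans H _.
apply: (@le_trans _ _ (`|C| * (1 + enorm x) ^+ k2 * (t + t^-1) ^+ k1)).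
  rewrite -!mulrA ler_wpM2r ?ler_norm// mulr_ge0 ?exprn_ge0//; exact: ltW.
apply: (@le_trans _ _ (`|C| * ((n%:R + 1) ^+ k2 * (1 + `|x|) ^+ k2) * (b + a^-1) ^+ k1)).
  apply: ler_pM; rewrite ?mulr_ge0 ?exprn_ge0 ?(ltW tt0) ?(ltW x0)//.
    by rewrite ler_wpM2l// norm1_enorm.
  rewrite lerXn2r ?nnegrE ?(ltW tt0) ?addr_ge0 ?invr_ge0 ?(ltW a0)//.
    by rewrite (le_trans (ltW t0)).
  by rewrite lerD// lef_pV2 ?posrE.
by rewrite le_eqVlt; apply/orP; left; apply/eqP; ring.
Qed.

Lemma U_continuous t : 0 < t -> continuous (U ^~ t).
Proof.
move=> t0 x; have [_ _ _ H] := U_regular.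
have := H [::] (x, t) (leq0n d) t0 => /= c.
apply: (@continuous_comp _ _ _ (fun y => (y, t)) (fun w => U w.1 w.2) x) c.
exact: pairl_continuous.
Qed.

Lemma partials_U_continuous s t : (size s <= d)%N -> 0 < t ->
  continuous (partials s (U ^~ t)).
Proof.
move=> sd t0 x; have [_ _ _ H] := U_regular.
have c := H s (x, t) sd t0.
apply: (@continuous_comp _ _ _ (fun y => (y, t)) (fun w => partials s (U ^~ w.2) w.1) x) c.
exact: pairl_continuous.
Qed.

Lemma compact_factor_cwbounded (h g : 'rV[R]_n -> R[i]) : continuous h ->
  csreg compactly_bounded (fun _ : unit => g) ->
  exists C, cwbounded C (fun x => h x * g x).
Proof.
move=> ch rg.
have [[_ [a aP]] [_ [b bP]]] := (sreg_bound rg.1, sreg_bound rg.2).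
apply: (@compact_support_cwbounded _ n (fun x => h x * g x) (Num.max a b)
  (continuous_complexM ch (csreg_continuous rg tt))).
move=> x; rewrite gt_max => /andP[/(aP tt) gR /(bP tt) gI].
have -> : g x = 0 by exact: eq_complexP.
by rewrite mulr0.
Qed.

Lemma partials_by_parts s t g : (size s <= d)%N -> 0 < t ->
  csreg compactly_bounded (fun _ : unit => g) ->
  cint (fun x => partials s (U ^~ t) x * g x) =
  (-1) ^+ size s * cint (fun x => U x t * partials (rev s) g x).
Proof.
move=> + t0; elim: s g => [|i s IH] g sd rg; first by rewrite expr0 mul1r.
have [_ _ dU _] := U_regular.
have := cint_by_parts (i := i) (partials_U_continuous (ltnW sd) t0)
  (partials_U_continuous sd t0) (fun x => dU s i x t sd t0) rg.
rewrite /= => ->; rewrite (IH _ (ltnW sd) (csreg_partials [:: i] rg)) exprS mulN1r mulNr.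
congr (- (_ * cint _)); apply/funext => x; congr (_ * _).
by rewrite rev_cons -cats1 /partials foldr_cat.
Qed.

Lemma cint_sum (I : eqType) (r : seq I) (h : I -> 'rV[R]_n -> R[i]) :
  (forall i, i \in r -> exists C, cwbounded C (h i)) ->
  (exists C, cwbounded C (fun x => \sum_(i <- r) h i x)) /\
  cint (fun x => \sum_(i <- r) h i x) = \sum_(i <- r) cint (h i).
Proof.
elim: r => [|i r IH] hw.
  have w0 : cwbounded 0 (fun _ : 'rV[R]_n => 0 : R[i]).
    by split; split=> [|x]; rewrite /= ?mul0r ?normr0//; exact: cst_continuous.
  have -> : (fun x => \sum_(i <- [::]) h i x) = fun=> 0.
    by apply/funext => x; rewrite big_nil.
  rewrite big_nil; split; first by exists 0.
  rewrite -[RHS](mul0r (cint (fun _ : 'rV[R]_n => 0))) -(cintZ 0 w0).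
  by congr cint; apply/funext => x; rewrite mul0r.
have [C wC] := hw i (mem_head _ _).
have [|[D wD] E] := IH; first by move=> j jr; apply: hw; rewrite in_cons jr orbT.
have -> : (fun x => \sum_(i <- i :: r) h i x) = fun x => h i x + \sum_(i <- r) h i x.
  by apply/funext => x; rewrite big_cons.
rewrite big_cons -E; split.
  by exists (C + D); exact: cwboundedD.
exact: cintD wC wD.
Qed.

Lemma diff_op_by_parts t g : 0 < t -> csreg compactly_bounded (fun _ : unit => g) ->
  cint (fun x => diff_op P (U ^~ t) x * g x) =
  cint (fun x => U x t * adjoint_op P g x).
Proof.
move=> t0 rg.
have sd m : m \in msupp P -> (size (indices m) <= d)%N.
  by move=> /P_deg md; rewrite size_indices md.
have w1 m : m \in msupp P -> exists C, cwbounded C (fun x =>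
    mcoeff m P * (partials (indices m) (U ^~ t) x * g x)).
  move=> mP; have [C wC] := compact_factor_cwbounded
    (partials_U_continuous (sd _ mP) t0) rg.
  by have [C' wC'] := cwboundedZ (mcoeff m P) wC; exists C'.
have w2' m : exists C, cwbounded C (fun x => U x t * partials (rev (indices m)) g x).
  apply: compact_factor_cwbounded; first exact: U_continuous.
  exact: csreg_partials.
have w2 m : m \in msupp P -> exists C, cwbounded C (fun x =>
    mcoeff m P * (-1) ^+ mdeg m * (U x t * partials (rev (indices m)) g x)).
  move=> mP; have [C wC] := w2' m.
  by have [C' wC'] := cwboundedZ (mcoeff m P * (-1) ^+ mdeg m) wC; exists C'.
transitivity (cint (fun x => \sum_(m <- msupp P)
    mcoeff m P * (partials (indices m) (U ^~ t) x * g x))).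
  congr cint; apply/funext => x; rewrite /diff_op mulr_suml.
  by apply: eq_bigr => m _; rewrite mulrA.
transitivity (cint (fun x => \sum_(m <- msupp P)
    mcoeff m P * (-1) ^+ mdeg m * (U x t * partials (rev (indices m)) g x))); last first.
  congr cint; apply/funext => x; rewrite /adjoint_op mulr_sumr.
  by apply: eq_bigr => m _; ring.
rewrite (cint_sum w1).2 (cint_sum w2).2; apply: eq_big_seq => m mP.
have [C wC] := compact_factor_cwbounded (partials_U_continuous (sd _ mP) t0) rg.
have [C' wC'] := w2' m.
rewrite (cintZ _ wC) (cintZ _ wC') (partials_by_parts (sd _ mP) t0 rg).
by rewrite size_indices mulrA.
Qed.

Lemma pexpN_is_cderive u t :
  is_cderive t (1 : R) (fun s => pexp P (- s) u) (- (psymbol P u * pexp P (- t) u)).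
Proof.
have dN : is_derive t (1 : R) (fun s : R => - s) (-1) by apply: is_derive_eq.
have [dR dI] := pexp_is_cderive P (- t) u.
split; [have := is_derive_comp_line dN dR|have := is_derive_comp_line dN dI].
  by rewrite mulrN1 ReN.
by rewrite mulrN1 ImN.
Qed.

End Evolution.

(** * Time derivative of the truncated pairing *)

Section EvolutionConstant.
Context {R : realType} {n d : nat} (P : mpoly n R[i]) (U : 'rV[R]_n -> R -> R[i]).
Local Notation Re := complex.Re.
Local Notation Im := complex.Im.
Hypothesis P_deg : forall m, m \in msupp P -> mdeg m = d.
Hypothesis U_regular : regular d U.
Hypothesis U_pde : forall x t, 0 < t -> cderive (1 : R) (U x) t = diff_op P (U ^~ t) x.
Hypothesis U_growth : slow_growth U.
Variable phi : 'rV[R]_n -> R[i].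
Hypothesis phi_csreg : csreg compactly_bounded (fun _ : unit => phi).

Lemma csreg_evolved {J : Type} (tau : J -> R) T : (forall j, `|tau j| <= T) ->
  csreg compactly_bounded (fun j u => phi u * pexp P (tau j) u).
Proof.
move=> tauT; apply: csreg_compactM; last exact: csreg_pexp tauT.
apply: (@csreg_reindex _ _ unit J (fun=> tt) compactly_bounded compactly_bounded
  (fun=> phi) _ phi_csreg) => G [[C GC] [r Gr]].
by split; [exists C|exists r] => j x; [exact: GC|exact: Gr].
Qed.

(** It solves the transposed equation d psi / dt = - P(-d/dx) psi, so its pairing with U(., t) is
    formally constant in t. *)
Let psi t : 'rV[R]_n -> R[i] := fourier (fun u => phi u * pexp P (- t) u).

Lemma csreg_psi {J : Type} (tau : J -> R) T : (forall j, `|tau j| <= T) ->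
  csreg rapid (fun j => psi (tau j)).
Proof.
move=> tauT; apply: (@csreg_fourier _ _ J (fun j u => phi u * pexp P (- tau j) u)).
apply: csreg_compact_rapid; apply: (csreg_evolved (T := T)) => j.
by rewrite normrN.
Qed.

Lemma adjoint_psi t :
  adjoint_op P (psi t) = fourier (fun u => psymbol P u * (phi u * pexp P (- t) u)).
Proof.
have H := csreg_compact_rapid
  (@csreg_evolved unit (fun=> - t) `|- t| (fun=> lexx _)).
exact: (@adjoint_fourier R n P unit (fun _ u => phi u * pexp P (- t) u) tt H).
Qed.

Lemma csreg_adjoint_psi {J : Type} (tau : J -> R) T : (forall j, `|tau j| <= T) ->
  csreg rapid (fun j => adjoint_op P (psi (tau j))).
Proof.
move=> tauT; under eq_fun do rewrite adjoint_psi.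
apply: (@csreg_fourier _ _ J (fun j u => psymbol P u * (phi u * pexp P (- tau j) u))).
under eq_fun do under eq_fun do rewrite mulrC.
apply: csreg_rapidM; last exact: csreg_psymbol.
apply: csreg_compact_rapid; apply: (csreg_evolved (T := T)) => j.
by rewrite normrN.
Qed.

Lemma cwbounded_le C (g : 'rV[R]_n -> R[i]) x : cwbounded C g ->
  normc (g x) <= (C + C) * weight x.
Proof.
move=> [[_ gR] [_ gI]]; apply: le_trans (normc_le _) _; rewrite mulrDl.
exact: lerD.
Qed.

Lemma cwbounded_continuous C (g : 'rV[R]_n -> R[i]) : cwbounded C g -> continuous g.
Proof. by move=> [[cR _] [cI _]]; apply/continuous_complexP. Qed.

Lemma psi_is_cderive x t0 :
  is_cderive t0 (1 : R) (psi^~ x) (- adjoint_op P (psi t0) x).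
Proof.
(* Taking the times near [t0] as the index set gives one majorant for the whole neighbourhood. *)
pose J := {t : R | `|t| <= `|t0| + 1}.
have tJ t : `|t - t0| < 1 -> `|t| <= `|t0| + 1.
  move=> tt0; rewrite -[t](subrK t0) addrC; apply: le_trans (ler_normD _ _) _.
  by rewrite lerD2l ltW.
have r1 : csreg rapid (fun (j : J) u => phi u * pexp P (- sval j) u).
  apply: csreg_compact_rapid; apply: (csreg_evolved (T := `|t0| + 1)) => -[t te] /=.
  by rewrite normrN.
have r2 : csreg rapid (fun (j : J) u => phi u * pexp P (- sval j) u * (- 1 * psymbol P u)).
  apply: csreg_rapidM r1 _; apply: csreg_moderateM; last exact: csreg_psymbol.
  by apply: (@csreg_moderate_cst _ _ _ _ 1) => _; rewrite normcN normc1.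
have [C1 w1] := csreg_rapid_cwbounded r1.
have [C2 w2] := csreg_rapid_cwbounded r2.
have := @cint_is_derive R n (fun t u => phi u * pexp P (- t) u * expi (- dot x u))
  (fun t u => phi u * pexp P (- t) u * (- 1 * psymbol P u) * expi (- dot x u))
  t0 1 (C1 + C1) ((C2 + C2) + (C2 + C2)) ltr01.
have -> : cint (fun u => phi u * pexp P (- t0) u * (- 1 * psymbol P u) * expi (- dot x u)) =
    - adjoint_op P (psi t0) x.
  have H := @csreg_evolved unit (fun=> - t0) `|- t0| (fun=> lexx _).
  have r3 : csreg rapid (fun (_ : unit) u => phi u * pexp P (- t0) u * psymbol P u).
    by apply: csreg_rapidM (csreg_compact_rapid H) _; exact: csreg_psymbol.
  have [C3 w3] := csreg_rapid_cwbounded r3.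
  rewrite adjoint_psi -[RHS]mulN1r.
  have -> : (fun u => psymbol P u * (phi u * pexp P (- t0) u)) =
     fun u => phi u * pexp P (- t0) u * psymbol P u by apply/funext => u; rewrite mulrC.
  have w3' : cwbounded C3 (fun u => phi u * pexp P (- t0) u * psymbol P u) := w3 tt.
  rewrite -(fourierZ (-1) x w3'); congr cint; apply/funext => u.
  by congr (_ * _); rewrite mulrCA.
apply.
- move=> t u _.
  have := is_cderiveM (is_cderiveM (is_cderive_cst t (1 : R) (phi u))
    (pexpN_is_cderive P u t)) (is_cderive_cst t (1 : R) (expi (- dot x u))).
  by congr is_cderive; rewrite mul0r add0r mulr0 addr0; congr (_ * _); ring.
- by move=> t /tJ te; exact: (fourier_cwbounded x (w1 (exist _ t te))).
- move=> t u /tJ te; 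
  exact: (cwbounded_le u (fourier_cwbounded x (w2 (exist _ t te)))).
- have te : `|t0| <= `|t0| + 1 by rewrite lerDl.
  exact: cwbounded_continuous (fourier_cwbounded x (w2 (exist _ t0 te))).
Qed.

Lemma cutoff_far (e : R) (x : 'rV[R]_n) : 0 < e -> 2 / e < `|x| -> cutoff e x = 0.
Proof.
move=> e0 xe; apply: cutoff_eq0.
apply: (@le_trans _ _ (e ^+ 2 * `|x| ^+ 2)); last first.
  by rewrite ler_wpM2l ?sqr_ge0// norm_sqr_le_dot.
rewrite -exprMn; have : 2 <= e * `|x| by rewrite mulrC -ler_pdivrMr// ltW.
by rewrite expr2 => H; nra.
Qed.

Lemma csreg_psi_cutoff {J : Type} (tau e : J -> R) T :
  (forall j, `|tau j| <= T) -> (forall j, `|e j| <= 1) ->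
  csreg rapid (fun j x => psi (tau j) x * cutoff (e j) x).
Proof.
by move=> tauT e1; apply: csreg_rapidM (csreg_psi tauT) (csreg_cutoff e1).
Qed.

Lemma cutoff_compact (e : R) : 0 < e <= 1 ->
  csreg compactly_bounded (fun _ : unit => cutoff e : 'rV[R]_n -> R[i]).
Proof.
move=> /andP[e0 e1]; apply: (@csreg_compact_vanish _ _ unit _ (2 / e)).
  apply: csreg_moderate_locally; apply: (csreg_cutoff (e := fun=> e)) => _.
  by rewrite ger0_norm// ltW.
by move=> _ x xe; rewrite cutoff_far.
Qed.

Lemma psi_cutoff_compact (t e : R) : 0 < e <= 1 ->
  csreg compactly_bounded (fun _ : unit => fun x => psi t x * cutoff e x).
Proof.
move=> /andP[e0 e1].
apply: (@csreg_compact_vanish _ _ unit _ (2 / e)).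
  have e1' : forall _ : unit, `|e| <= 1 by move=> _; rewrite ger0_norm// ltW.
  have := csreg_psi_cutoff (tau := fun=> t) (fun=> lexx `|t|) e1'.
  apply: csreg_sub => G rG s.
  by have [K KP] := rG 0%N; exists K => j x _; have := KP j x; rewrite expr0 mulr1.
by move=> _ x xe; rewrite cutoff_far// mulr0.
Qed.

Lemma dU_continuous t : 0 < t -> continuous (fun x => cderive (1 : R) (U x) t).
Proof.
move=> t0 x; have [_ H _ _] := U_regular.
have c := H (x, t) t0.
apply: (@continuous_comp _ _ _ (fun y => (y, t))
  (fun w : 'rV[R]_n * R => cderive (1 : R) (U w.1) w.2) x) c.
exact: pairl_continuous.
Qed.

Lemma dU_bounded a b r : 0 < a -> exists C, forall t x, a <= t <= b -> `|x| <= r ->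
  normc (cderive (1 : R) (U x) t) <= C.
Proof.
move=> a0; have [_ H _ _] := U_regular.
pose A := [set x : 'rV[R]_n | `|x| <= r] `*` `[a, b]%classic.
have cA : compact A := compact_setX (@closed_ball_compact R n r) (@segment_compact R a b).
have A0 w : A w -> 0 < w.2.
  by move=> [_] /=; rewrite in_itv /= => /andP[+ _]; exact: lt_le_trans.
have cR w : A w -> {for w, continuous (fun w : 'rV[R]_n * R => Re (cderive (1 : R) (U w.1) w.2))}.
  by move=> /A0 /H /cvg_complexP[].
have cI w : A w -> {for w, continuous (fun w : 'rV[R]_n * R => Im (cderive (1 : R) (U w.1) w.2))}.
  by move=> /A0 /H /cvg_complexP[].
have [C CP] := compact_norm_bounded cA cR.
have [D DP] := compact_norm_bounded cA cI.
exists (C + D) => t x tab xr; apply: le_trans (normc_le _) _.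
have Aw : A (x, t) by split => //=; rewrite in_itv.
by apply: lerD; [exact: (CP _ Aw)|exact: (DP _ Aw)].
Qed.

(** The error of truncation: only terms with a derivative on the cutoff survive in it. *)
Definition commutator (e t : R) (x : 'rV[R]_n) : R[i] :=
  adjoint_op P (fun x => psi t x * cutoff e x) x - cutoff e x * adjoint_op P (psi t) x.

(** The equation and integration by parts move P(d/dx) from U to the truncated [psi], while the
    derivative of [psi] subtracts the truncation of P(-d/dx) psi. The cutoff is essential for this,
    since slow growth bounds U but not its derivatives. *)
Lemma truncated_is_cderive (e t0 : R) : 0 < e <= 1 -> 0 < t0 ->
  is_cderive t0 (1 : R) (fun t => cint (fun x => U x t * (psi t x * cutoff e x)))
    (cint (fun x => U x t0 * commutator e t0 x)).
Proof.
move=> e01 t0_gt0; have /andP[e0 e1] := e01.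
pose J := {t : R | `|t| <= 2 * t0}.
have tJ t : `|t - t0| < t0 / 2 -> t0 / 2 <= t <= 2 * t0 /\ `|t| <= 2 * t0.
  by rewrite ltr_norml => /andP[h1 h2]; split; [lra|rewrite ger0_norm; lra].
have J2 (j : J) : `|sval j| <= 2 * t0 by case: j.
have eJ (j : J) : `|e| <= 1 by rewrite ger0_norm// ltW.
have t20 : 0 < t0 / 2 by rewrite divr_gt0.
have [K [N KN]] := growth_on_interval U_growth (2 * t0) t20.
have [C1 w1] := growth_cwbounded K N (csreg_psi_cutoff J2 eJ).
have rA : csreg rapid (fun (j : J) x => (-1 * cutoff e x) * adjoint_op P (psi (sval j)) x).
  under eq_fun do under eq_fun do rewrite mulrC.
  apply: csreg_rapidM (csreg_adjoint_psi J2) _; apply: csreg_moderateM (csreg_cutoff eJ).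
  by apply: (@csreg_moderate_cst _ _ _ _ 1) => _; rewrite normcN normc1.
have [C2 w2] := growth_cwbounded K N rA.
have [C3 w3] := csreg_rapid_cwbounded (csreg_psi_cutoff J2 eJ).
have [D DP] := dU_bounded (2 * t0) (2 / e) t20.
have tt0 : `|t0 - t0| < t0 / 2 by rewrite subrr normr0.
have cU t : `|t - t0| < t0 / 2 -> continuous (U^~ t).
  by move=> /tJ[/andP[h _] _]; apply: (U_continuous U_regular); exact: lt_le_trans h.
have w2' t : `|t - t0| < t0 / 2 ->
    cwbounded C2 (fun x => U x t * ((-1 * cutoff e x) * adjoint_op P (psi t) x)).
  move=> tt; have [tab tJ'] := tJ t tt.
  by apply: (w2 (exist _ t tJ')) => [|x]; [exact: cU|exact: KN].
have := @cint_is_derive R n (fun t x => U x t * (psi t x * cutoff e x))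
  (fun t x => cderive (1 : R) (U x) t * (psi t x * cutoff e x) +
     U x t * ((-1 * cutoff e x) * adjoint_op P (psi t) x))
  t0 (t0 / 2) C1 (`|D| * (C3 + C3) + (C2 + C2)) t20.
have -> : cint (fun x => cderive (1 : R) (U x) t0 * (psi t0 x * cutoff e x) +
     U x t0 * ((-1 * cutoff e x) * adjoint_op P (psi t0) x)) =
   cint (fun x => U x t0 * commutator e t0 x).
  have rc := psi_cutoff_compact t0 e01.
  have [C4 w4] := compact_factor_cwbounded (dU_continuous t0_gt0) rc.
  have ca : exists C, cwbounded C (fun x => U x t0 * adjoint_op P (fun x => psi t0 x * cutoff e x) x).
    have [C wC] : exists C, cwbounded C (fun x => \sum_(m <- msupp P) U x t0 *
        (mcoeff m P * ((-1) ^+ mdeg m * partials (rev (indices m)) (fun x => psi t0 x * cutoff e x) x))).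
      apply: (cint_sum _).1 => m _.
      have [C wC] := compact_factor_cwbounded (cU t0 tt0) (csreg_partials (rev (indices m)) rc).
      have [C' wC'] := cwboundedZ (mcoeff m P * (-1) ^+ mdeg m) wC; exists C'.
      by move: wC'; congr cwbounded; apply/funext => x; ring.
    by exists C; move: wC; congr cwbounded; apply/funext => x; rewrite /adjoint_op mulr_sumr.
  have [C5 w5] := ca.
  rewrite (cintD w4 (w2' t0 tt0)).
  under eq_fun do rewrite (U_pde _ t0_gt0).
  rewrite (diff_op_by_parts P_deg U_regular t0_gt0 rc) -(cintD w5 (w2' t0 tt0)).
  congr cint; apply/funext => x; rewrite /commutator; ring.
apply.
- move=> t x tt; have [tab _] := tJ t tt.
  have t_gt0 : 0 < t by move/andP: tab => [h _]; exact: lt_le_trans h.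
  have [dU _ _ _] := U_regular.
  have := is_cderiveM (is_cderiveP (dU x t t_gt0))
    (is_cderiveM (psi_is_cderive x t) (is_cderive_cst t (1 : R) (cutoff e x))).
  by congr is_cderive; congr (_ + _ * _); ring.
- move=> t tt; have [tab tJ'] := tJ t tt.
  by apply: (w1 (exist _ t tJ')) => [|x]; [exact: cU|exact: KN].
- move=> t x tt; have [tab tJ'] := tJ t tt.
  apply: le_trans (le_normcD _ _) _; rewrite mulrDl; apply: lerD; last first.
    exact: (cwbounded_le x (w2' t tt)).
  have [xe|xe] := ltP (2 / e) `|x|.
    rewrite cutoff_far// !mulr0 normc0 mulr_ge0 ?weight_ge0// mulr_ge0// addr_ge0//.
      exact: (wbounded_ge0 (w3 (exist _ t tJ')).1).
    exact: (wbounded_ge0 (w3 (exist _ t tJ')).1).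
  rewrite normcM -mulrA; apply: ler_pM; rewrite ?normc_ge0//.
    exact: le_trans (DP t x tab xe) (ler_norm _).
  exact: (cwbounded_le x (w3 (exist _ t tJ'))).
- apply: continuous_complexD; last exact: cwbounded_continuous (w2' t0 tt0).
  apply: continuous_complexM (dU_continuous t0_gt0) _.
  exact: (csreg_continuous (psi_cutoff_compact t0 e01) tt).
Qed.

End EvolutionConstant.

(** * The evolution identity and the initial condition *)

Section EvolutionIdentity.
Context {R : realType} {n d : nat} (P : mpoly n R[i]) (U : 'rV[R]_n -> R -> R[i]).
Local Notation Re := complex.Re.
Local Notation Im := complex.Im.
Hypothesis P_deg : forall m, m \in msupp P -> mdeg m = d.
Hypothesis U_regular : regular d U.
Hypothesis U_pde : forall x t, 0 < t -> cderive (1 : R) (U x) t = diff_op P (U ^~ t) x.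
Hypothesis U_growth : slow_growth U.

(** With the pairs (e, t) as indices, the remainders of [cutoff_commutator] form one rapid family;
    integrated against U they are bounded, and the factor e remains. *)
Lemma commutator_small phi a b : csreg compactly_bounded (fun _ : unit => phi) ->
  0 < a -> a <= b ->
  exists C, forall (e t : R), 0 < e <= 1 -> a <= t <= b ->
    normc (cint (fun x => U x t * commutator P phi e t x)) <= e * C.
Proof.
move=> phi_csreg a0 ab.
pose J := {p : R * R | 0 < p.1 <= 1 /\ a <= p.2 <= b}.
pose tau (j : J) := (sval j).2; pose ep (j : J) := (sval j).1.
have tauT j : `|tau j| <= b.
  have H : a <= (sval j).2 <= b := (svalP j).2.
  move/andP: H => [at_ tb]; rewrite /tau ger0_norm//.
  exact/ltW/(lt_le_trans a0).
have ep1 j : `|ep j| <= 1.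
  have H : 0 < (sval j).1 <= 1 := (svalP j).1.
  by move/andP: H => [e0 e1]; rewrite /ep ger0_norm// ltW.
have rpsi := csreg_psi P phi_csreg tauT.
have rcut := csreg_cutoff (n := n) ep1.
have /choice[G GP] := fun s => cutoff_commutator s rpsi rcut
  (fun i => cutoff_cderive i ep1).
pose H j x := \sum_(m <- msupp P)
  mcoeff m P * ((-1) ^+ mdeg m * G (rev (indices m)) j x).
have rH : csreg rapid H.
  rewrite /H; elim: (msupp P) => [|m r IH].
    under eq_fun do under eq_fun do rewrite big_nil.
    by split=> k; apply: reg_cst; move=> N; exists 0 => _ x /=; rewrite normr0 mul0r.
  under eq_fun do under eq_fun do rewrite big_cons.
  apply: (csregD (@rapidD _ _ _)) IH.
  under eq_fun do under eq_fun do rewrite mulrA mulrC.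
  apply: csreg_rapidM (GP _).1 _.
  by apply: csreg_moderate_cst => _; exact: lexx.
have [K [N KN]] := growth_on_interval U_growth b a0.
have [C wC] := growth_cwbounded K N rH.
exists ((C * wmass ^+ n) *+ 2) => e t e01 tab.
have [/andP[e0 e1] /andP[at_ tb]] := (e01, tab).
pose j : J := exist _ (e, t) (conj e01 tab).
have cU : continuous (U^~ t) by apply: (U_continuous U_regular); exact: lt_le_trans at_.
have wj : cwbounded C (fun x => U x t * H j x).
  by apply: wC => [|x]; [exact: cU|exact: KN].
have -> : cint (fun x => U x t * commutator P phi e t x) =
    e%:C * cint (fun x => U x t * H j x).
  rewrite -(cintZ _ wj); congr cint; apply/funext => x.
  rewrite mulrCA; congr (_ * _); rewrite /commutator /adjoint_op !mulr_sumr -sumrB.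
  apply: eq_bigr => m _; have [_ GE] := GP (rev (indices m)).
  by rewrite (GE j x) /tau /ep /=; ring.
rewrite normcM normcR ger0_norm ?(ltW e0)// ler_wpM2l ?(ltW e0)//.
exact: cint_le.
Qed.

Lemma cint_cutoff_cvg (V psi : 'rV[R]_n -> R[i]) C :
  cwbounded C (fun x => V x * psi x) ->
  cint (fun x => V x * (psi x * cutoff e x)) @[e --> (0 : R)^'+] -->
  cint (fun x => V x * psi x).
Proof.
move=> wV; have [[cR VR] [cI VI]] := wV.
apply: (@cint_cvg _ _ _ _ _ ((C + C))).
- exact/countable_base_within/countable_base_nbhs.
- near=> e.
  have rc : csreg moderate (fun _ : unit => cutoff (n := n) e).
    apply: (@csreg_cutoff _ _ unit (fun=> e)) => _.
    have e0 : 0 < e by near: e; exact: nbhs_right_gt.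
    by rewrite ger0_norm ?(ltW e0)//; near: e; apply: nbhs_right_le.
  apply: cwbounded_normc => [|x].
    under eq_fun do rewrite mulrA.
    apply: continuous_complexM; first exact: cwbounded_continuous wV.
    exact: (csreg_continuous rc tt).
  rewrite mulrA normcM; apply: le_trans (cwbounded_le x wV).
  by rewrite ler_piMr ?normc_ge0// normcR ger0_norm ?step_ge0// step_le1.
- by split; [apply: wboundedW wV.1|apply: wboundedW wV.2];
     rewrite lerDl (wbounded_ge0 wV.1).
- move=> x; apply/cvg_normcP => eps eps0.
  have /cvg_complexP[hR hI] := cutoff_cvg x.
  have /cvg_normcP H := cutoff_cvg x.
  have k0 : 0 < normc (V x * psi x) + 1 by rewrite ltr_wpDl// normc_ge0.
  apply: filterS (H _ (divr_gt0 eps0 k0)) => e.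
  rewrite ltr_pdivlMr// mulrC; apply: le_lt_trans.
  have -> : V x * (psi x * cutoff e x) - V x * psi x = (V x * psi x) * (cutoff e x - 1).
    by rewrite mulrBr mulr1 mulrA.
  by rewrite normcM ler_wpM2r ?normc_ge0// lerDl.
Unshelve. all: by end_near. Qed.

Lemma cvg_small_eq0 (f : R -> R[i]) (l : R[i]) (C : R) :
  f e @[e --> (0 : R)^'+] --> l ->
  (forall e, 0 < e <= 1 -> normc (f e) <= e * C) -> l = 0.
Proof.
move=> /cvg_normcP fl fC; apply: eq0_normc; apply/eqP; rewrite -[_ == _]negbK.
apply/negP => l0; have {}l0 : 0 < normc l by rewrite lt_neqAle eq_sym l0 normc_ge0.
have l2 : 0 < normc l / 2 by rewrite divr_gt0.
have C1 : 0 < `|C| + 1 by rewrite ltr_wpDl.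
have [e [[He e0] [e1 e2]]] : exists e, (normc (f e - l) < normc l / 2 /\ 0 < e) /\
    (e <= 1 /\ e <= normc l / 2 / (`|C| + 1)).
  near ((0 : R)^'+) => e; exists e; split; split.
  - by near: e; exact: fl.
  - by near: e; exact: nbhs_right_gt.
  - by near: e; apply: nbhs_right_le.
  - by near: e; apply: nbhs_right_le; rewrite divr_gt0.
have : normc l <= normc (f e - l) + normc (f e).
  rewrite -[normc (_ - _)]normcN opprB -[X in normc X <= _](subrK (f e)).
  exact: le_normcD.
have := fC e; rewrite e0 e1 => /(_ isT) fe.
have : normc (f e) <= normc l / 2.
  apply: le_trans fe _.
  apply: (@le_trans _ _ (e * (`|C| + 1))).
    by rewrite ler_wpM2l ?(ltW e0)// (le_trans (ler_norm C))// lerDl.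
  by rewrite -ler_pdivlMr.
lra.
Unshelve. all: by end_near. Qed.

(** Between times a and b the truncated pairing changes by O(e); letting e tend to 0 removes both
    the cutoff and the change. *)
Lemma uhat_evolved_constant phi a b : csreg compactly_bounded (fun _ : unit => phi) ->
  0 < a -> a <= b ->
  uhat U a (fun u => phi u * pexp P (- a) u) = uhat U b (fun u => phi u * pexp P (- b) u).
Proof.
move=> phi_csreg a0 ab; have b0 : 0 < b by exact: lt_le_trans ab.
pose psi t : 'rV[R]_n -> R[i] := fourier (fun u => phi u * pexp P (- t) u).
pose E e t := cint (fun x => U x t * (psi t x * cutoff e x)).
have [C CP] := commutator_small phi_csreg a0 ab.
have lim t : 0 < t -> E e t @[e --> (0 : R)^'+] --> uhat U t (fun u => phi u * pexp P (- t) u).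
  move=> t0; have rpsi := @csreg_psi _ _ P _ phi_csreg unit (fun=> t) `|t| (fun=> lexx _).
  have [K [N KN]] := growth_on_interval U_growth t t0.
  have [C' wC'] := growth_cwbounded K N rpsi.
  apply: (@cint_cutoff_cvg (U^~ t) (psi t) C').
  apply: (wC' tt) => [|x]; first exact: (U_continuous U_regular).
  by apply: KN; rewrite !lexx.
apply/eqP; rewrite -subr_eq0; apply/eqP; rewrite -opprB; apply/eqP; rewrite oppr_eq0; apply/eqP.
apply: (@cvg_small_eq0 (fun e => E e b - E e a) _ ((C * (b - a)) *+ 2)).
  exact: (cvgB (lim b b0) (lim a a0)).
move=> e e01; have e0 : 0 <= e by have /andP[/ltW] := e01.
have dE t : a <= t <= b -> is_cderive t (1 : R) (E e)
    (cint (fun x => U x t * commutator P phi e t x)).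
  move=> /andP[at_ _]; apply: (truncated_is_cderive P_deg U_regular U_pde U_growth) => //.
  exact: lt_le_trans at_.
have mm t : Num.min a b <= t <= Num.max a b -> a <= t <= b by rewrite min_l// max_r.
have ba : `|b - a| = b - a by rewrite ger0_norm// subr_ge0.
apply: le_trans (normc_le _) _.
have -> : e * ((C * (b - a)) *+ 2) = e * C * `|b - a| + e * C * `|b - a|.
  by rewrite ba; ring.
rewrite [Re _]ReD [Im _]ImD ReN ImN; apply: lerD.
  apply: (mean_value_le (f := fun t => Re (E e t))
    (f' := fun t => Re (cint (fun x => U x t * commutator P phi e t x)))).
    by move=> t /mm /dE [].
  by move=> t /mm tab; apply: le_trans (Re_le_normc _) (CP e t e01 tab).
apply: (mean_value_le (f := fun t => Im (E e t))
  (f' := fun t => Im (cint (fun x => U x t * commutator P phi e t x)))).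
  by move=> t /mm /dE [].
by move=> t /mm tab; apply: le_trans (Im_le_normc _) (CP e t e01 tab).
Qed.

(** Constancy is applied to [phi * pexp P t], which is again smooth with compact support. *)
Lemma uhat_evolution phi s t : csreg compactly_bounded (fun _ : unit => phi) ->
  0 < s -> 0 < t -> uhat U t phi = uhat U s (fun u => phi u * pexp P (t - s) u).
Proof.
move=> phi_csreg s0 t0.
have r := @csreg_evolved _ _ P _ phi_csreg unit (fun=> t) `|t| (fun=> lexx _).
have E (a : R) : (fun u => phi u * pexp P t u * pexp P (- a) u) =
    (fun u => phi u * pexp P (t - a) u).
  by apply/funext => u; rewrite -mulrA -pexpD.
have Et : (fun u => phi u * pexp P (t - t) u) = phi.
  by apply/funext => u; rewrite subrr pexp0 mulr1.
have [st|ts] := leP s t.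
  by have := uhat_evolved_constant r s0 st; rewrite !E Et.
by have := uhat_evolved_constant r t0 (ltW ts); rewrite !E Et.
Qed.

Lemma cvg_complexM {T} (F : set_system T) {FF : Filter F} (g h : T -> R[i]) (k l : R[i]) :
  g x @[x --> F] --> k -> h x @[x --> F] --> l -> g x * h x @[x --> F] --> k * l.
Proof.
move=> /cvg_complexP[gR gI] /cvg_complexP[hR hI]; apply/cvg_complexP; split.
  under eq_fun do rewrite ReM; rewrite ReM.
  exact: cvgB (cvgM gR hR) (cvgM gI hI).
under eq_fun do rewrite ImM; rewrite ImM.
exact: cvgD (cvgM gR hI) (cvgM gI hR).
Qed.

Lemma cvg_complex_unique {T} (F : set_system T) {FF : ProperFilter F}
    (g : T -> R[i]) (k l : R[i]) :
  g x @[x --> F] --> k -> g x @[x --> F] --> l -> k = l.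
Proof.
move=> /cvg_complexP[gR gI] /cvg_complexP[hR hI].
by apply: eq_complexP; [exact: cvg_unique gR hR|exact: cvg_unique gI hI].
Qed.

Lemma pexp_factor_cvg (phi : 'rV[R]_n -> R[i]) x u :
  phi u * pexp P (t - 1) u * expi (- dot x u) @[t --> (0 : R)^'+] -->
  phi u * pexp P (0 - 1) u * expi (- dot x u).
Proof.
apply: cvg_complexM; last exact: cvg_cst.
apply: cvg_complexM; first exact: cvg_cst.
have [[dR _] [dI _]] := pexp_is_cderive P (0 - 1) u.
have cs : t - 1 @[t --> (0 : R)^'+] --> (0 - 1 : R).
  by apply: cvg_at_right_filter; apply: cvgB; [exact: cvg_id|exact: cvg_cst].
have cR := differentiable_continuous ((derivable1_diffP _ _).1 dR).
have cI := differentiable_continuous ((derivable1_diffP _ _).1 dI).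
apply/cvg_complexP; split.
  exact: (cvg_comp _ _ cs cR).
exact: (cvg_comp _ _ cs cI).
Qed.

Variable f : ('rV[R]_n -> R[i]) -> R[i].
Hypothesis U_initial : forall phi, schwartz phi ->
  cint (fun x => U x t * phi x) @[t --> 0^'+] --> f phi.

(** For t > 0 the evolution identity equates [uhat U t phi] with the pairing at time 1 of phi exp((t
    - 1) P). As t tends to 0, the first tends to f(fourier phi) by the initial condition and the
    second to its value at t = 0 by dominated convergence. *)
Lemma uhat_eq0 phi : csreg compactly_bounded (fun _ : unit => phi) ->
  f (fourier phi) = 0 -> uhat U 1 (fun u => phi u * pexp P (- 1) u) = 0.
Proof.
move=> phi_csreg f0.
have rphi := csreg_fourier (csreg_compact_rapid phi_csreg).
have lim0 : uhat U t phi @[t --> (0 : R)^'+] --> (0 : R[i]).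
  by rewrite -f0; apply: U_initial; exact: (csreg_rapid_schwartz tt rphi).
pose J := {t : R | `|t| <= 1}.
have J1 (j : J) : `|sval j - 1| <= 2.
  by case: j => t t1 /=; apply: le_trans (ler_normB _ _) _; rewrite normr1; lra.
have rJ := csreg_compact_rapid (csreg_evolved P phi_csreg J1).
have [C wC] := csreg_rapid_cwbounded rJ.
have [K [N KN]] := growth_on_interval U_growth 1 ltr01.
have [D wD] := growth_cwbounded K N (csreg_fourier rJ).
have cU : continuous (U^~ 1) by exact: (U_continuous U_regular).
have K1 x : normc (U x 1) <= K * (1 + `|x|) ^+ N by apply: KN; rewrite !lexx.
have n1 : \forall t \near (0 : R)^'+, `|t| <= 1.
  near=> t; have t0 : 0 < t by near: t; exact: nbhs_right_gt.
  by rewrite ger0_norm ?(ltW t0)//; near: t; exact: nbhs_right_le.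
have z1 : `|0 : R| <= 1 by rewrite normr0.
have lim1 : uhat U 1 (fun u => phi u * pexp P (t - 1) u) @[t --> (0 : R)^'+] -->
    uhat U 1 (fun u => phi u * pexp P (0 - 1) u).
  apply: (@cint_cvg _ _ _ _ _ D).
  - exact/countable_base_within/countable_base_nbhs.
  - by apply: filterS n1 => t t1; exact: (wD (exist _ t t1)).
  - exact: (wD (exist _ 0 z1)).
  - move=> x.
    have : fourier (fun u => phi u * pexp P (t - 1) u) x @[t --> (0 : R)^'+] -->
       fourier (fun u => phi u * pexp P (0 - 1) u) x.
      apply: (@cint_cvg _ _ _ _ _ (C + C)).
      + exact/countable_base_within/countable_base_nbhs.
      + by apply: filterS n1 => t t1; exact: (fourier_cwbounded x (wC (exist _ t t1))).
      + exact: (fourier_cwbounded x (wC (exist _ 0 z1))).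
      + by move=> u; exact: pexp_factor_cvg.
    by move=> H; apply: cvg_complexM H; exact: cvg_cst.
have : uhat U t phi @[t --> (0 : R)^'+] --> uhat U 1 (fun u => phi u * pexp P (0 - 1) u).
  apply: cvg_trans lim1; apply: near_eq_cvg; near=> t.
  by rewrite (uhat_evolution phi_csreg ltr01).
rewrite sub0r => lim2.
exact: cvg_complex_unique lim2 lim0.
Unshelve. all: by end_near. Qed.

End EvolutionIdentity.

(** * Spectral support of the solution *)

Section SpectralSupport.
Context {R : realType} {n d : nat} (P : mpoly n R[i]) (U : 'rV[R]_n -> R -> R[i]).
Hypothesis P_deg : forall m, m \in msupp P -> mdeg m = d.
Hypothesis U_regular : regular d U.
Hypothesis U_pde : forall x t, 0 < t -> cderive (1 : R) (U x) t = diff_op P (U ^~ t) x.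
Hypothesis U_growth : slow_growth U.
Variable f : ('rV[R]_n -> R[i]) -> R[i].
Hypothesis U_initial : forall phi, schwartz phi ->
  cint (fun x => U x t * phi x) @[t --> 0^'+] --> f phi.
Implicit Types g h : 'rV[R]_n -> R[i].

Definition smooth_compact g := csreg compactly_bounded (fun _ : unit => g).

Lemma uhat_cwbounded t g : 0 < t -> smooth_compact g ->
  exists C, cwbounded C (fun x => U x t * fourier g x).
Proof.
move=> t0 rg; have [K [N KN]] := growth_on_interval U_growth t t0.
have [C wC] := growth_cwbounded K N (csreg_fourier (csreg_compact_rapid rg)).
exists C; apply: (wC tt) => [|x]; first exact: (U_continuous U_regular).
by apply: KN; rewrite !lexx.
Qed.

Lemma uhatD t g h : 0 < t -> smooth_compact g -> smooth_compact h ->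
  uhat U t (fun x => g x + h x) = uhat U t g + uhat U t h.
Proof.
move=> t0 rg rh; have [C wC] := uhat_cwbounded t0 rg.
have [D wD] := uhat_cwbounded t0 rh.
have [C' wC'] := csreg_rapid_cwbounded (csreg_compact_rapid rg).
have [D' wD'] := csreg_rapid_cwbounded (csreg_compact_rapid rh).
rewrite /uhat -(cintD wC wD); congr cint; apply/funext => x.
by rewrite -mulrDr; congr (_ * _); exact: (fourierD x (wC' tt) (wD' tt)).
Qed.

Lemma uhatZ t (c : R[i]) g : 0 < t -> smooth_compact g ->
  uhat U t (fun x => c * g x) = c * uhat U t g.
Proof.
move=> t0 rg; have [C wC] := uhat_cwbounded t0 rg.
have [C' wC'] := csreg_rapid_cwbounded (csreg_compact_rapid rg).
rewrite /uhat -(cintZ c wC); congr cint; apply/funext => x.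
by rewrite mulrCA; congr (_ * _); exact: (fourierZ c x (wC' tt)).
Qed.

Lemma smooth_compactD g h : smooth_compact g -> smooth_compact h ->
  smooth_compact (fun x => g x + h x).
Proof. exact: (csregD (@compactly_boundedD _ _ _)). Qed.

Lemma smooth_compact_moderate g h : smooth_compact g ->
  csreg moderate (fun _ : unit => h) -> smooth_compact (fun x => g x * h x).
Proof. by move=> rg rh; exact: csreg_compactM rg (csreg_moderate_locally rh). Qed.

Lemma uhat_sum (I : Type) (r : seq I) (F : I -> 'rV[R]_n -> R[i]) t : 0 < t ->
  (forall i, smooth_compact (F i)) ->
  uhat U t (fun x => \sum_(i <- r) F i x) = \sum_(i <- r) uhat U t (F i).
Proof.
move=> t0 rF.
suff [] : smooth_compact (fun x => \sum_(i <- r) F i x) /\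
  uhat U t (fun x => \sum_(i <- r) F i x) = \sum_(i <- r) uhat U t (F i) by [].
elim: r => [|i r [IHr IH]].
  have -> : (fun x => \sum_(i <- [::]) F i x) = fun=> 0.
    by apply/funext => x; rewrite big_nil.
  have r0 : smooth_compact (fun=> 0).
    by split=> k; apply: reg_cst; (split; [exists 0 => _ x; rewrite normr0|exists 0]).
  split=> //; rewrite big_nil -[RHS](mul0r (uhat U t (fun=> 0))) -(uhatZ 0 t0 r0).
  by congr uhat; apply/funext => x; rewrite mul0r.
have -> : (fun x => \sum_(i <- i :: r) F i x) = fun x => F i x + \sum_(i <- r) F i x.
  by apply/funext => x; rewrite big_cons.
split; first exact: smooth_compactD.
by rewrite big_cons uhatD// IH.
Qed.

(** Open sets on which f^ vanishes; they cover the complement of its support. *)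
Definition annihilating (O : set 'rV[R]_n) : Prop :=
  open O /\ forall phi, test_function O phi -> f (fourier phi) = 0.

Lemma smooth_compact_test g (A O : set 'rV[R]_n) : smooth_compact g -> closed A ->
  A `<=` O -> (forall x, ~ A x -> g x = 0) -> test_function O g.
Proof.
move=> rg cA AO gA.
have sub : closure [set x | g x != 0] `<=` A.
  rewrite [X in _ `<=` X](closure_id A).1//; apply: closure_subset => x /= gx.
  by apply: contrapT => /gA gx0; move: gx; rewrite gx0 eqxx.
split; last exact: subset_trans AO.
  exact: (csreg_smooth tt rg).
have [[_ [a aP]] [_ [b bP]]] := (sreg_bound rg.1, sreg_bound rg.2).
apply: (subclosed_compact (@closed_closure _ _) (@closed_ball_compact R n (Num.max a b))).
have cB : closed [set x : 'rV[R]_n | `|x| <= Num.max a b].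
  by apply: compact_closed (@closed_ball_compact R n _); exact: norm_hausdorff.
rewrite [X in _ `<=` X](closure_id _).1//; apply: closure_subset => x /= gx.
rewrite leNgt; apply: contraNN gx; rewrite gt_max => /andP[/(aP tt) gR /(bP tt) gI].
by apply/eqP; exact: eq_complexP.
Qed.

(** [uhat_eq0] is applied to g exp(tP), which vanishes wherever g does; the evolution identity turns
    the resulting pairing at time 1 into the one of g at time t. *)
Lemma uhat_annihilating t g (A O : set 'rV[R]_n) : 0 < t -> smooth_compact g ->
  annihilating O -> closed A -> A `<=` O -> (forall x, ~ A x -> g x = 0) ->
  uhat U t g = 0.
Proof.
move=> t0 rg [_ hO] cA AO gA.
have re := @csreg_evolved _ _ P _ rg unit (fun=> t) `|t| (fun=> lexx _).
have te : test_function O (fun u => g u * pexp P t u).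
  by apply: smooth_compact_test re cA AO _ => x /gA ->; rewrite mul0r.
have := uhat_eq0 P_deg U_regular U_pde U_growth U_initial re (hO _ te).
rewrite (uhat_evolution P_deg U_regular U_pde U_growth rg ltr01 t0) => <-.
by congr uhat; apply/funext => u; rewrite -mulrA -pexpD.
Qed.

(* A partition of unity of [- M * e, M * e] into pieces of width 2e. *)
Definition bump (e : R) (M : nat) (k : nat) (v : R) : R :=
  step (v / e + M%:R + 1 - k%:R) - step (v / e + M%:R - k%:R).

(** The sum telescopes to step(v/e + M + 1) - step(v/e - M), which is 1 - 0 in this range. *)
Lemma sum_bump e M v : 0 < e -> `|v| <= M%:R * e ->
  \sum_(k < (2 * M).+1) bump e M k v = 1.
Proof.
move=> e0; rewrite ler_norml => /andP[v1 v2].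
have {}v1 : 0 <= v / e + M%:R by rewrite -lerBlDr sub0r ler_pdivlMr// mulNr.
have {}v2 : v / e <= M%:R by rewrite ler_pdivrMr.
pose h k := - step (v / e + M%:R + 1 - k%:R).
rewrite -(big_mkord predT (fun k => bump e M k v)).
rewrite (eq_bigr (fun k => h k.+1 - h k)) => [|k _]; last first.
  rewrite /bump /h opprK addrC; congr (- step _ + _).
  by rewrite -natr1; ring.
rewrite telescope_sumr// /h step_le0 ?step_ge1 ?oppr0 ?opprK ?add0r//; last first.
  by rewrite ?mulr0n -?natr1 ?natrM; lra.
by rewrite ?mulr0n -?natr1 ?natrM; lra.
Qed.

Lemma bump_far e M k v : 1 < `|v / e + M%:R - k%:R| -> bump e M k v = 0.
Proof.
rewrite /bump; set w := v / e + M%:R - k%:R.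
have -> : v / e + M%:R + 1 - k%:R = w + 1 by rewrite /w; ring.
have [w0|w0] := leP 0 w.
  by rewrite ger0_norm// => w1; rewrite !step_ge1 ?subrr; lra.
by rewrite ltr0_norm// => w1; rewrite !step_le0 ?subrr; lra.
Qed.

Lemma csreg_bump_prod e M (k : 'I_n -> nat) :
  csreg moderate (fun (_ : unit) (x : 'rV[R]_n) => (\prod_i bump e M (k i) (x 0 i))%:C).
Proof.
apply: csreg_moderate_real; apply: sreg_moderate_prod => i.
have aff (c : R) : sreg (@base R n) moderate (fun (_ : unit) (x : 'rV[R]_n) => x 0 i / e + c).
  apply: sreg_moderateD; last exact: (@sreg_moderate_cst _ _ _ (fun=> c) `|c|).
  apply: sreg_moderateM; first exact: sreg_moderate_coord.
  exact: (@sreg_moderate_cst _ _ _ (fun=> e^-1) `|e^-1|).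
rewrite /bump; apply: sreg_moderateD.
  apply: sreg_step_comp; have := aff (M%:R + 1 - (k i)%:R).
  by under eq_fun do under eq_fun do rewrite !addrA.
apply: sreg_moderateN; apply: sreg_step_comp; have := aff (M%:R - (k i)%:R).
by under eq_fun do under eq_fun do rewrite !addrA.
Qed.

(** A partition of unity into small cubes reduces to [uhat_annihilating]: by compactness, a cube
    meeting the set where g may be nonzero has its relevant part inside a single annihilating
    set. *)
Lemma uhat_support t g (A : set 'rV[R]_n) : 0 < t -> smooth_compact g -> closed A ->
  (forall x, A x -> exists O, annihilating O /\ O x) ->
  (forall x, ~ A x -> g x = 0) -> uhat U t g = 0.
Proof.
move=> t0 rg cA AO gA.
have [r [r0 gr]] : exists r : R, 0 <= r /\ forall x : 'rV[R]_n, r < `|x| -> g x = 0.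
  have [[_ [a aP]] [_ [b bP]]] := (sreg_bound rg.1, sreg_bound rg.2).
  exists (Num.max 0 (Num.max a b)); split; first by rewrite le_max lexx.
  move=> x; rewrite !gt_max => /and3P[_ /(aP tt) gR /(bP tt) gI].
  exact: eq_complexP.
pose K := [set x : 'rV[R]_n | `|x| <= r] `&` A.
have cK : compact K by exact: compact_closedI (@closed_ball_compact R n r) cA.
pose Q (e : R) (x : 'rV[R]_n) := exists O, annihilating O /\ forall y, `|y - x| <= e -> O y.
(* A Lebesgue number for the cover of [K]. The factor 2 is needed because two points of one cube may
   be 2e apart in the sup norm. *)
have [e [e0 KQ]] : exists e : R, 0 < e /\ K `<=` Q (2 * e).
  have H x : K x -> filter_prod (nbhs x) ((0 : R)^'+) (fun p => Q p.2 p.1).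
    move=> [_ Ax]; have [W [hO Ox]] := AO x Ax.
    have /nbhs_ballP[e /= e0 eO] : nbhs x W by exact: open_nbhs_nbhs (conj hO.1 Ox).
    have e2 : 0 < e / 2 by rewrite divr_gt0.
    exists ([set x' | `|x - x'| < e / 2], [set e' | e' < e / 2]).
      by split=> /=; [exact: (near_dist x e2)|exact: nbhs_right_lt].
    move=> [x' e'] [/= xx' e'e]; exists W; split=> // y yx'; apply: eO.
    rewrite mx_norm_ball /ball_ /=; have -> : x - y = (x - x') - (y - x').
      by rewrite opprB addrA subrK.
    by apply: le_lt_trans (ler_normB _ _) _; lra.
  have H' := (compact_near_coveringP K).1 cK R ((0 : R)^'+) Q _ H.
  near ((0 : R)^'+) => e; exists (e / 2).
  have e0 : 0 < e by near: e; exact: nbhs_right_gt.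
  split; first by rewrite divr_gt0.
  rewrite mulrC divfK//; near: e; exact: H'.
pose M := Num.bound (r / e).
have rM : r <= M%:R * e.
  by rewrite -ler_pdivrMr// ltW// archi_boundP// divr_ge0// ltW.
pose B (k : {ffun 'I_n -> 'I_(2 * M).+1}) (x : 'rV[R]_n) : R[i] :=
  (\prod_i bump e M (k i) (x 0 i))%:C.
have -> : g = fun x => \sum_k g x * B k x.
  apply/funext => x; have [/gr ->|xr] := ltP r `|x|.
    by rewrite big1// => k _; rewrite mul0r.
  rewrite -mulr_sumr /B -rmorph_sum -(bigA_distr_bigA (fun i (k : 'I_(2 * M).+1) => bump e M k (x 0 i))).
  rewrite big1 ?mulr1// => i _; apply: sum_bump => //.
  exact: le_trans (coord_le_norm x i) (le_trans xr rM).
have rB k : smooth_compact (fun x => g x * B k x).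
  exact: smooth_compact_moderate rg (csreg_bump_prod e M (fun i => k i)).
rewrite (uhat_sum _ t0 rB) big1// => k _.
pose Ak := K `&` [set x : 'rV[R]_n | forall i, `|x 0 i / e + M%:R - (k i)%:R| <= 1].
have gAk x : ~ Ak x -> g x * B k x = 0.
  move=> nAk; have [/gr ->|xr] := ltP r `|x|; first by rewrite mul0r.
  have [Ax|/gA ->] := pselect (A x); last by rewrite mul0r.
  have [i iP] : exists i, ~ (`|x 0 i / e + M%:R - (k i)%:R| <= 1).
    by apply/existsNP => H; apply: nAk.
  rewrite /B (bigD1 i)//= bump_far ?mul0r ?mulr0//.
  by rewrite ltNge; apply/negP.
have [[x0 [Kx0 x0k]]|noAk] := pselect (Ak !=set0); last first.
  have -> : (fun x => g x * B k x) = fun x => 0 * g x.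
    by apply/funext => x; rewrite gAk ?mul0r// => Akx; apply: noAk; exists x.
  by rewrite uhatZ// mul0r.
have [W [hO OP]] := KQ x0 Kx0.
have cAk : closed Ak.
  apply: closedI; first by apply: compact_closed cK; exact: norm_hausdorff.
  have -> : [set x : 'rV[R]_n | forall i, `|x 0 i / e + M%:R - (k i)%:R| <= 1] =
     \bigcap_i [set x : 'rV[R]_n | `|x 0 i / e + M%:R - (k i)%:R| <= 1].
    by apply/seteqP; split=> x /= H; [move=> i _; exact: H|move=> i; exact: H].
  apply: closed_bigI => i _.
  have ci : continuous (fun x : 'rV[R]_n => `|x 0 i / e + M%:R - (k i)%:R|).
    apply: (@lipschitz_continuous _ _ _ `|e^-1|) => x y.
    apply: le_trans (ler_dist_dist _ _) _.
    have -> : x 0 i / e + M%:R - (k i)%:R - (y 0 i / e + M%:R - (k i)%:R) =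
        e^-1 * (x - y) 0 i by rewrite !mxE; ring.
    by rewrite normrM ler_wpM2l// coord_le_norm.
  have HH := (@preimage_closed _ _ (fun x : 'rV[R]_n => `|x 0 i / e + M%:R - (k i)%:R|)
    [set t | t <= 1] (fun x _ => ci x)).
  by apply: HH; exact: closed_le.
apply: (uhat_annihilating t0 (rB k) hO cAk _ gAk) => y [Ky yk]; apply: OP.
apply: norm_le_coord => [|i]; first by rewrite mulr_ge0// ltW.
rewrite !mxE; have := x0k i; have := yk i.
rewrite !ler_norml => /andP[y1 y2] /andP[x1 x2].
have E : y 0 i - x0 0 i = (y 0 i / e - x0 0 i / e) * e.
  by rewrite -mulrBl divfK// gt_eqF.
rewrite E -mulNr ler_pM2r// ler_pM2r//; apply/andP; split; lra.
Unshelve. all: by end_near. Qed.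

End SpectralSupport.

(** * A band-limited approximate identity *)

Section Gaussian.
Context {R : realType} {n : nat}.
Local Notation Re := complex.Re.
Local Notation sreg := (sreg (@base R n)).

(** Since exp is its own derivative, the outer class can be reduced to the multiples of exp, and
    only their values along [q] have to be controlled. *)
Lemma sreg_expR_class {J : Type} (B : (J -> 'rV[R]_n -> R) -> Prop)
    (q : J -> 'rV[R]_n -> R) :
  (forall c, B (fun j x => c * expR (q j x))) ->
  (forall F G, B F -> moderate G -> B (fun j x => F j x * G j x)) ->
  (forall F G, B F -> B G -> B (fun j x => F j x + G j x)) ->
  sreg moderate q -> sreg B (fun j x => expR (q j x)).
Proof.
move=> Bc BM BD rq.
apply: (@sreg_comp _ _ J (fun h => exists c : R, h = fun _ x => c * expR x) B (fun=> expR)) => //.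
  by move=> h [c ->]; exact: Bc.
have b : exists c : R, (fun _ : J => expR) = fun _ x => c * expR x.
  by exists 1; apply/funext => j; apply/funext => x; rewrite mul1r.
elim=> [|k IH]; first by split=> // _; exact: continuous_expR.
apply: regS_intro => // [_|i]; first exact: continuous_expR.
by exists (fun=> expR); split => // _ x; exact: is_derive_expR.
Qed.

Lemma dot_ge0 (x : 'rV[R]_n) : 0 <= dot x x.
Proof. by apply: le_trans (norm_sqr_le_dot x); rewrite sqr_ge0. Qed.

Lemma norm1_le_expR N : {C : R | 0 < C &
  forall x : 'rV[R]_n, (1 + `|x|) ^+ N <= C * expR (dot x x / 2)}.
Proof.
have [C C0 CP] := @exprn_le_expR R N.
exists (4 ^+ N * (C * expR 2^-1)) => [|x]; first by rewrite !mulr_gt0// ?exprn_gt0// expR_gt0.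
apply: (@le_trans _ _ (4 ^+ N * (2^-1 + dot x x / 2) ^+ N)).
  rewrite -exprMn lerXn2r ?nnegrE ?addr_ge0 ?mulr_ge0 ?addr_ge0 ?divr_ge0 ?dot_ge0//.
  have := norm_sqr_le_dot x; have := normr_ge0 x; have := sqr_ge0 (`|x| - 1).
  rewrite sqrrB1 !expr2; nra.
rewrite -[leRHS]mulrA ler_wpM2l ?exprn_ge0// -mulrA -expRD.
by apply: CP; rewrite addr_ge0 ?divr_ge0 ?dot_ge0.
Qed.

Lemma iint_sum (I : eqType) (r : seq I) (h : I -> 'rV[R]_n -> R) :
  (forall i, i \in r -> exists C, wbounded C (h i)) ->
  (exists C, wbounded C (fun x => \sum_(i <- r) h i x)) /\
  iint (fun x => \sum_(i <- r) h i x) = \sum_(i <- r) iint (h i).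
Proof.
move=> hw; have [|[C [wC _]] E] := @cint_sum R n I r (fun i x => (h i x)%:C).
  move=> i /hw[C wC]; exists C; split => //=; split=> [|x].
    exact: cst_continuous.
  by rewrite normr0 mulr_ge0 ?weight_ge0// (wbounded_ge0 wC).
have RE : (fun x => Re (\sum_(i <- r) (h i x)%:C)) = fun x => \sum_(i <- r) h i x.
  by apply/funext => x; rewrite -rmorph_sum.
split; first by exists C; rewrite -RE.
rewrite -RE -Re_cint E; elim: {hw wC E RE} r => [|i r IH]; first by rewrite !big_nil.
by rewrite !big_cons ReD IH.
Qed.

Definition gauss (x : 'rV[R]_n) : R := expR (- (dot x x / 2)).

Lemma sreg_quadratic {J : Type} (e : J -> R) C : (forall j, `|e j| <= C) ->
  sreg moderate (fun j x => e j * dot x x).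
Proof.
move=> eC; apply: sreg_moderateM sreg_dotxx; exact: sreg_moderate_cst eC.
Qed.

Lemma sreg_gauss {J : Type} : sreg rapid (fun _ : J => gauss).
Proof.
have -> : gauss = fun x => expR (- 2^-1 * dot x x).
  by apply/funext => x; rewrite /gauss mulNr mulrC.
apply: (@sreg_expR_class J rapid) => //.
- move=> c N; have [C C0 CP] := norm1_le_expR N; exists (`|c| * C) => _ x.
  rewrite normrM -mulrA ler_wpM2l// ger0_norm ?expR_ge0// mulNr expRN mulrC.
  by rewrite ler_pdivrMr ?expR_gt0// [_^-1 * _]mulrC; exact: CP.
- exact: rapid_moderate.
- exact: rapidD.
- exact: (@sreg_quadratic J (fun=> - 2^-1) `|- 2^-1|).
Qed.

(* The Gaussian satisfies grad g = - x g, so its cosine transform A satisfies  *)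
(* d/dt A(t z) = - t |z|^2 A(t z), and is positive.                            *)
Lemma trig_gauss_gt0 (z : 'rV[R]_n) : 0 < trig 0 (fun _ : unit => gauss) tt z.
Proof.
have rg := @sreg_gauss unit.
pose A t := trig 0 (fun _ : unit => gauss) tt (t *: z).
have [C wC] := sreg_rapid_wbounded rg.
have grad i : (fun (_ : unit) x => 'D_(base i) gauss x) = fun _ x => - (gauss x * x 0 i).
  apply/funext => _; apply/funext => x.
  have dd := sreg_is_derive i tt x (@sreg_dotxx R n unit).
  have Dd : 'D_(base i) (fun x : 'rV[R]_n => dot x x) x = 2 * x 0 i.
    have H k : is_derive x (base i) (fun x : 'rV[R]_n => x 0 k * x 0 k) ((k == i)%:R * (2 * x 0 k)).
      have dk := is_derive_coord k i x.
      refine (is_derive_eq (is_deriveM dk dk) _); rewrite /GRing.scale /=; ring.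
    have -> : (fun x : 'rV[R]_n => dot x x) = \sum_(k < n) (fun x : 'rV[R]_n => x 0 k * x 0 k).
      by apply/funext => y; rewrite fct_sumE.
    have [_ ->] := is_derive_sum H.
    rewrite (bigD1 i)//= eqxx mul1r big1 ?addr0// => k /negbTE ->.
    by rewrite mul0r.
  have dq := is_deriveN (is_deriveZ 2^-1 dd).
  have dg := is_derive_comp_line dq (is_derive_expR _).
  have -> : gauss = fun y => expR ((- (2^-1 \*: (fun x : 'rV[R]_n => dot x x))) y).
    by apply/funext => y; rewrite /gauss mulrC.
  have [_ ->] := dg; rewrite Dd /GRing.scale /= mulrA mulVf ?pnatr_eq0// mul1r.
  by rewrite mulrN.
have dA t : is_derive t (1 : R) A (- (t * dot z z) * A t).
  have [D wD] := sreg_rapid_wbounded (sreg_rapidM rg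
    (@sreg_moderate_dot R n unit (fun=> z) `|z| (fun=> lexx _))).
  have := @iint_is_derive R n (fun t x => gauss x * cos (dot (t *: z) x + 0))
    (fun t x => gauss x * dot z x * cos (dot (t *: z) x + (0 + pi / 2))) t 1 C D ltr01.
  have -> : iint (fun x => gauss x * dot z x * cos (dot (t *: z) x + (0 + pi / 2))) =
      - (t * dot z z) * A t.
    have rgi i := sreg_rapid_coord i rg.
    have part (k : 'I_n) : trig (0 + pi / 2) (fun (_ : unit) y => gauss y * y 0 k) tt (t *: z) =
        t * z 0 k * - A t.
      have := @trig_by_parts R n unit (0 + pi / 2) (fun=> gauss) k tt (t *: z) rg.
      have -> : trig (0 + pi / 2) (fun (_ : unit) y => 'D_(base k) gauss y) tt (t *: z) =
          - trig (0 + pi / 2) (fun (_ : unit) y => gauss y * y 0 k) tt (t *: z).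
        rewrite grad; have [K wK] := sreg_rapid_wbounded (rgi k).
        rewrite -mulN1r -(iintZ _ (trig_wbounded (t *: z) (0 + pi / 2) (wK tt))).
        by congr iint; apply/funext => y; rewrite mulN1r mulNr.
      rewrite opprK => <-; rewrite mxE; congr (_ * _).
      rewrite -mulN1r -(iintZ _ (trig_wbounded (t *: z) 0 (wC tt))).
      congr iint; apply/funext => y; rewrite add0r addrA cosDpihalf sinDpihalf addr0.
      by rewrite mulN1r mulrN.
    have -> : (fun x => gauss x * dot z x * cos (dot (t *: z) x + (0 + pi / 2))) =
       fun x => \sum_i z 0 i * (gauss x * x 0 i * cos (dot (t *: z) x + (0 + pi / 2))).
      apply/funext => y; rewrite /dot mulr_sumr mulr_suml; apply: eq_bigr => i _; ring.
    rewrite (iint_sum _).2 => [|i _]; last first.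
      have [K wK] := sreg_rapid_wbounded (rgi i).
      by eexists; exact: wboundedZ (trig_wbounded (t *: z) (0 + pi / 2) (wK tt)).
    transitivity (\sum_i z 0 i * (t * z 0 i * - A t)).
      apply: eq_bigr => i _; rewrite -part.
      have [K wK] := sreg_rapid_wbounded (rgi i).
      exact: iintZ (trig_wbounded (t *: z) (0 + pi / 2) (wK tt)).
    by rewrite /dot mulr_sumr mulNr mulr_suml -sumrN; apply: eq_bigr => i _; ring.
  apply.
  - move=> s y _; have := is_derive_cos_phase 0 (dot z y) s.
    move=> /(is_deriveZ (gauss y)) H.
    have -> : (fun s : R => gauss y * cos (dot (s *: z) y + 0)) =
        gauss y \*: (fun s : R => cos (0 + s * dot z y)).
      by apply/funext => r; rewrite dotZl addrC.
    refine (is_derive_eq H _); rewrite /GRing.scale /= dotZl !add0r; ring.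
  - by move=> s _; exact: (trig_wbounded _ _ (wC tt)).
  - by move=> s y _; exact: (trig_wbounded _ _ (wD tt)).2.
  - exact: (trig_wbounded _ _ (wD tt)).1.
have A0 : 0 < A 0.
  rewrite /A scale0r /trig.
  have -> : (fun x : 'rV[R]_n => gauss x * cos (dot 0 x + 0)) = gauss.
    by apply/funext => x; rewrite addr0 /dot big1 ?cos0 ?mulr1// => i _; rewrite mxE mul0r.
  by apply: (iint_gt0 (wC tt)) => x; exact: expR_gt0.
(* The integrating factor of the equation for [A]: [E] is constant, so A(1) has the sign of A(0). *)
pose E t := A t * expR (t ^+ 2 * (dot z z / 2)).
have dE t : is_derive t (1 : R) E 0.
  have dq : is_derive t (1 : R) (fun s : R => s ^+ 2 * (dot z z / 2)) (t * dot z z).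
    have H := is_deriveZ (dot z z / 2)
      (is_deriveM (is_derive_id t (1 : R)) (is_derive_id t (1 : R))).
    have -> : (fun s : R => s ^+ 2 * (dot z z / 2)) = dot z z / 2 \*: (id * id).
      by apply/funext => s; rewrite mulrC expr2.
    by refine (is_derive_eq H _); rewrite /GRing.scale /=; lra.
  refine (is_derive_eq (is_deriveM (dA t) (is_derive_comp_line dq (is_derive_expR _))) _).
  rewrite /GRing.scale /=; ring.
have E10 : E 1 = E 0.
  have H : `|E 1 - E 0| <= 0 * `|1 - 0|.
    by apply: (mean_value_le (f := E) (f' := fun=> 0)) => t _; rewrite normr0.
  by apply/eqP; rewrite -subr_eq0 -normr_le0; rewrite mul0r in H.
have : 0 < E 1 by rewrite E10 /E expr0n mul0r expR0 mulr1.
by rewrite /E pmulr_lgt0 ?expR_gt0// /A scale1r.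
Qed.

(* The Fourier transform of [bandlimit], once rescaled, is an approximate      *)
(* identity with compactly supported spectrum.                                 *)
Definition bandlimit (u : 'rV[R]_n) : R := gauss u * step (2 - dot u u).

Lemma sreg_step_quadratic {J : Type} (a : R) (e : J -> R) C : (forall j, `|e j| <= C) ->
  sreg moderate (fun j x => step (a - e j * dot x x)).
Proof.
move=> eC; apply: sreg_step_comp; apply: sreg_moderateD.
  exact: (@sreg_moderate_cst _ _ _ (fun=> a) `|a|).
exact/sreg_moderateN/(sreg_quadratic eC).
Qed.

Lemma sreg_bandlimit : sreg rapid (fun _ : unit => bandlimit).
Proof.
apply: sreg_rapidM sreg_gauss _.
have := @sreg_step_quadratic unit 2 (fun=> 1) 1 (fun=> _).
by under eq_fun do under eq_fun do rewrite mul1r; apply => _; rewrite normr1.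
Qed.

(* gauss - bandlimit vanishes near the origin, hence is sum x_i psi_i with     *)
(* rapid psi_i; each term has a cosine transform with zero integral.           *)
Lemma iint_trig_bandlimit_gt0 :
  0 < iint (fun z => trig 0 (fun _ : unit => bandlimit) tt z).
Proof.
have rg := @sreg_gauss unit; have rb := sreg_bandlimit.
(* A smooth substitute for |u|^2, bounded below: it equals |u|^2 for |u|^2 >= 1/2, in particular
   wherever [1 - step (2 - dot u u)] is nonzero, so dividing by it is harmless. *)
pose D (u : 'rV[R]_n) := dot u u + step (2 - 4 * dot u u).
have D_ge u : 4^-1 <= D u.
  rewrite /D; have [u4|u4] := leP (4^-1) (dot u u).
    by have := step_ge0 (2 - 4 * dot u u); lra.
  by rewrite step_ge1; have := dot_ge0 u; lra.
have D_gt0 u : 0 < D u by apply: lt_le_trans (D_ge u); rewrite invr_gt0.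
have rD : sreg moderate (fun (_ : unit) u => D u).
  apply: sreg_moderateD; first exact: sreg_dotxx.
  exact: (@sreg_step_quadratic unit 2 (fun=> 4) `|4|).
have rDV : sreg moderate (fun (_ : unit) u => (D u)^-1).
  move=> k; apply: (reg_inv (@moderateM _ _ _) (@moderateD _ _ _) (@moderateN _ _ _)) => //.
    apply: bounded_moderate; exists 4 => _ u.
    rewrite normfV ger0_norm ?(ltW (D_gt0 u))// -[leRHS]invrK lef_pV2 ?posrE//.
  by move=> _ u; rewrite gt_eqF.
have rs : sreg moderate (fun (_ : unit) u => 1 - step (2 - dot u u)).
  apply: sreg_moderateD; first exact: (@sreg_moderate_cst _ _ _ (fun=> 1) `|1|).
  apply: sreg_moderateN; have := @sreg_step_quadratic unit 2 (fun=> 1) 1 (fun=> _).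
  by under eq_fun do under eq_fun do rewrite mul1r; apply => _; rewrite normr1.
pose psi i (u : 'rV[R]_n) := gauss u * (1 - step (2 - dot u u)) * (D u)^-1 * u 0 i.
have rpsi i : sreg rapid (fun _ : unit => psi i).
  apply: sreg_rapid_coord; apply: sreg_rapidM rDV; exact: sreg_rapidM rg rs.
have decomp u : gauss u = bandlimit u + \sum_i psi i u * u 0 i.
  have -> : \sum_i psi i u * u 0 i = gauss u * (1 - step (2 - dot u u)) * ((D u)^-1 * dot u u).
    by rewrite /dot !mulr_sumr; apply: eq_bigr => i _; rewrite /psi; ring.
  have [u1|u1] := leP (dot u u) 1; first by rewrite /bandlimit step_ge1; [ring|lra].
  have -> : D u = dot u u by rewrite /D step_le0 ?addr0//; lra.
  by rewrite mulVf ?gt_eqF ?(lt_trans ltr01)// /bandlimit; ring.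
have zero i : iint (fun z => trig 0 (fun (_ : unit) u => psi i u * u 0 i) tt z) = 0.
  have rt := trig_sreg (- (pi / 2)) (rpsi i).
  have rt' := trig_sreg 0 (sreg_rapid_coord i (rpsi i)).
  have [C wC] := sreg_rapid_wbounded rt; have [C' wC'] := sreg_rapid_wbounded rt'.
  apply: (iint_partial (i := i) (wC tt) (wC' tt)) => z.
  by have := trig_is_derive (- (pi / 2)) i tt z (rpsi i); rewrite addNr.
have [Cb wb] := sreg_rapid_wbounded rb.
have split_trig z : trig 0 (fun _ : unit => gauss) tt z =
    trig 0 (fun _ : unit => bandlimit) tt z +
    \sum_i trig 0 (fun (_ : unit) u => psi i u * u 0 i) tt z.
  have wi i : exists C, wbounded C (fun u : 'rV[R]_n => psi i u * u 0 i * cos (dot z u + 0)).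
    have [K wK] := sreg_rapid_wbounded (sreg_rapid_coord i (rpsi i)).
    by exists K; exact: trig_wbounded (wK tt).
  have [[K wK] E] := iint_sum (fun i (_ : i \in index_enum 'I_n) => wi i).
  rewrite -E -(iintD (trig_wbounded z 0 (wb tt)) wK); congr iint; apply/funext => u.
  by rewrite -mulr_suml -mulrDl -decomp.
have [C1 w1] := sreg_rapid_wbounded (trig_sreg 0 rb).
have wt i : exists C, wbounded C (fun z => trig 0 (fun (_ : unit) u => psi i u * u 0 i) tt z).
  have [K wK] := sreg_rapid_wbounded (trig_sreg 0 (sreg_rapid_coord i (rpsi i))).
  by exists K; exact: wK tt.
have [[K wK] E] := iint_sum (fun i (_ : i \in index_enum 'I_n) => wt i).
have <- : iint (fun z => trig 0 (fun _ : unit => gauss) tt z) =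
    iint (fun z => trig 0 (fun _ : unit => bandlimit) tt z).
  rewrite (funext split_trig) (iintD (w1 tt) wK) E big1 ?addr0// => i _; exact: zero.
have [C2 w2] := sreg_rapid_wbounded (trig_sreg 0 rg).
by apply: (iint_gt0 (w2 tt)) => z; exact: trig_gauss_gt0.
Qed.

(** As [bandlimit] is real, the real part of its Fourier transform is the cosine transform, whose
    integral is positive. This mass is the factor by which point values are divided in
    [spreading]. *)
Lemma bandlimit_mass_neq0 : cint (fourier (fun u => (bandlimit u)%:C)) != 0.
Proof.
have [C wC] := sreg_rapid_wbounded sreg_bandlimit.
have wc : cwbounded C (fun u => (bandlimit u)%:C).
  split=> //=; first exact: wC tt.
  split=> [|x]; first exact: cst_continuous.
  by rewrite normr0 mulr_ge0 ?weight_ge0// (wbounded_ge0 (wC tt)).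
apply: contraNneq (lt0r_neq0 iint_trig_bandlimit_gt0) => /(congr1 (@complex.Re R)) E.
apply/eqP; rewrite -[RHS]E Re_cint; congr iint; apply/funext => z.
have -> := @fourierE R n unit C (fun _ u => (bandlimit u)%:C) tt z wc.
rewrite /=.
suff -> : trig (- (pi / 2)) (fun (_ : unit) (_ : 'rV[R]_n) => 0) tt z = 0 by rewrite addr0.
rewrite /trig; have -> : (fun x : 'rV[R]_n => 0 * cos (dot z x - pi / 2)) = fun x => 0 * bandlimit x.
  by apply/funext => x; rewrite !mul0r.
by rewrite (iintZ 0 (wC tt)) mul0r.
Qed.

End Gaussian.

(** * Dilated waves and the approximate identity *)

Section Waves.
Context {R : realType} {n : nat}.
Implicit Types (V m : 'rV[R]_n -> R[i]) (y : 'rV[R]_n).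

Lemma expiD (a b : R) : expi (a + b) = expi a * expi b.
Proof. by apply: eq_complexP; rewrite ?ReM ?ImM /= ?cosD ?sinD; ring. Qed.

(** A linear substitution: dilation by k in frequency becomes dilation by 1/k in space, and
    modulation by exp(i y.u) becomes translation by y. *)
Lemma fourier_wave C m k y x : 0 < k -> cwbounded C m ->
  (k ^+ n)%:C * fourier (fun u => m (k *: u) * expi (dot y u)) x =
  fourier m (k^-1 *: (x - y)).
Proof.
move=> k0 mC; rewrite [RHS]/fourier.
rewrite (cint_affine 0 k0 (fourier_cwbounded (k^-1 *: (x - y)) mC)); congr (_ * cint _).
apply/funext => u; rewrite addr0 -mulrA -expiD; congr (_ * expi _).
rewrite dotZl (dotC (x - y)) dotZl mulrA mulVf ?gt_eqF// mul1r.
rewrite [dot u _]dotC dotDl -[- y]scaleN1r dotZl; ring.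
Qed.

Lemma cint_fourier_wave C D D' V m k y : 0 < k -> cwbounded C m ->
  cwbounded D (fun x => V x * fourier (fun u => m (k *: u) * expi (dot y u)) x) ->
  cwbounded D' (fun w => V (k *: w + y) * fourier m w) ->
  cint (fun x => V x * fourier (fun u => m (k *: u) * expi (dot y u)) x) =
  cint (fun w => V (k *: w + y) * fourier m w).
Proof.
move=> k0 mC VD VD'; have kV0 : 0 < k^-1 by rewrite invr_gt0.
rewrite (cint_affine (- (k^-1 *: y)) kV0 VD').
have -> : (fun x => V (k *: (k^-1 *: x - k^-1 *: y) + y) * fourier m (k^-1 *: x - k^-1 *: y)) =
    fun x => (k ^+ n)%:C * (V x * fourier (fun u => m (k *: u) * expi (dot y u)) x).
  apply/funext => x; rewrite mulrCA (fourier_wave y x k0 mC) -scalerBr scalerA.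
  by rewrite mulfV ?gt_eqF// scale1r subrK.
rewrite (cintZ _ VD) mulrA -rmorphM /= -exprMn mulVf ?gt_eqF// expr1n.
by rewrite mul1r.
Qed.

Lemma growth_affine V (K : R) N (k : R) y : 0 <= k <= 1 -> (forall x, normc (V x) <= K * (1 + `|x|) ^+ N) ->
  forall w, normc (V (k *: w + y)) <= K * (1 + `|y|) ^+ N * (1 + `|w|) ^+ N.
Proof.
move=> /andP[k0 k1] VK w; apply: (le_trans (VK _)).
have K0 : 0 <= K.
  by have := le_trans (normc_ge0 _) (VK 0); rewrite pmulr_lge0// exprn_gt0// ltr_pwDl.
rewrite -mulrA ler_wpM2l// -exprMn lerXn2r ?nnegrE ?addr_ge0 ?mulr_ge0 ?addr_ge0//.
have := ler_normD (k *: w) y; rewrite normrZ (ger0_norm k0).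
by have := normr_ge0 w; have := normr_ge0 y; nra.
Qed.

Lemma affine_continuous V (k : R) y : continuous V -> continuous (fun w : 'rV[R]_n => V (k *: w + y)).
Proof.
move=> Vc w; apply: (@continuous_comp _ _ _ (fun w : 'rV[R]_n => k *: w + y)); last exact: Vc.
by apply: (@lipschitz_continuous R 'rV[R]_n 'rV[R]_n `|k|) => a b; rewrite opprD addrACA subrr addr0 -scalerBr normrZ.
Qed.

(** Dominated convergence: for 0 <= k <= 1 the growth of V(k w + y) is polynomial in w uniformly in
    k, and the rapid decay of [m] absorbs it. *)
Lemma approximate_identity V m (K : R) N y : continuous V ->
  (forall x, normc (V x) <= K * (1 + `|x|) ^+ N) -> csreg rapid (fun _ : unit => m) ->
  cint (fun w => V (k *: w + y) * m w) @[k --> (0 : R)^'+] --> V y * cint m.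
Proof.
move=> Vc VK rm.
have [C wC] := growth_cwbounded (K * (1 + `|y|) ^+ N) N rm.
have near_w : \forall k \near 0^'+, cwbounded C (fun w => V (k *: w + y) * m w).
  near=> k; apply: (wC tt (fun w => V (k *: w + y))); first exact: affine_continuous.
  by apply: growth_affine => //; apply/andP; split; near: k; [exact: nbhs_right_ge|exact: nbhs_right_le].
have [D mD] := csreg_rapid_cwbounded rm.
have mD' : cwbounded D m := mD tt.
rewrite -(cintZ _ mD').
have cb : countable_base ((0 : R)^'+).
  exact/countable_base_within/countable_base_nbhs.
have w0 : cwbounded C (fun w => V y * m w).
  apply: (wC tt (fun=> V y)); first exact: cst_continuous.
  move=> w; have := growth_affine (k := 0) y _ VK w; rewrite scale0r add0r; apply.
  by rewrite lexx ler01.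
refine (@cint_cvg R n R ((0 : R)^'+) _ C (fun k w => V (k *: w + y) * m w)
  (fun w => V y * m w) cb near_w w0 _) => w.
apply: cvg_complexM; last exact: cvg_cst.
have c1 : continuous (fun k : R => k *: w + y).
  by apply: (@lipschitz_continuous R R 'rV[R]_n `|w|) => a b; rewrite opprD addrACA subrr addr0 -scalerBl normrZ mulrC.
have -> : V y = (V \o (fun k : R => k *: w + y)) 0 by rewrite /= scale0r add0r.
have H := @continuous_comp _ _ _ (fun k : R => k *: w + y) V 0 (c1 0) (Vc _).
exact: cvg_trans (cvg_app _ (cvg_within _)) H.
Unshelve. all: by end_near. Qed.

End Waves.

(** * The spreading estimate *)

Section Kernel.
Context {R : realType} {n : nat} (d : nat).
Local Notation Re := complex.Re.
Local Notation Im := complex.Im.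
Local Notation sreg := (sreg (@base R n)).
Variables (P : mpoly n R[i]) (c : R).
Hypotheses (P_deg : forall m, m \in msupp P -> mdeg m = d) (d_gt0 : (0 < d)%N) (c_gt0 : 0 < c).

Lemma psymbol_homog (k : R) u : psymbol P (k *: u) = (k ^+ d)%:C * psymbol P u.
Proof.
rewrite /psymbol !mevalE mulr_sumr [LHS]big_seq [RHS]big_seq; apply: eq_bigr => m mP.
rewrite mulrCA; congr (_ * _).
have -> : (k ^+ d)%:C = \prod_(i < n) (k%:C ^+ m i) :> R[i].
  by rewrite -(P_deg mP) mdegE prodrXr rmorphXn.
rewrite -big_split; apply: eq_bigr => i _ /=; rewrite -exprMn; congr (_ ^+ _).
by apply: eq_complexP; rewrite ?ReM ?ImM /imag_vec /= ?mxE; ring.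
Qed.

Definition rsymbol (u : 'rV[R]_n) : R := Re (psymbol P u).

Lemma rsymbol_homog (k : R) u : rsymbol (k *: u) = k ^+ d * rsymbol u.
Proof. by rewrite /rsymbol psymbol_homog ReM /= mul0r subr0. Qed.

(* Nonpositive on the cone, where Re P(iu) <= - c |u|^d; conversely            *)
(* [excess u <= 2] and [rsymbol u <= 3] force [rsymbol u <= 8 - c |u|^d].      *)
Definition excess (u : 'rV[R]_n) : R := c ^+ 2 * dot u u ^+ d - rsymbol u ^+ 2.

Lemma excess_homog (k : R) u : excess (k *: u) = k ^+ (2 * d) * excess u.
Proof.
rewrite /excess.
have -> : dot (k *: u) (k *: u) = k ^+ 2 * dot u u by rewrite dotZl dotC dotZl; ring.
rewrite rsymbol_homog !exprMn -!exprM [(d * 2)%N]mulnC mulrBr mulrCA.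
by rewrite mulnC exprM expr2.
Qed.

(** Equal to 1 where k^d [rsymbol] <= 2 and k^(2d) [excess] <= 1, a neighbourhood of the cone, and 0
    where the first quantity reaches 3 or the second reaches 2. Both are polynomials in u, which
    makes the cut smooth; |u|^d itself would not be smooth for odd d. *)
Definition cone_cut (k : R) (u : 'rV[R]_n) : R :=
  step (3 - k ^+ d * rsymbol u) * step (2 - k ^+ (2 * d) * excess u).

Lemma cone_cut_scale k u : cone_cut 1 (k *: u) = cone_cut k u.
Proof. by rewrite /cone_cut rsymbol_homog excess_homog !expr1n !mul1r. Qed.

Lemma sreg_rsymbol {J : Type} : sreg moderate (fun _ : J => rsymbol).
Proof. exact: (csreg_psymbol P).1. Qed.

Lemma sreg_excess {J : Type} : sreg moderate (fun _ : J => excess).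
Proof.
apply: sreg_moderateD; last exact/sreg_moderateN/sreg_moderate_exp/sreg_rsymbol.
apply: sreg_moderateM; last exact/sreg_moderate_exp/sreg_dotxx.
exact: (@sreg_moderate_cst _ _ _ (fun=> _) `|c ^+ 2|).
Qed.

Lemma sreg_step_affine {J : Type} (a b : R) (F : J -> 'rV[R]_n -> R) :
  sreg moderate F -> sreg moderate (fun j x => step (a - b * F j x)).
Proof.
move=> rF; apply: sreg_step_comp; apply: sreg_moderateD.
  exact: (@sreg_moderate_cst _ _ _ (fun=> _) `|a|).
apply/sreg_moderateN/(sreg_moderateM _ rF).
exact: (@sreg_moderate_cst _ _ _ (fun=> _) `|b|).
Qed.

Lemma sreg_cone_cut {J : Type} k : sreg moderate (fun _ : J => cone_cut k).
Proof.
apply: sreg_moderateM; apply: sreg_step_affine; [exact: sreg_rsymbol|exact: sreg_excess].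
Qed.

Let admissible (u : 'rV[R]_n) := rsymbol u <= 3 /\ excess u <= 2.

(** With z = c |u|^d one has z^2 <= 2 + (rsymbol u)^2. If [rsymbol u] lies in [0, 3], then z is at
    most sqrt(11); if it is negative, z exceeds its modulus by at most sqrt(2). *)
Lemma admissible_bound u : admissible u -> rsymbol u <= 8 - c * `|u| ^+ d.
Proof.
move=> [q3]; rewrite /excess; set q := rsymbol u in q3 *; set z := c * `|u| ^+ d.
have z0 : 0 <= z by rewrite mulr_ge0 ?(ltW c_gt0)// exprn_ge0.
have : z ^+ 2 <= c ^+ 2 * dot u u ^+ d.
  rewrite /z exprMn ler_wpM2l ?sqr_ge0// -exprM mulnC exprM.
  by rewrite lerXn2r ?nnegrE ?sqr_ge0 ?dot_ge0// norm_sqr_le_dot.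
move: z0 q3; move: z q (c ^+ 2 * _) => z q w z0 q3 zw w2.
have {zw w2} : z ^+ 2 <= 2 + q ^+ 2 by lra.
rewrite !expr2; nra.
Qed.

Lemma norm1_le_expR_pow (N : nat) : exists C : R, forall u : 'rV[R]_n,
  (1 + `|u|) ^+ N <= C * expR (c * `|u| ^+ d / 2).
Proof.
have [C C0 CP] := @exprn_le_expR R N.
exists ((2 + 2 / c) ^+ N * (C * expR 1)) => u; set z := c * `|u| ^+ d / 2.
have z0 : 0 <= z by rewrite !mulr_ge0 ?(ltW c_gt0) ?exprn_ge0 ?invr_ge0.
have c2 : 0 <= 2 + 2 / c by rewrite addr_ge0// divr_ge0// ltW.
have uz : 1 + `|u| <= (2 + 2 / c) * (1 + z).
  have e : 2 / c * z = `|u| ^+ d by rewrite /z; field; rewrite gt_eqF.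
  have ue : `|u| <= 1 + `|u| ^+ d.
    have [u1|u1] := leP `|u| 1; first by rewrite (le_trans u1)// lerDl exprn_ge0.
    by rewrite (le_trans (ler_eXnr d_gt0 (ltW u1)))// lerDr.
  have : 0 <= 2 / c by rewrite divr_ge0 ?(ltW c_gt0).
  have -> : (2 + 2 / c) * (1 + z) = 2 + 2 * z + 2 / c + `|u| ^+ d by rewrite -e; ring.
  lra.
apply: (@le_trans _ _ (((2 + 2 / c) * (1 + z)) ^+ N)).
  by rewrite lerXn2r ?nnegrE// ?addr_ge0// mulr_ge0// addr_ge0.
rewrite exprMn -!mulrA ler_wpM2l ?exprn_ge0//.
by rewrite -expRD CP// addr_ge0.
Qed.

(** The exponential is known to decrease rapidly on the admissible set only (class [B1]). On the
    open complement [W] the cut vanishes with all its derivatives, so the product decreases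
    everywhere. *)
Lemma sreg_damped {J : Type} : sreg rapid (fun (_ : J) u => expR (rsymbol u / 2) * cone_cut 1 u).
Proof.
pose B1 (F : J -> 'rV[R]_n -> R) := forall N, exists C, forall j u, admissible u ->
  `|F j u| * (1 + `|u|) ^+ N <= C.
pose W (_ : J) : set 'rV[R]_n := [set u | 3 < rsymbol u] `|` [set u | 2 < excess u].
have oW j : open (W j).
  apply: openU.
    apply: (@open_comp _ _ rsymbol [set t | 3 < t]) => [x _|]; last exact: open_gt.
    exact: (sreg_continuous (@sreg_rsymbol unit) tt).
  apply: (@open_comp _ _ excess [set t | 2 < t]) => [x _|]; last exact: open_gt.
  exact: (sreg_continuous (@sreg_excess unit) tt).
have cut0 (j : J) u : W j u -> cone_cut 1 u = 0.
  rewrite /cone_cut !expr1n !mul1r => -[] /= h; first by rewrite step_le0 ?mul0r//; lra.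
  by rewrite [X in _ * X]step_le0 ?mulr0//; lra.
have r1 : sreg B1 (fun (_ : J) u => expR (rsymbol u / 2)).
  have half : sreg moderate (fun (_ : J) u => rsymbol u / 2).
    apply: sreg_moderateM sreg_rsymbol _.
    exact: (@sreg_moderate_cst _ _ _ (fun=> _) `|2^-1|).
  apply: sreg_expR_class half.
  - move=> a N; have [C CP] := norm1_le_expR_pow N; exists (`|a| * (C * expR 4)) => _ u au.
    rewrite normrM -mulrA ler_wpM2l// ger0_norm ?expR_ge0//.
    have H : expR (rsymbol u / 2) <= expR 4 / expR (c * `|u| ^+ d / 2).
      by rewrite -expRN -expRD ler_expR; have := admissible_bound au; lra.
    apply: (le_trans (ler_pM _ _ H (CP u))); rewrite ?expR_ge0 ?exprn_ge0 ?addr_ge0//.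
    rewrite le_eqVlt; apply/orP; left; apply/eqP; field.
    by rewrite gt_eqF// expR_gt0.
  - move=> F G bF /moderateP[M [D [D0 GD]]] N; have [C CP] := bF (M + N)%N.
    exists (C * D) => j u au; rewrite normrM -mulrA.
    apply: (@le_trans _ _ (`|F j u| * (D * (1 + `|u|) ^+ (M + N)))).
      by rewrite ler_wpM2l// exprD mulrA ler_wpM2r ?exprn_ge0 ?addr_ge0// GD.
    by rewrite mulrCA [leRHS]mulrC ler_wpM2l// CP.
  - move=> F G bF bG N; have [C CP] := bF N; have [D DP] := bG N.
    exists (C + D) => j u au; apply: le_trans (lerD (CP j u au) (DP j u au)).
    by rewrite -mulrDl ler_wpM2r ?exprn_ge0 ?addr_ge0// ler_normD.
move=> k; apply: (reg_mul _ (@rapidD _ _ _) (r1 k)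
  (reg_vanish oW cut0 (@sreg_cone_cut J 1 k))) => F G bF [/moderateP[M [D [D0 GD]]] G0] N.
have [C CP] := bF (M + N)%N; exists (`|C * D|) => j u.
have [wu|nw] := pselect (W j u); first by rewrite G0// mulr0 normr0 mul0r.
have au : admissible u.
  by split; rewrite leNgt; apply/negP => h; apply: nw; [left|right].
apply: le_trans (ler_norm _); rewrite normrM -mulrA.
apply: (@le_trans _ _ (`|F j u| * (D * (1 + `|u|) ^+ (M + N)))).
  by rewrite ler_wpM2l// exprD mulrA ler_wpM2r ?exprn_ge0 ?addr_ge0// GD.
by rewrite mulrCA [leRHS]mulrC ler_wpM2l// CP.
Qed.

(** The multiplier that advances time from 1/2 to 1, cut off near the cone so as to be a Schwartz
    function. *)
Definition kernel (u : 'rV[R]_n) : R[i] := pexp P 2^-1 u * (cone_cut 1 u)%:C.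

Lemma csreg_expi {J : Type} (q : J -> 'rV[R]_n -> R) : sreg moderate q ->
  csreg moderate (fun j x => expi (q j x)).
Proof.
move=> rq; split; rewrite /expi /=.
  exact: (sreg_bounded_comp (fun k => (cos_sin_reg k).1) rq).
exact: (sreg_bounded_comp (fun k => (cos_sin_reg k).2) rq).
Qed.

Lemma csreg_kernel {J : Type} : csreg rapid (fun _ : J => kernel).
Proof.
have -> : kernel = fun u => (expR (rsymbol u / 2) * cone_cut 1 u)%:C *
    expi (2^-1 * Im (psymbol P u)).
  by apply/funext => u; rewrite /kernel /pexp mulrC mulrA -rmorphM /= [_ / 2]mulrC [X in X%:C]mulrC.
apply: csreg_rapidM.
  split; first exact: sreg_damped.
  by move=> k; apply: reg_cst => N; exists 0 => _ u; rewrite normr0 mul0r.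
apply: csreg_expi; apply: sreg_moderateM (csreg_psymbol P).2.
exact: (@sreg_moderate_cst _ _ _ (fun=> _) `|2^-1|).
Qed.

End Kernel.

(** * Difference quotients of waves and band limitation *)

Section DampedWaves.
Context {R : realType} {n : nat}.
Local Notation sreg := (sreg (@base R n)).

Lemma dot_le (x y : 'rV[R]_n) : `|dot x y| <= n%:R * (`|x| * `|y|).
Proof.
apply: (le_trans (ler_norm_sum _ _ _)).
apply: (@le_trans _ _ (\sum_(i < n) `|x| * `|y|)).
  by apply: ler_sum => i _; rewrite normrM ler_pM// coord_le_norm.
by rewrite sumr_const card_ord mulr_natl.
Qed.

(** By the mean value inequality the quotient is at most n |v|, and its derivatives involve y only
    through h'(y.v) and the bounded direction y / |y|. Uniformity reaches y = 0, where division by 0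
    makes the quotient 0. *)
Lemma sreg_difference_quotient {J : Type} (y : J -> 'rV[R]_n) (h h' : R -> R) :
  (forall j, `|y j| <= 1) ->
  (forall k, reg dir1 bounded_family k (fun _ : unit => h')) ->
  (forall t, is_derive t (1 : R) h (h' t)) -> (forall t, `|h' t| <= 1) ->
  sreg moderate (fun j v => (h (dot (y j) v) - h 0) / `|y j|).
Proof.
move=> y1 rh' dh h'1 k; apply: regW.
have d_h i j v : is_derive v (base i) (fun v => (h (dot (y j) v) - h 0) / `|y j|)
    (h' (dot (y j) v) * (y j 0 i / `|y j|)).
  have dd := sreg_is_derive i j v (sreg_moderate_dot y1).
  have Dd : 'D_(base i) (dot (y j)) v = y j 0 i.
    suff [_ ->] : is_derive v (base i) (dot (y j)) (y j 0 i) by [].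
    apply/is_derive_line0.
    have -> : (fun s : R => dot (y j) (v + s *: base i)) =
        fun s => dot (y j) v + s * y j 0 i.
      by apply/funext => s; rewrite dotC dotDl dotZl dot_base dotC.
    exact: is_derive_affine.
  have H := is_deriveZ `|y j|^-1
    (is_deriveB (is_derive_comp_line dd (dh _)) (is_derive_cst (h 0) v (base i))).
  have -> : (fun v => (h (dot (y j) v) - h 0) / `|y j|) =
      `|y j|^-1 \*: ((fun v => h (dot (y j) v)) - cst (h 0)).
    by apply/funext => w; rewrite mulrC.
  by refine (is_derive_eq H _); rewrite Dd /GRing.scale /=; ring.
apply: regS_intro.
- exists 1%N, n%:R => j v; rewrite expr1 normrM normfV normr_id.
  have [->|y0] := eqVneq (y j) 0; first by rewrite normr0 invr0 mulr0 !mulr_ge0// addr_ge0.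
  have yp : 0 < `|y j| by rewrite normr_gt0.
  have := @mean_value_le R h h' 0 (dot (y j) v) 1 (fun t _ => dh t) (fun t _ => h'1 t).
  rewrite mul1r subr0 => /le_trans/(_ (dot_le _ _)) H.
  rewrite ler_pdivrMr//; apply: (le_trans H).
  rewrite -mulrA ler_wpM2l// mulrC ler_wpM2r//.
  by rewrite lerDr.
- move=> j v; have hc : {for dot (y j) v, continuous h}.
    by apply/differentiable_continuous/derivable1_diffP; have [] := dh (dot (y j) v).
  have c1 := continuous_comp (@dot_continuous R n (y j) v) hc.
  exact: (cvgM (cvgB c1 (cvg_cst (h 0))) (cvg_cst _)).
- move=> i; exists (fun j v => h' (dot (y j) v) * (y j 0 i / `|y j|)); split; first exact: d_h.
  apply: sreg_moderateM.
    exact: (sreg_bounded_comp rh' (sreg_moderate_dot y1)).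
  apply: (@sreg_moderate_cst _ _ _ _ 1) => j.
  rewrite normrM normfV normr_id; have [->|y0] := eqVneq (y j) 0.
    by rewrite normr0 invr0 mulr0.
  by rewrite ler_pdivrMr ?normr_gt0// mul1r coord_le_norm.
Qed.

Definition wave_quotient (y v : 'rV[R]_n) : R[i] :=
  ((cos (dot y v) - 1) / `|y|) +i* (sin (dot y v) / `|y|).

Lemma csreg_wave_quotient {J : Type} (y : J -> 'rV[R]_n) : (forall j, `|y j| <= 1) ->
  csreg moderate (fun j => wave_quotient (y j)).
Proof.
move=> y1; split => /=.
  have rs k : reg dir1 bounded_family k (fun _ : unit => fun t : R => - sin t).
    exact: (reg_opp (@bounded_familyN _ _ _) (cos_sin_reg k).2).
  have b1 (t : R) : `|- sin t| <= 1 by rewrite normrN ler_norml sin_geN1 sin_le1.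
  by have := sreg_difference_quotient y1 rs (fun t => is_derive_cos t) b1; rewrite cos0.
have rc k : reg dir1 bounded_family k (fun _ : unit => @cos R) := (cos_sin_reg k).1.
have b1 (t : R) : `|cos t| <= 1 by rewrite ler_norml cos_geN1 cos_le1.
have := sreg_difference_quotient y1 rc (fun t => is_derive_sin t) b1; rewrite sin0.
suff -> : (fun j (v : 'rV[R]_n) => (sin (dot (y j) v) - 0) / `|y j|) =
  (fun j v => sin (dot (y j) v) / `|y j|) by [].
by apply/funext => j; apply/funext => v; rewrite subr0.
Qed.

Lemma wave_quotientE (y v : 'rV[R]_n) :
  expi (dot y v) - 1 = (`|y|)%:C * wave_quotient y v.
Proof.
have [->|y0] := eqVneq y 0.
  rewrite normr0 mul0r (_ : dot 0 v = 0); last by rewrite -(scale0r v) dotZl mul0r.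
  by rewrite /expi cos0 sin0; exact: subrr.
have yn : `|y| != 0 by rewrite normr_eq0.
by apply: eq_complexP; rewrite ?ReD ?ImD ?ReM ?ImM /=; field.
Qed.

Definition band (k : R) (u : 'rV[R]_n) : R[i] := (bandlimit (k *: u))%:C.

Lemma bandE k u : band k u = cutoff k u * (gauss (k *: u))%:C.
Proof.
rewrite /band /cutoff /bandlimit -rmorphM /= mulrC dotZl dotC dotZl.
by congr (step (2 - _) * _)%:C; ring.
Qed.

Lemma csreg_gauss_dilate {J : Type} (k : J -> R) : (forall j, `|k j| <= 1) ->
  csreg moderate (fun j (u : 'rV[R]_n) => (gauss (k j *: u))%:C).
Proof.
move=> k1; apply: csreg_moderate_real.
have -> : (fun j (u : 'rV[R]_n) => gauss (k j *: u)) =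
    fun j u => expR (- (k j ^+ 2 / 2) * dot u u).
  apply/funext => j; apply/funext => u; rewrite /gauss dotZl dotC dotZl; congr expR; ring.
have k2 j : `|- (k j ^+ 2 / 2)| <= 1.
  rewrite normrN ger0_norm ?divr_ge0 ?sqr_ge0// ler_pdivrMr// mul1r -real_normK ?num_real//.
  by rewrite (le_trans (exprn_ile1 _ _ (k1 j)))// ler1n.
have rq : sreg moderate (fun j (u : 'rV[R]_n) => - (k j ^+ 2 / 2) * dot u u).
  exact: (sreg_quadratic k2).
pose B (F : J -> 'rV[R]_n -> R) := moderate F.
apply: (@sreg_expR_class _ _ J B) => //.
- move=> c; exists 0%N, `|c| => j u; rewrite expr0 mulr1 normrM.
  rewrite -[leRHS]mulr1 ler_wpM2l// ger0_norm ?expR_ge0// -expR0 ler_expR mulNr.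
  by rewrite oppr_le0 mulr_ge0 ?dot_ge0// divr_ge0// sqr_ge0.
- exact: moderateM.
- exact: moderateD.
Qed.

Lemma csreg_band {J : Type} (k : J -> R) : (forall j, `|k j| <= 1) ->
  csreg moderate (fun j => band (k j)).
Proof.
move=> k1; have -> : (fun j => band (k j)) =
    fun j u => cutoff (k j) u * (gauss (k j *: u))%:C.
  by apply/funext => j; apply/funext => u; rewrite bandE.
exact: csreg_moderateM (csreg_cutoff k1) (csreg_gauss_dilate k1).
Qed.

Lemma band_compact k : 0 < k <= 1 -> smooth_compact (band k).
Proof.
move=> k01; rewrite (_ : band k = fun u => cutoff k u * (gauss (k *: u))%:C); last first.
  by apply/funext => u; rewrite bandE.
apply: csreg_compactM (cutoff_compact k01) _; apply: csreg_moderate_locally.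
apply: (csreg_gauss_dilate (k := fun=> k)) => _.
by case/andP: k01 => k0 k1; rewrite ger0_norm// ltW.
Qed.

End DampedWaves.

(** * The gradient estimate *)

Section Spreading.
Context {R : realType} {n d : nat} (P : mpoly n R[i]) (U : 'rV[R]_n -> R -> R[i]) (c : R).
Hypothesis P_deg : forall m, m \in msupp P -> mdeg m = d.
Hypothesis d_gt0 : (0 < d)%N.
Hypothesis c_gt0 : 0 < c.
Hypothesis U_regular : regular d U.
Hypothesis U_pde : forall x t, 0 < t -> cderive (1 : R) (U x) t = diff_op P (U ^~ t) x.
Hypothesis U_growth : slow_growth U.
Variable f : ('rV[R]_n -> R[i]) -> R[i].
Hypothesis U_initial : forall phi, schwartz phi ->
  cint (fun x => U x t * phi x) @[t --> 0^'+] --> f phi.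
Hypothesis annihilated : forall u, 0 < rsymbol P u \/ 0 < excess d P c u ->
  exists O, annihilating f O /\ O u.

Lemma pexp_homog (k t : R) u : pexp P (k ^+ d * t) u = pexp P t (k *: u).
Proof.
have P2 := psymbol_homog P_deg k u.
rewrite /pexp P2 ReM ImM /= !mul0r subr0 addr0.
by congr (_%:C * expi _); [congr expR|]; ring.
Qed.

(** The part removed by the cut lives on the closed set [A], where [rsymbol] or [excess] is
    positive. Its points are off the spectrum, so [uhat_support] discards it. *)
Lemma uhat_cone_cut t s k g : 0 < t -> 0 < s -> 0 < k -> smooth_compact g ->
  uhat U t g = uhat U s (fun u => g u * (pexp P (t - s) u * (cone_cut d P c k u)%:C)).
Proof.
move=> t0 s0 k0 rg.
rewrite (uhat_evolution P_deg U_regular U_pde U_growth rg s0 t0).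
set h := fun u => g u * pexp P (t - s) u.
have rh : smooth_compact h.
  apply: csreg_compactM rg _.
  exact: (csreg_pexp P (tau := fun=> t - s) (T := `|t - s|) (fun=> lexx _)).
have rc : csreg moderate (fun (_ : unit) u => (cone_cut d P c k u)%:C).
  exact/csreg_moderate_real/sreg_cone_cut.
have rc' : csreg moderate (fun (_ : unit) u => (1 - cone_cut d P c k u)%:C).
  apply: csreg_moderate_real; apply: sreg_moderateD; last exact/sreg_moderateN/sreg_cone_cut.
  exact: (@sreg_moderate_cst _ _ _ (fun=> 1) `|1|).
have -> : h = fun u => h u * (cone_cut d P c k u)%:C + h u * (1 - cone_cut d P c k u)%:C.
  by apply/funext => u; rewrite -mulrDr -rmorphD /= addrC subrK mulr1.
rewrite (uhatD U_regular U_growth s0 (smooth_compact_moderate rh rc)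
  (smooth_compact_moderate rh rc')).
pose A : set 'rV[R]_n := [set u | 2 <= k ^+ d * rsymbol P u] `|`
  [set u | 1 <= k ^+ (2 * d) * excess d P c u].
have cq := sreg_continuous (@sreg_rsymbol R n P unit) tt.
have ce := sreg_continuous (@sreg_excess R n d P c unit) tt.
have scale (a : R) (q : 'rV[R]_n -> R) : continuous q -> continuous (fun u => a * q u).
  by move=> qc u; exact: (cvgM (cvg_cst a) (qc u)).
rewrite (uhat_support P_deg U_regular U_pde U_growth U_initial (A := A) s0
  (smooth_compact_moderate rh rc')) ?addr0.
- by congr (uhat U s _); apply/funext => u; rewrite -mulrA.
- apply: closedU.
    exact: (@closed_comp _ _ (fun u => k ^+ d * rsymbol P u) [set r | 2 <= r]
      (fun x _ => scale _ _ cq x) (@closed_ge R 2)).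
  exact: (@closed_comp _ _ (fun u => k ^+ (2 * d) * excess d P c u) [set r | 1 <= r]
      (fun x _ => scale _ _ ce x) (@closed_ge R 1)).
- move=> u Au; apply: annihilated; case: Au => /= Au; [left|right].
    by rewrite -(pmulr_rgt0 _ (exprn_gt0 d k0)); lra.
  by rewrite -(pmulr_rgt0 _ (exprn_gt0 (2 * d) k0)); lra.
- move=> u /not_orP[/= /negP]; rewrite -ltNge => q2 /negP; rewrite -ltNge => e1.
  by rewrite /cone_cut !step_ge1 ?mulr1 ?subrr ?mulr0//; lra.
Qed.

(* The difference is, up to e --> 0, an integral of the solution at time       *)
(* k^d / 2 against a rapidly decreasing kernel of size O(|y|).                 *)
Lemma spreading N : exists C : R, forall k B y, 0 < k -> 0 < B -> `|y| <= 1 ->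
  (forall w, normc (U (k *: w) (k ^+ d / 2)) <= B * (1 + `|w|) ^+ N) ->
  normc (U (k *: y) (k ^+ d) - U 0 (k ^+ d)) <= C * (B * `|y|).
Proof.
(* The index will be (e / k, y), with e <= k, so that the constant [C1] depends on none of e, k and
   y. *)
pose J := {p : R * 'rV[R]_n | `|p.1| <= 1 /\ `|p.2| <= 1}.
pose M (j : J) u := wave_quotient (sval j).2 u * (band (sval j).1 u * kernel d P c u).
have rM : csreg rapid M.
  have rk := csreg_kernel P d_gt0 c_gt0 (J := J).
  have rb := csreg_band (n := n) (k := fun j : J => (sval j).1) (fun j => (svalP j).1).
  have rw := csreg_wave_quotient (y := fun j : J => (sval j).2) (fun j => (svalP j).2).
  have := csreg_rapidM (csreg_rapidM rk rb) rw.
  rewrite (_ : (fun j u => _) = M)//; apply/funext => j; apply/funext => u.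
  by rewrite /M mulrC; congr (_ * _); rewrite mulrC.
have [C1 C1P] := growth_cwbounded 1 N (csreg_fourier rM).
pose c0 := cint (fourier (fun u : 'rV[R]_n => (bandlimit u)%:C)).
have c00 : 0 < normc c0.
  by rewrite lt_def normc_ge0 andbT; apply: contra (bandlimit_mass_neq0 (R := R) (n := n)) => /eqP/eq0_normc ce; exact/eqP.
exists (C1 * wmass ^+ n *+ 2 / normc c0) => k B y k0 B0 y1 UB.
set t := k ^+ d in UB *; have t0 : 0 < t by rewrite exprn_gt0.
have s0 : 0 < t / 2 by rewrite divr_gt0.
pose wave (e : R) (z u : 'rV[R]_n) : R[i] := band e u * expi (dot z u).
have wave_compact e z : 0 < e <= 1 -> smooth_compact (wave e z).
  move=> e01; apply: smooth_compact_moderate (band_compact e01) _.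
  exact/csreg_expi/(sreg_moderate_dot (z := fun=> z) (fun=> lexx _)).
have cU := U_continuous U_regular t0.
have [K [N' KN]] := growth_on_interval U_growth t t0.
have KN' x : normc (U x t) <= K * (1 + `|x|) ^+ N' by apply: KN; rewrite !lexx.
have rb : csreg rapid (fun (_ : unit) (u : 'rV[R]_n) => (bandlimit u)%:C).
  split; first exact: sreg_bandlimit.
  by move=> l; apply: reg_cst => m; exists 0 => _ u; rewrite normr0 mul0r.
(* The waves are compactly supported in frequency, and their pairings tend to point values of U up
   to the mass [c0]. *)
have lim z : uhat U t (wave e z) @[e --> 0^'+] --> U z t * c0.
  refine (cvg_trans _ (approximate_identity (y := z) cU KN' (csreg_fourier rb))).
  apply: near_eq_cvg; near=> e.
  have e01 : 0 < e <= 1 by apply/andP; split; near: e; [exact: nbhs_right_gt|exact: nbhs_right_le].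
  have [D wD] := uhat_cwbounded U_regular U_growth t0 (wave_compact e z e01).
  have [D' wD'] := growth_cwbounded (K * (1 + `|z|) ^+ N') N' (csreg_fourier rb).
  have [C wC] := csreg_rapid_cwbounded rb.
  have e0 : 0 < e by case/andP: e01.
  apply: esym; apply: (cint_fourier_wave (V := U ^~ t) e0 (wC tt) wD).
  apply: (wD' tt (fun w => U (e *: w + z) t)); first exact: (affine_continuous (V := U ^~ t)).
  apply: (growth_affine (V := U ^~ t)) => //.
  by case/andP: e01 => e_gt0 ->; rewrite ltW.
have bound e : 0 < e <= Num.min 1 k ->
    normc (uhat U t (wave e (k *: y)) - uhat U t (wave e 0)) <=
    C1 * wmass ^+ n *+ 2 * (B * `|y|).
  move=> /andP[e0]; rewrite le_min => /andP[e1 ek].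
  have e01 : 0 < e <= 1 by rewrite e0.
  have rw0 := wave_compact e (k *: y) e01; have rw1 := wave_compact e 0 e01.
  have rwN : smooth_compact (fun u => -1 * wave e 0 u).
    have H := smooth_compact_moderate rw1 (@csreg_moderate_cst R n unit (fun=> -1) (normc (-1)) (fun=> lexx _)).
    by rewrite (_ : (fun u => _) = fun u => wave e 0 u * -1)//; apply/funext => u; rewrite mulrC.
  rewrite -mulN1r -(uhatZ U_regular U_growth (-1) t0 rw1) -(uhatD U_regular U_growth t0 rw0 rwN).
  rewrite (uhat_cone_cut t0 s0 k0 (smooth_compactD rw0 rwN)).
  have jP : `|e / k| <= 1 /\ `|y| <= 1.
    by rewrite normrM normfV !gtr0_norm// ler_pdivrMr// mul1r.
  pose j : J := exist _ (e / k, y) jP.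
  pose m u := (`|y|)%:C * M j u.
  (* After homogeneity everything depends on u through k u, and the difference of the two waves
     supplies the factor |y|. *)
  have hE : (fun u => (wave e (k *: y) u + -1 * wave e 0 u) *
      (pexp P (t - t / 2) u * (cone_cut d P c k u)%:C)) =
      fun u => m (k *: u) * expi (dot 0 u).
    apply/funext => u; rewrite /m /M /kernel /= [X in _ = X * _]mulrA -wave_quotientE.
    have d0 : dot 0 u = 0 by rewrite -(scale0r u) dotZl mul0r.
    have -> : t - t / 2 = k ^+ d * 2^-1 by rewrite /t; field.
    rewrite pexp_homog (cone_cut_scale c P_deg) /wave /band scalerA divfK ?gt_eqF// d0.
    have -> : dot (k *: y) u = dot y (k *: u) by rewrite dotZl (dotC y (k *: u)) dotZl (dotC u y).
    have -> : expi 0 = 1 :> R[i] by rewrite /expi cos0 sin0.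
    by rewrite mulN1r !mulr1; ring.
  rewrite hE.
  have [Cm wm] := csreg_rapid_cwbounded rM.
  have [Cm' wm'] := cwboundedZ (`|y|)%:C (wm j).
  have rh : smooth_compact (fun u => m (k *: u) * expi (dot 0 u)).
    rewrite -hE; apply: csreg_compactM (smooth_compactD rw0 rwN) _.
    rewrite /=; have rp := csreg_pexp P (J := unit) (tau := fun=> t - t / 2) (fun=> lexx _).
    have rc := csreg_moderate_locally (csreg_moderate_real (@sreg_cone_cut R n d P c unit k)).
    apply: csregM rp rc; [exact: sreg_locallyM|exact: locally_boundedD|exact: locally_boundedN].
  have [D wD] := uhat_cwbounded U_regular U_growth s0 rh.
  (* Dividing by [B] brings the growth constant to 1, the value for which [C1] was chosen. *)
  pose V w := (B^-1)%:C * U (k *: w + 0) (t / 2).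
  have VC : continuous V.
    have H : continuous (fun w : 'rV[R]_n => U (k *: w + 0) (t / 2)).
      move=> w; apply: (affine_continuous (V := U ^~ (t / 2))); exact: (U_continuous U_regular).
    by move=> w; exact: (cvg_complexM (cvg_cst _) (H w)).
  have VB w : normc (V w) <= 1 * (1 + `|w|) ^+ N.
    rewrite /V normcM normcR ger0_norm ?invr_ge0 ?(ltW B0)// addr0 mul1r.
    by rewrite mulrC ler_pdivrMr// [leRHS]mulrC.
  have wV := C1P j V VC VB.
  have VE : (fun w => U (k *: w + 0) (t / 2) * fourier m w) =
      fun w => (B * `|y|)%:C * (V w * fourier (M j) w).
    apply/funext => w; rewrite /m (fourierZ _ w (wm j)) /V rmorphM /=.
    have BE : B%:C * (B^-1)%:C = 1 :> R[i] by rewrite -rmorphM /= mulfV ?gt_eqF.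
    by rewrite -[LHS]mul1r -BE; ring.
  have [D' wD'] := cwboundedZ (B * `|y|)%:C wV.
  rewrite /uhat (cint_fourier_wave (V := U ^~ (t / 2)) k0 wm' wD (D' := D')); last by rewrite VE.
  rewrite VE (cintZ _ wV) normcM normcR ger0_norm ?mulr_ge0 ?(ltW B0)// mulrC.
  by rewrite ler_wpM2r ?mulr_ge0 ?(ltW B0)//; exact: cint_le wV.
have lim2 : uhat U t (wave e (k *: y)) - uhat U t (wave e 0) @[e --> 0^'+] -->
    (U (k *: y) t - U 0 t) * c0.
  by rewrite mulrBl; exact: (cvgB (lim _) (lim _)).
rewrite mulrAC ler_pdivlMr// -normcM.
apply/ler_addgt0Pr => r r0; move/cvg_normcP: lim2 => /(_ r r0) near_r.
near (0 : R)^'+ => e.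
have er : normc (uhat U t (wave e (k *: y)) - uhat U t (wave e 0) - (U (k *: y) t - U 0 t) * c0) < r.
  by near: e.
have eb := bound e; have {}eb : normc (uhat U t (wave e (k *: y)) - uhat U t (wave e 0)) <=
    C1 * wmass ^+ n *+ 2 * (B * `|y|).
  apply: eb; apply/andP; split; near: e; first exact: nbhs_right_gt.
  by apply: nbhs_right_le; rewrite lt_min ltr01.
apply: le_trans (lerD eb (ltW er)).
set a := uhat U t _ - _; set l := _ * c0.
by have := le_normcD a (- (a - l)); rewrite subKr normcN; exact.
Unshelve. all: by end_near. Qed.

End Spreading.

(** * Slow variation and stabilization *)

Section SlowVariation.
Context {R : realType}.
Local Notation mu := (@lebesgue_measure R).

Lemma lebesgue_translate (s : R) (A : set R) : measurable A ->
  mu ((fun u => u - s) @^-1` A) = mu A.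
Proof.
move=> mA.
pose m := pushforward mu ((fun u => u - s) : measurableTypeR R -> measurableTypeR R).
have ms : measurable_fun setT ((fun u => u - s) : measurableTypeR R -> measurableTypeR R).
  by apply: measurable_funB.
rewrite -[LHS]/(m A); apply/esym/lebesgue_measure_unique => //= _ [[a b]] _ <-.
rewrite /m /pushforward (_ : _ @^-1` _ = `](a + s), (b + s)]%classic); last first.
  by apply/seteqP; split=> u; rewrite /= !in_itv /= ltrBrDr lerBlDr.
rewrite !lebesgue_measure_itv/= !lte_fin ltrD2r.
by case: ifP => // _; rewrite -!EFinB; congr (_ %:E); ring.
Qed.

Variables (L : R -> R) (A : R).
Hypothesis L_gt0 : forall x, A < x -> 0 < L x.
Hypothesis L_measurable : measurable_fun (`]A, +oo[%classic : set R) L.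
Hypothesis L_slow : forall a : R, 0 < a -> L (a * x) / L x @[x --> +oo] --> (1 : R).

Let ratio (t u : R) : R := L (expR (t + u)) / L (expR t).
(** In logarithmic coordinates slow variation says that [ratio t u] tends to 1 for each u; these are
    the shifts for which it is still off by a factor 2. *)
Let bad (t : R) : set R := `[0, 2]%classic `&` ratio t @^-1` (~` `]2^-1, 2[%classic).

Let A_lt_expR (t u : R) : `|A| < t -> 0 <= u -> A < expR (t + u).
Proof.
move=> At u0; apply: (le_lt_trans (ler_norm A)); apply: (lt_le_trans At).
by apply: le_trans (expR_ge1Dx _); lra.
Qed.

Let bad_measurable (t : R) : `|A| < t -> measurable (bad t).
Proof.
move=> At; have m02 : measurable (`[0, 2]%classic : set R) by [].
suff mr : measurable_fun (`[0, 2]%classic : set R) (ratio t).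
  by apply: mr => //; exact: measurableC.
apply: measurable_funM; last exact: measurable_cst.
apply: (@measurable_comp _ _ _ _ _ _ `]A, +oo[%classic L _ (fun u => expR (t + u))) => //.
  move=> v [u /=]; rewrite in_itv /= => /andP[u0 _] <-.
  by rewrite in_itv /= andbT A_lt_expR.
apply: measurable_funTS; apply: measurableT_comp; first exact: measurable_expR.
by apply: measurable_funD.
Qed.

(** Otherwise some t_k tending to infinity have bad sets of measure at least 1/2, although the
    indicators of these sets tend to 0 pointwise; this contradicts dominated convergence on
    [0, 2]. *)
Let bad_small : exists T, `|A| < T /\ forall t, T <= t -> (mu (bad t) < (2^-1)%:E)%E.
Proof.
apply: contrapT => H.
have /choice[t tP] : forall k : nat, exists t, `|A| + 1 + k%:R <= t /\ ((2^-1)%:E <= mu (bad t))%E.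
  move=> k; apply: contrapT => Hk; apply: H; exists (`|A| + 1 + k%:R); split.
    by rewrite -addrA ltrDl ltr_pwDl.
  by move=> t tk; rewrite ltNge; apply/negP => h; apply: Hk; exists t.
have At k : `|A| < t k by apply: lt_le_trans (tP k).1; rewrite -addrA ltrDl ltr_pwDl.
have m02 : measurable (`[0, 2]%classic : set R) by [].
have [|||||_ _] := @dominated_convergence _ _ _ mu `[0, 2]%classic m02
    (fun k x => (\1_(bad (t k)) x)%:E) (fun x => 0%E) (fun x => 1%E).
- move=> k; apply/measurable_EFinP; apply: measurable_funTS.
  apply: measurable_indic; exact: bad_measurable.
- exact: measurable_cst.
- apply: aeW => u /=; rewrite in_itv /= => /andP[u0 u2].
  have a0 : 0 < expR u := expR_gt0 u.
  have /cvgrPdist_lt /(_ (2^-1) _)[|T [_ TP]] := L_slow a0; first by rewrite invr_gt0.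
  apply: cvg_near_cst.
  have [k0 k0P] : exists k0 : nat, T <= k0%:R.
    by exists (Num.truncn `|T|).+1; rewrite (le_trans (ler_norm _))// ltW// truncnS_gt.
  exists k0 => // k /= kk; rewrite indicE memNset//= => -[_ /=]; rewrite in_itv /=; apply.
  have : T < expR (t k).
    apply: (le_lt_trans k0P); apply: (@le_lt_trans _ _ k%:R); first by rewrite ler_nat.
    apply: (@lt_le_trans _ _ (1 + t k)); last exact: expR_ge1Dx.
    by have := (tP k).1; have := normr_ge0 A; lra.
  move=> /TP; rewrite -expRD (addrC u) -/(ratio (t k) u) ltr_norml; lra.
- have := @continuous_compact_integrable R (cst 1) `[0, 2]%classic (@segment_compact R 0 2).
  by apply; apply: continuous_subspaceT => u; exact: cvg_cst.
- apply: aeW => u k _; rewrite /= lee_fin ger0_norm ?indicE//.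
  by rewrite lern1 leq_b1.
rewrite integral0 => H0.
have : ((2^-1)%:E <= limn (fun k => \int[mu]_(x in `[0%R, 2%R]) (\1_(bad (t k)) x)%:E))%E.
  apply: lime_ge; first by apply/cvg_ex; exists 0%E.
  apply: nearW => k; rewrite integral_indic//; last exact: bad_measurable.
  by rewrite (_ : _ `&` _ = bad (t k)) ?(tP k).2//; apply/setIidPl => u [].
by rewrite (cvg_lim _ H0)// lee_fin leNgt invr_gt0 ltr0n.
Qed.

(** Write x = e^t and a = e^s with s in [0, 1]. The set [bad t] and the translate by s of
    [bad (t + s)] have total measure below 1, so some u in [1, 2] avoids both. Then L(e^(t + u)) is
    within a factor 2 of L(x) and of L(a x), which are therefore within a factor 4 of each other. *)
Lemma slowly_varying_doubling : exists X, 0 < X /\ (forall x, X <= x -> A < x) /\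
  forall x a, X <= x -> 1 <= a <= 2 -> L (a * x) <= 4 * L x /\ L x <= 4 * L (a * x).
Proof.
have [T [AT TP]] := bad_small; exists (expR T); split; first exact: expR_gt0.
have Ax x : expR T <= x -> A < x.
  move=> Tx; apply: lt_le_trans Tx.
  by have := @A_lt_expR T 0 AT (lexx _); rewrite addr0.
split=> // x a Tx /andP[a1 a2].
have x0 : 0 < x by apply: lt_le_trans Tx; exact: expR_gt0.
have a0 : 0 < a by lra.
pose t := ln x; pose s := ln a.
have xE : x = expR t by rewrite lnK.
have aE : a = expR s by rewrite lnK.
have Tt : T <= t by rewrite -ler_expR -xE.
have s0 : 0 <= s by rewrite ln_ge0.
have s1 : s <= 1 by have := expR_ge1Dx s; rewrite -aE; lra.
have Tts : T <= t + s by lra.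
pose S : set R := (fun u => u - s) @^-1` bad (t + s).
have mS : measurable S.
  have := bad_measurable (lt_le_trans AT Tts).
  have ms : measurable_fun setT (fun u : R => u - s) by apply: measurable_funB.
  by move=> /(ms measurableT); rewrite setTI.
have mb := bad_measurable (lt_le_trans AT Tt).
have [u [/= u12 ub uS]] : exists u, [/\ `[1, 2]%classic u, ~ bad t u & ~ S u].
  apply: contrapT => H.
  have sub : `[1, 2]%classic `<=` bad t `|` S.
    by move=> u u12; apply: contrapT => /not_orP[ub uS]; apply: H; exists u.
  have := le_measure mu _ _ sub.
  rewrite !inE => /(_ _ _) le12.
  have {}le12 : (mu (`[1%R, 2%R]%classic : set R) <= mu (bad t `|` S))%E.
    by apply: le12; [exact: measurable_itv|exact: measurableU].
  have muS : (mu S < (2^-1)%:E)%E.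
    by rewrite lebesgue_translate; [exact: TP|exact: bad_measurable (lt_le_trans AT Tts)].
  have := le_lt_trans (le_trans le12 (measureU2 mu mb mS)) (lteD (TP t Tt) muS).
  rewrite lebesgue_measure_itv /= lte_fin ltr1n /= -EFinB -EFinD lte_fin.
  lra.
move: u12; rewrite in_itv /= => /andP[u1 u2].
have good r v : ~ bad r v -> 0 <= v <= 2 -> 2^-1 < ratio r v < 2.
  move=> nb v02; apply: contrapT => H; apply: nb; split; rewrite /= in_itv //=.
have /andP[g1 g2] : 2^-1 < ratio t u < 2 by apply: good => //; apply/andP; split; lra.
have /andP[h1 h2] : 2^-1 < ratio (t + s) (u - s) < 2.
  by apply: good => //; apply/andP; split; lra.
move: g1 g2 h1 h2; rewrite /ratio addrACA addrN addr0.
have -> : a * x = expR (t + s) by rewrite expRD -xE -aE mulrC.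
have p1 : 0 < L (expR (t + s)) by apply: L_gt0; exact: A_lt_expR (lt_le_trans AT Tt) s0.
have p2 : 0 < L (expR t) by apply: L_gt0; rewrite -xE; exact: Ax.
rewrite xE !ltr_pdivrMr// !ltr_pdivlMr//; lra.
Qed.

End SlowVariation.

(** * Homogeneity of the cone, the sphere and the comparison function *)

Section Rescaling.
Context {R : realType} {n : nat}.

(** On the compact intersection of Gamma with the unit sphere Re P(iu) is negative and its inverse
    is bounded; homogeneity extends Re P(iu) <= - c |u|^d to all of Gamma. *)
Lemma cone_constant d (P : mpoly n R[i]) (Gamma : set 'rV[R]_n) :
  closed_convex_cone Gamma -> (0 < d)%N -> (forall m, m \in msupp P -> mdeg m = d) ->
  (forall u, Gamma u -> u <> 0 -> complex.Re (meval (imag_vec u) P) < 0) ->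
  exists2 c, 0 < c & forall u, Gamma u -> rsymbol P u <= 0 /\ excess d P c u <= 0.
Proof.
move=> [clG _ _ coneG] d0 P_deg neg.
pose K := Gamma `&` [set u | dot u u = 1].
have cd : continuous (fun u : 'rV[R]_n => dot u u) := sreg_continuous (@sreg_dotxx R n unit) tt.
have cq : continuous (rsymbol P) := sreg_continuous (@sreg_rsymbol R n P unit) tt.
have K0 u : K u -> u <> 0.
  by move=> [_ /= + u0]; rewrite u0 -(scale0r (0 : 'rV[R]_n)) dotZl mul0r => /eqP; rewrite eq_sym oner_eq0.
have cK : compact K.
  have clK : closed K.
    apply: closedI => //.
    exact: (@closed_comp _ _ (fun u : 'rV[R]_n => dot u u) [set x | x = 1]
      (fun u _ => cd u) (@closed_eq R 1)).
  apply: (subclosed_compact clK (@closed_ball_compact R n 1)) => u [_ /= u1].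
  by rewrite -(@expr_le1 _ 2)// (le_trans (norm_sqr_le_dot u))// u1.
have [C CP] : exists C, forall u, K u -> `|(rsymbol P u)^-1| <= C.
  apply: (compact_norm_bounded cK) => u Ku; refine (cvgV _ (cq u)).
  by apply/negbT/lt_eqF; apply: neg; [case: Ku|exact: K0].
have C1 : 0 < 1 + `|C| by rewrite ltr_pwDl.
exists (1 + `|C|)^-1 => [|u Gu]; first by rewrite invr_gt0.
have [->|u0] := eqVneq u 0.
  have r0 : rsymbol P 0 = 0.
    by rewrite -(scale0r (0 : 'rV[R]_n)) (rsymbol_homog P_deg) expr0n gtn_eqF// mul0r.
  rewrite r0; split => //; rewrite -(scale0r (0 : 'rV[R]_n)) (excess_homog _ P_deg).
  by rewrite expr0n muln_eq0 /= gtn_eqF// mul0r.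
have qu : rsymbol P u < 0 by apply: neg => //; exact/eqP.
split; first exact: ltW.
set e := enorm u; have e2 : e ^+ 2 = dot u u by rewrite /e /enorm sqr_sqrtr// dot_ge0.
have e0 : 0 < e by apply: lt_le_trans (norm_le_enorm u); rewrite normr_gt0.
have Kv : K (e^-1 *: u).
  split; first by apply: coneG => //; rewrite invr_gt0.
  rewrite /= dotZl dotC dotZl -e2; field; exact: lt0r_neq0.
have := CP _ Kv; rewrite (rsymbol_homog P_deg) => H.
have {}H : e ^+ d <= `|rsymbol P u| * (1 + `|C|).
  have en0 : 0 < e ^+ d by rewrite exprn_gt0.
  have : `|(e^-1 ^+ d * rsymbol P u)^-1| <= 1 + `|C|.
    by rewrite (le_trans H)// (le_trans (ler_norm _))// lerDr.
  rewrite invfM exprVn invrK normrM normfV ger0_norm ?(ltW en0)//.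
  by rewrite ler_pdivrMr ?normr_gt0 ?ltr0_neq0// mulrC.
rewrite /excess subr_le0 -e2 -exprM mulnC exprM -exprMn -[leRHS]real_normK ?num_real//.
have p1 : 0 <= (1 + `|C|)^-1 by rewrite invr_ge0 ltW.
rewrite lerXn2r ?nnegrE ?mulr_ge0 ?exprn_ge0 ?(ltW e0)//.
by rewrite mulrC ler_pdivrMr.
Qed.

(* Places (w, 1/2) on the d-curve through a point of the unit sphere. *)
Lemma sphere_rescaling d (w : 'rV[R]_n) : (0 < d)%N -> exists a : R,
  2^-1 <= a <= 1 + enorm w /\
  dot (a^-1 *: w) (a^-1 *: w) + ((2 * a ^+ d)^-1) ^+ 2 = 1.
Proof.
case: d => // d _.
pose e := enorm w; have e0 : 0 <= e := enorm_ge0 w.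
have e2 : e ^+ 2 = dot w w by rewrite /e /enorm sqr_sqrtr// dot_ge0.
(* Zeros of [p] are the solutions of the sphere equation after clearing denominators; here [d] is
   one less than the original degree. The sign change between 1/2 and 1 + |w| gives a zero. *)
pose p (a : R) := 4 * (a ^+ d) ^+ 2 * (e ^+ 2 - a ^+ 2) + 1.
have cp : continuous p.
  have cX k : continuous (fun a : R => a ^+ k) by exact: exprn_continuous.
  move=> a; apply: cvgD; last exact: cvg_cst.
  apply: cvgM; last by apply: cvgB; [exact: cvg_cst|exact: cX].
  apply: cvgM; first exact: cvg_cst.
  by rewrite expr2; under eq_fun do rewrite expr2; apply: cvgM; exact: cX.
have half : 0 <= p 2^-1.
  have h1 : 0 <= ((2^-1 : R) ^+ d) ^+ 2 <= 1.
    by rewrite sqr_ge0 /= !exprn_ile1 ?exprn_ge0 ?invr_ge0 ?invf_le1 ?ler1n.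
  move: h1; rewrite /p; set z := _ ^+ 2 => /andP[z0 z1].
  have : 0 <= z * e ^+ 2 by rewrite mulr_ge0 ?sqr_ge0.
  by rewrite mulrBr expr2; nra.
have big : p (1 + e) <= 0.
  have : 1 <= ((1 + e) ^+ d) ^+ 2 by rewrite !exprn_ege1// lerDl.
  by rewrite /p; set z := (_ ^+ d) ^+ 2; rewrite !expr2; nra.
have he : 2^-1 <= 1 + e by lra.
have [||a] := @IVT R p 2^-1 (1 + e) 0 he.
- exact: continuous_subspaceT.
- by rewrite ge_min le_max half big orbT.
rewrite in_itv /= => aP pa; exists a; split => //.
have a0 : 0 < a by case/andP: aP; lra.
have ad : a ^+ d != 0 by rewrite gt_eqF// exprn_gt0.
rewrite dotZl dotC dotZl -e2 (exprS a d); move: pa ad; rewrite /p; set z := a ^+ d => pa ad.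
have -> : a^-1 * (a^-1 * e ^+ 2) + (2 * (a * z))^-1 ^+ 2 =
    (4 * z ^+ 2 * (e ^+ 2 - a ^+ 2) + 1) / (4 * z ^+ 2 * a ^+ 2) + 1.
  by field; rewrite ad gt_eqF.
by rewrite pa mul0r add0r.
Qed.

(** For a >= 1/2 one has |ln a| <= ln(2 (1 + a)), which treats both signs of [alpha] at once. *)
Lemma powR_le_exp (alpha : R) : exists M : nat, forall a : R, 2^-1 <= a ->
  a `^ alpha <= (2 * (1 + a)) ^+ M.
Proof.
exists (Num.truncn `|alpha|).+1 => a a2; have a0 : 0 < a by lra.
have b1 : 1 <= 2 * (1 + a) by lra.
apply: (@le_trans _ _ ((2 * (1 + a)) `^ `|alpha|)); last first.
  by rewrite -powR_mulrn ?ler_powR ?ltW ?truncnS_gt//; lra.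
rewrite /powR !gt_eqF; [|lra..]; rewrite ler_expR.
have lnb : 0 <= ln (2 * (1 + a)) by rewrite ln_ge0.
have lna : `|ln a| <= ln (2 * (1 + a)).
  rewrite ler_norml; apply/andP; split; last by rewrite ler_ln ?posrE; lra.
  have aV : a^-1 <= 2 by rewrite -[leRHS]invrK lef_pV2 ?posrE ?invr_gt0.
  by rewrite lerNl -lnV ?posrE// ler_ln ?posrE ?invr_gt0//; lra.
by rewrite (le_trans (ler_norm _))// normrM ler_wpM2l.
Qed.

(** A Potter-type bound for x^alpha L(x): doubling is iterated along the dyadic scale for a >= 1 and
    used backwards for a in [1/2, 1]. The threshold is doubled so that a x stays in the range of the
    doubling inequality. *)
Lemma regular_growth (alpha : R) (L : R -> R) : slowly_varying L ->
  exists X (M : nat) (C : R), [/\ 0 < X, 0 <= C,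
    forall x, X <= x -> 0 < x `^ alpha * L x &
    forall x a, X <= x -> 2^-1 <= a ->
      (a * x) `^ alpha * L (a * x) <= C * (1 + a) ^+ M * (x `^ alpha * L x)].
Proof.
move=> [A [L0 Lm Ls]]; have [X [X0 [XA XP]]] := slowly_varying_doubling L0 Lm Ls.
(* The square absorbs the factor 4 lost at each halving of [a], because 4 (a / 2)^2 = a^2. *)
have up (m : nat) : forall x a, X <= x -> 1 <= a <= 2 ^+ m -> L (a * x) <= 4 * a ^+ 2 * L x.
  elim: m => [|m IH] x a Xx /andP[a1 am].
    have -> : a = 1 by apply/eqP; rewrite eq_le a1 am.
    by rewrite mul1r; have := L0 x (XA x Xx); rewrite expr2; nra.
  have Lx := L0 x (XA x Xx).
  have [a2|a2] := leP a 2.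
    have := (XP x a Xx _).1; rewrite a1 a2 => /(_ isT)/le_trans; apply.
    by rewrite ler_wpM2r ?(ltW Lx)// ler_peMr// exprn_ege1.
  have Xh : X <= a / 2 * x.
    have := le_lt_trans Xx (_ : x < a / 2 * x); rewrite ltr_pMl ?(lt_le_trans X0)//.
    by rewrite ltr_pdivlMr// mul1r => /(_ a2)/ltW.
  have := (XP _ 2 Xh _).1; rewrite ler1n lexx => /(_ isT).
  have -> : 2 * (a / 2 * x) = a * x by field.
  move=> /le_trans; apply.
  have := IH x (a / 2) Xx _; rewrite ler_pdivlMr// ler_pdivrMr// -exprSr am mul1r (ltW a2).
  move=> /(_ isT) H; apply: (@le_trans _ _ (4 * (4 * (a / 2) ^+ 2 * L x))).
    by rewrite ler_wpM2l.
  by rewrite !mulrA ler_wpM2r ?(ltW Lx)// le_eqVlt; apply/orP; left; apply/eqP; field.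
have Lgrowth x a : 2 * X <= x -> 2^-1 <= a -> L (a * x) <= 4 * (1 + a) ^+ 2 * L x.
  move=> Xx a2; have Xx' : X <= x by lra.
  have Lx := L0 x (XA x Xx').
  have [a1|a1] := leP a 1.
    have Xax : X <= a * x by rewrite (@le_trans _ _ (2^-1 * x))//; [lra|rewrite ler_wpM2r//; lra].
    have a0 : 0 < a by lra.
    have := (XP _ a^-1 Xax _).2; rewrite mulrA mulVf ?gt_eqF// mul1r => H.
    have {}H : L (a * x) <= 4 * L x.
      apply: H; rewrite invf_ge1// a1 /= -[leRHS]invrK lef_pV2 ?posrE ?invr_gt0//.
    by rewrite (le_trans H)// ler_wpM2r ?(ltW Lx)// ler_peMr// exprn_ege1// lerDl ltW.
  have [m am] : exists m, a <= 2 ^+ m.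
    exists (Num.truncn a).+1; rewrite (le_trans (ltW (truncnS_gt _)))//.
    by rewrite -natrX ler_nat ltnW// ltn_expl.
  have := up m x a Xx'; rewrite (ltW a1) am => /(_ isT)/le_trans; apply.
  rewrite ler_wpM2r ?(ltW Lx)// ler_wpM2l// lerXn2r ?nnegrE; lra.
have [M MP] := powR_le_exp alpha.
exists (2 * X), (M + 2)%N, (2 ^+ M * 4); split.
- by rewrite mulr_gt0.
- by rewrite mulr_ge0// exprn_ge0.
- by move=> x Xx; rewrite mulr_gt0 ?powR_gt0 ?L0 ?XA; lra.
move=> x a Xx a2; have x0 : 0 <= x by lra.
have a0 : 0 <= a by lra.
have Lx : 0 < L x by apply: L0; apply: XA; lra.
have Lax : 0 < L (a * x).
  by apply/L0/XA; rewrite (@le_trans _ _ (2^-1 * x))//; [lra|rewrite ler_wpM2r].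
rewrite powRM//; apply: (@le_trans _ _ ((2 * (1 + a)) ^+ M * x `^ alpha * (4 * (1 + a) ^+ 2 * L x))).
  rewrite ler_pM ?mulr_ge0 ?powR_ge0 ?(ltW Lax)//.
  - by rewrite ler_wpM2r ?powR_ge0// MP.
  - exact: Lgrowth.
by rewrite le_eqVlt exprMn exprD; apply/orP; left; apply/eqP; ring.
Qed.

End Rescaling.

(** * From the gradient estimate to stabilization *)

Section Stabilization.
Context {R : realType} {n d : nat} (U : 'rV[R]_n -> R -> R[i]) (rho : R -> R).
Hypothesis d_gt0 : (0 < d)%N.
Variables (X Ck : R) (M : nat).
Hypothesis X_gt0 : 0 < X.
Hypothesis Ck_ge0 : 0 <= Ck.
Hypothesis rho_gt0 : forall x, X <= x -> 0 < rho x.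
Hypothesis rho_growth : forall x a, X <= x -> 2^-1 <= a ->
  rho (a * x) <= Ck * (1 + a) ^+ M * rho x.

(** Write (w, 1/2) = (a x, a^d t) with (x, t) on the sphere. Then (k w, k^d / 2) is the dilate of
    (x, t) by a k, and the hypothesis costs t^-l = 2^l a^(d l) together with rho(a k); both are
    polynomial in 1 + |w|, up to rho(k). The bound a >= 1/2 accounts for the doubled thresholds. *)
Lemma dcurve_growth (C : R) l (lambda0 : R) : 0 < C ->
  (forall x t lambda, 0 < t -> dot x x + t ^+ 2 = 1 -> lambda0 <= lambda ->
     normc (U (lambda *: x) (lambda ^+ d * t) / (rho lambda)%:C) <= C / t ^+ l) ->
  exists (B : R) (N : nat), 0 < B /\ forall k w, 2 * X <= k -> 2 * lambda0 <= k ->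
    normc (U (k *: w) (k ^+ d / 2)) <= B * rho k * (1 + `|w|) ^+ N.
Proof.
move=> C0 HC; pose N := (d * l + M)%N.
exists (C * 2 ^+ l * (Ck + 1) * (2 + n%:R) ^+ N), N; split.
  have n2 : 0 < 2 + n%:R :> R by rewrite ltr_wpDr.
  by rewrite !mulr_gt0 ?exprn_gt0// ltr_wpDl.
move=> k w Xk lk; have [a [/andP[a2 ae] aw]] := sphere_rescaling w d_gt0.
have a0 : 0 < a by lra.
have k0 : 0 < k by apply: lt_le_trans Xk; rewrite mulr_gt0.
have ad0 : 0 < a ^+ d by rewrite exprn_gt0.
have ka : k / 2 <= a * k by rewrite mulrC ler_wpM2r// ltW.
have Xak : X <= a * k by lra.
have rak := rho_gt0 Xak.
have Xk' : X <= k by lra.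
have rk := rho_gt0 Xk'.
have t0 : 0 < (2 * a ^+ d)^-1 by rewrite invr_gt0 mulr_gt0.
have lak : lambda0 <= a * k by lra.
have := HC _ _ _ t0 aw lak.
have -> : (a * k) *: (a^-1 *: w) = k *: w.
  by rewrite scalerA mulrAC mulfV ?gt_eqF// mul1r.
have -> : (a * k) ^+ d * (2 * a ^+ d)^-1 = k ^+ d / 2.
  by rewrite exprMn; field; rewrite gt_eqF.
rewrite normcM normcV normcR ger0_norm ?(ltW rak)// ler_pdivrMr// => /le_trans; apply.
rewrite exprVn invrK exprMn -exprM.
have b1 : 1 + a <= (2 + n%:R) * (1 + `|w|).
  have n0 : 0 <= (n%:R : R) by [].
  by have := enorm_le_norm w; have := normr_ge0 w; nra.
have H : a ^+ (d * l) * rho (a * k) <= (Ck + 1) * ((2 + n%:R) * (1 + `|w|)) ^+ N * rho k.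
  apply: (@le_trans _ _ ((1 + a) ^+ (d * l) * (Ck * (1 + a) ^+ M * rho k))).
    rewrite ler_pM ?exprn_ge0 ?(ltW a0) ?(ltW rak)//; last exact: rho_growth.
    by rewrite lerXn2r ?nnegrE; lra.
  apply: (@le_trans _ _ (Ck * (1 + a) ^+ N * rho k)).
    by rewrite /N exprD le_eqVlt; apply/orP; left; apply/eqP; ring.
  rewrite ler_wpM2r ?(ltW rk)// ler_pM ?exprn_ge0//; [lra|lra|].
  by rewrite lerXn2r ?nnegrE//; lra.
have c2 : 0 <= C * 2 ^+ l by rewrite mulr_ge0 ?exprn_ge0 ?(ltW C0).
have -> : C * (2 ^+ l * a ^+ (d * l)) * rho (a * k) = C * 2 ^+ l * (a ^+ (d * l) * rho (a * k)) by ring.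
apply: (@le_trans _ _ (C * 2 ^+ l * ((Ck + 1) * ((2 + n%:R) * (1 + `|w|)) ^+ N * rho k))).
  by rewrite ler_wpM2l.
by rewrite exprMn le_eqVlt; apply/orP; left; apply/eqP; ring.
Qed.

(** The gradient bound at y = x / k, with B rho(k) as growth constant, shows that U(x, k^d) and U(0,
    k^d) differ by at most Cs B rho(k) |x| / k, which is negligible against rho(k) on bounded
    sets. *)
Lemma stabilization_estimate (Cs B : R) N l (k0 : R) : 0 < B ->
  (forall k B y, 0 < k -> 0 < B -> `|y| <= 1 ->
    (forall w, normc (U (k *: w) (k ^+ d / 2)) <= B * (1 + `|w|) ^+ N) ->
    normc (U (k *: y) (k ^+ d) - U 0 (k ^+ d)) <= Cs * (B * `|y|)) ->
  (forall k w, k0 <= k -> normc (U (k *: w) (k ^+ d / 2)) <= B * rho k * (1 + `|w|) ^+ N) ->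
  U 0 (k ^+ d) / (rho k)%:C @[k --> +oo] --> l ->
  forall r e, 0 < e -> \forall k \near +oo, forall x, `|x| <= r ->
    normc (U x (k ^+ d) / (rho k)%:C - l) < e.
Proof.
move=> B0 spread growth /cvg_normcP lim r e e0.
have e2 : 0 < e / 2 by rewrite divr_gt0.
near=> k => x xr.
have k_gt0 : 0 < k by near: k; apply: nbhs_pinfty_gt; exact: num_real.
have kX : X <= k by near: k; apply: nbhs_pinfty_ge; exact: num_real.
have kk0 : k0 <= k by near: k; apply: nbhs_pinfty_ge; exact: num_real.
have kr : r <= k by near: k; apply: nbhs_pinfty_ge; exact: num_real.
have kC : 2 * (`|Cs| * B * `|r|) / e < k by near: k; apply: nbhs_pinfty_gt; exact: num_real.
have rk := rho_gt0 kX.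
have l2 : normc (U 0 (k ^+ d) / (rho k)%:C - l) < e / 2 by near: k; exact: lim.
have y1 : `|k^-1 *: x| <= 1.
  by rewrite normrZ normfV gtr0_norm// mulrC ler_pdivrMr// mul1r (le_trans xr).
have := spread k (B * rho k) _ k_gt0 (mulr_gt0 B0 rk) y1 (fun w => growth k w kk0).
rewrite scalerA mulfV ?gt_eqF// scale1r => D.
have -> : U x (k ^+ d) / (rho k)%:C - l =
    (U x (k ^+ d) - U 0 (k ^+ d)) / (rho k)%:C + (U 0 (k ^+ d) / (rho k)%:C - l).
  by rewrite mulrBl addrA subrK.
apply: (le_lt_trans (le_normcD _ _)); rewrite [ltRHS](splitr e) ler_ltD//.
rewrite normcM normcV normcR gtr0_norm// ler_pdivrMr//; apply: (le_trans D).
rewrite normrZ normfV (gtr0_norm k_gt0).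
have xr' : `|x| <= `|r| by rewrite (le_trans xr)// ler_norm.
have kC' : `|Cs| * B * `|r| <= e / 2 * k.
  by move: kC; rewrite ltr_pdivrMr// => /ltW; lra.
have K : `|Cs| * B * `|x| / k <= e / 2.
  rewrite ler_pdivrMr//; apply: le_trans kC'.
  by rewrite ler_wpM2l// mulr_ge0// ltW.
apply: (@le_trans _ _ (`|Cs| * B * `|x| / k * rho k)); last by rewrite ler_wpM2r// ltW.
have -> : Cs * (B * rho k * (k^-1 * `|x|)) = Cs * (B * `|x| / k * rho k) by ring.
rewrite -!mulrA ler_wpM2r ?ler_norm// !mulr_ge0 ?invr_ge0 ?(ltW B0) ?(ltW k_gt0) ?(ltW rk)//.
Unshelve. all: by end_near. Qed.

End Stabilization.

(** * Uniform convergence and conclusion *)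

Lemma uniform_cvg_complex {R : realType} {T : choiceType} (K : set T) (F : R -> T -> R[i])
    (l : R[i]) :
  (forall e : R, 0 < e -> \forall t \near +oo, forall x, K x -> normc (F t x - l) < e) ->
  {uniform K, (fun x => F t x) @[t --> +oo] --> (fun=> l)}.
Proof.
move=> H Q /uniform_nbhs[E [entE EQ]].
move: entE; rewrite -entourage_from_ballE => -[e /= e0 eE].
have er : e = (complex.Re e)%:C.
  by case: e e0 {eE} => a b; rewrite ltcE /= => /andP[/eqP -> _].
have re0 : 0 < complex.Re e by move: e0; rewrite {1}er ltcR.
apply: filterS (H _ re0) => t Ht; apply: EQ => x Kx; apply: eE => /=.
rewrite /ball /= er -[ltLHS]/((normc (l - F t x))%:C) ltcR -normcN opprB.
exact: Ht.
Qed.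

Theorem corollary7p1 (R : realType) (n d : nat) (Gamma : set 'rV[R]_n)
    (P : mpoly n R[i]) (f : ('rV[R]_n -> R[i]) -> R[i])
    (U : 'rV[R]_n -> R -> R[i]) (alpha : R) (L : R -> R)
    (hGamma : closed_convex_cone Gamma)
    (hd : (0 < d)%N)
    (hP : P \is ishomog1 d mdeg)
    (hPGamma : forall u, Gamma u -> u <> 0 ->
       complex.Re (meval (imag_vec u) P) < 0)
    (hf : tempered_distribution f)
    (hsupp : dsupp (dfourier f) `<=` Gamma)
    (hUgrowth : slow_growth U)
    (hU : cauchy_solution d P f U)
    (hL : slowly_varying L)
    (hstab : stabilizes_along_dcurves d
       (fun lambda => lambda `^ alpha * L lambda) U) :
  let T t := t `^ (alpha / d%:R) * L (t `^ d%:R^-1) in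
  exists l : R[i],
    (forall x, U x t / (T t)%:C @[t --> +oo] --> l) /\
    (forall K : set 'rV[R]_n, compact K ->
       {uniform K, (fun x => U x t / (T t)%:C) @[t --> +oo] --> (fun=> l)}).
Proof.
move=> T; have P_deg : forall m, m \in msupp P -> mdeg m = d := dhomog_mf hP.
have [U_regular U_pde U_initial] := hU.
have [c c0 coneP] := cone_constant hGamma hd P_deg hPGamma.
(* On Gamma both quantities are nonpositive, so such a point lies outside the support of f^ and has
   an annihilating neighbourhood. *)
have annihilated u : 0 < rsymbol P u \/ 0 < excess d P c u ->
    exists O, annihilating f O /\ O u.
  move=> pos; apply: contrapT => nO.
  have /hsupp/coneP[q0 e0] : dsupp (dfourier f) u.
    by move=> [W [oW Wu fW]]; apply: nO; exists W.
  by case: pos; rewrite ltNge ?q0 ?e0.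
have [X [M [Ck [X0 Ck0 rho0 rhoG]]]] := regular_growth alpha hL.
have [[U0 U0P] [C [l [lambda0 [C0 _ HC]]]]] := hstab.
have [B [N [B0 growth]]] := dcurve_growth hd X0 Ck0 rho0 rhoG C0 HC.
have [Cs spread] := spreading P_deg hd c0 U_regular U_pde hUgrowth U_initial annihilated N.
(* The point (0, 1) of the sphere travels along the time axis; its limit is the constant of the
   conclusion. *)
have lim0 : U 0 (k ^+ d) / (k `^ alpha * L k)%:C @[k --> +oo] --> U0 0 1.
  have s1 : dot (0 : 'rV[R]_n) 0 + 1 ^+ 2 = 1.
    by rewrite -(scale0r (0 : 'rV[R]_n)) dotZl mul0r add0r expr1n.
  have := U0P 0 1 ltr01 s1.
  by under eq_fun do rewrite scaler0 mulr1.
have growth' k w : Num.max (2 * X) (2 * lambda0) <= k ->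
    normc (U (k *: w) (k ^+ d / 2)) <= B * (k `^ alpha * L k) * (1 + `|w|) ^+ N.
  by rewrite ge_max => /andP[]; exact: growth.
have est := stabilization_estimate rho0 B0 spread growth' lim0.
(* Substitute k = t^(1/d), for which k^d = t and k^alpha L(k) = T(t). *)
have {}est : forall r e, 0 < e -> \forall t \near +oo, forall x, `|x| <= r ->
    normc (U x t / (T t)%:C - U0 0 1) < e.
  move=> r e e0; have [k1 [_ k1P]] := est r e e0.
  near=> t; have t0 : 0 < t by near: t; apply: nbhs_pinfty_gt; exact: num_real.
  have dn : d%:R != 0 :> R by rewrite pnatr_eq0 -lt0n.
  have td : (t `^ d%:R^-1) ^+ d = t.
    by rewrite -powR_mulrn ?powR_ge0// -powRrM mulVf// powRr1// ltW.
  have := k1P (t `^ d%:R^-1); rewrite td -powRrM (mulrC _ alpha); apply.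
  rewrite ltNge; apply/negP => tk.
  have k10 : 0 <= k1 by apply: le_trans tk; exact: powR_ge0.
  have : t <= k1 ^+ d by rewrite -[leLHS]td lerXn2r ?nnegrE ?powR_ge0.
  by rewrite leNgt; apply/negP/negPn; near: t; apply: nbhs_pinfty_gt; exact: num_real.
exists (U0 0 1); split=> [x|K cK].
  apply/cvg_normcP => e e0.
  by apply: filterS (est `|x| e e0) => t; apply.
apply: (uniform_cvg_complex (F := fun t x => U x t / (T t)%:C)) => e e0.
have [r [_ rP]] := compact_bounded cK.
apply: filterS (est (r + 1) e e0) => t Ht x Kx; apply: Ht.
by apply: (rP (r + 1)) => //; rewrite ltrDl.
Unshelve. all: by end_near. Qed.
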